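(* Let $G$ be any infinite rooted tree of uniformly bounded degree each of whose vertices has at least two offspring. Then there exists $T_0 \in (0,\infty)$ such that if $T \geq T_0$ then the random stirring model with parameter $T$ on $G$ contains infinite cycles almost surely.
   Context: The random stirring model on a graph $G$ is the process $(\sigma_t)_{t\ge 0}$ of permutations of $V(G)$ which starts at the identity at time $0$ and in which, independently for each edge $e\in E(G)$, the transposition of the two endpoints of $e$ is performed (composed) at each point of a rate-one Poisson process on $[0,\infty)$. The random stirring model with parameter $T$ is the random permutation $\sigma_T$. An infinite cycle is a cycle of the permutation containing infinitely many vertices. In a rooted tree, the offspring of a vertex $v$ are its neighbours that are farther from the root than $v$. *)

(* Defs.v *)
From HB Require Import structures.
From mathcomp Require Import all_boot all_order all_algebra.
From mathcomp Require Import all_classical all_reals all_analysis.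
From Stdlib Require Import List.

Set Implicit Arguments.
Unset Strict Implicit.
Unset Printing Implicit Defensive.

Import Order.TTheory GRing.Theory Num.Theory.
Local Open Scope classical_set_scope.
Local Open Scope ring_scope.

(* (V, r, parent) is a rooted tree: the root is its own "parent" (it has
   no parent) and every vertex reaches the root by following parents.
   The edges of the tree are the pairs {v, parent v} for v <> r. *)
Definition rooted_tree (V : Type) (r : V) (parent : V -> V) : Prop :=
  parent r = r /\ forall v : V, exists n : nat, iter n parent v = r.

Definition tadj (V : Type) (r : V) (parent : V -> V) (u v : V) : Prop :=
  (v <> r /\ parent v = u) \/ (u <> r /\ parent u = v).

Definition offspring (V : Type) (r : V) (parent : V -> V) (v w : V) : Prop :=
  w <> r /\ parent w = v.

Definition infinite_vertex_set (V : Type) : Prop :=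
  ~ exists l : list V, forall v : V, In v l.

Definition uniformly_bounded_degree (V : Type) (r : V) (parent : V -> V) :
  Prop :=
  exists D : nat, forall v : V, exists l : list V,
    (length l <= D)%N /\ forall w : V, tadj r parent v w -> In w l.

Definition at_least_two_offspring (V : Type) (r : V) (parent : V -> V) :
  Prop :=
  forall v : V, exists w1 w2 : V,
    w1 <> w2 /\ offspring r parent v w1 /\ offspring r parent v w2.

(* edge set of the tree: edge indexed by its lower endpoint v <> r *)
Definition tedge (V : Type) (r : V) : Type := {v : V | v <> r}.

Definition tends (V : Type) (r : V) (parent : V -> V) (e : tedge r) : V * V :=
  (proj1_sig e, parent (proj1_sig e)).

Definition incident (V E : Type) (ends : E -> V * V) (e : E) (x : V) : Prop :=
  (ends e).1 = x \/ (ends e).2 = x.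

Definition crosses (V E : Type) (ends : E -> V * V) (e : E) (x y : V) :
  Prop :=
  ends e = (x, y) \/ ends e = (y, x).

(* Given the set of ring times of each edge ([ring e t] = the Poisson clock
   of e rings at time t), [stirring_path ends ring T v w] says that the
   particle started at v at time 0, which is moved across an edge each
   time an edge incident to its current position rings, is at w at time
   T.  Equivalently w = sigma_T v, where sigma_T is the composition (in
   time order) of the transpositions of the rung edges. *)
Definition stirring_path (R : realType) (V E : Type) (ends : E -> V * V)
    (ring : E -> R -> Prop) (T : R) (v w : V) : Prop :=
  exists (n : nat) (x : nat -> V) (s : nat -> R) (e : nat -> E),
    [/\ x 0%N = v, s 0%N = 0, x n = w,
      (forall i : nat, (i < n)%N ->
         [/\ s i < s i.+1, s i.+1 <= T,
             crosses ends (e i) (x i) (x i.+1),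
             ring (e i) (s i.+1) &
             forall (f : E) (t : R), incident ends f (x i) ->
               s i < t -> t < s i.+1 -> ~ ring f t]) &
      (forall (f : E) (t : R), incident ends f (x n) ->
         s n < t -> t <= T -> ~ ring f t)].

Definition cycle_of (V : Type) (sigma : V -> V) (v : V) : set V :=
  [set w | exists n : nat, iter n sigma v = w \/ iter n sigma w = v].

Definition has_infinite_cycle (V : Type) (sigma : V -> V) : Prop :=
  exists v : V, ~ exists l : list V, forall w : V, cycle_of sigma v w -> In w l.

Definition stirring_has_infinite_cycle (R : realType) (V E : Type)
    (ends : E -> V * V) (ring : E -> R -> Prop) (T : R) : Prop :=
  exists sigma : V -> V,
    [/\ bijective sigma,
        (forall v : V, stirring_path ends ring T v (sigma v)),
        (forall sigma' : V -> V,
            (forall v : V, stirring_path ends ring T v (sigma' v)) ->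
            sigma' = sigma) &
        has_infinite_cycle sigma].

(* Rate-one Poisson processes via i.i.d. Exp(1) inter-arrival times.    *)

Definition mutually_independent (d : measure_display) (Omega : measurableType d)
    (R : realType) (P : probability Omega R) (I : Type) (X : I -> Omega -> R)
    : Prop :=
  forall (n : nat) (f : 'I_n -> I), injective f ->
  forall B : 'I_n -> set R, (forall k, measurable (B k)) ->
    P (\bigcap_(k in [set: 'I_n]) (X (f k) @^-1` B k)) =
    (\prod_(k < n) P (X (f k) @^-1` B k))%E.

Definition exp1_distributed (d : measure_display) (Omega : measurableType d)
    (R : realType) (P : probability Omega R) (X : Omega -> R) : Prop :=
  forall t : R, 0 <= t -> P [set w | t < X w] = (expR (- t))%:E.

Definition arrival (R : realType) (E Omega : Type)
    (tau : E -> nat -> Omega -> R) (e : E) (k : nat) (w : Omega) : R :=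
  \sum_(j < k.+1) tau e j w.

Definition rings (R : realType) (E Omega : Type)
    (tau : E -> nat -> Omega -> R) (w : Omega) (e : E) (t : R) : Prop :=
  exists k : nat, arrival tau e k w = t.

(* Main.v *)
Require Import Defs.
From HB Require Import structures.
From mathcomp Require Import all_boot all_order all_algebra.
From mathcomp Require Import all_classical all_reals all_analysis.
From mathcomp Require Import zify ring lra.

Set Implicit Arguments.
Unset Strict Implicit.
Unset Printing Implicit Defensive.

Import Order.TTheory GRing.Theory Num.Theory.
Local Open Scope classical_set_scope.
Local Open Scope ring_scope.

(** The cycle of a vertex v is traced by the walk that follows the particle
    of v through time [0, T], and restarts at time 0 from the place reached at
    time T.  Time is cut into N slots, so that the clocks become independent
    bits, and the walk is followed by revealing only the bits that it meets.

    Suppose that the walk is started at v at time 0.  While it moves in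
    unexplored territory it drifts away from the root, because every vertex
    has at least two offspring.  On its way down it leaves, with probability
    bounded below, many vertices x, entered at some time t, with an unexplored
    child w, such that no other clock at x rings during a window of length
    about 1 before t.  To close up, the walk must come back through x; before it
    can leave x upwards at time t it has to wait there during the whole window,
    and with probability at least 1/2 the clock of w rings in the window and
    sends the walk into a fresh subtree, where the situation is as at the
    start.  A potential argument then bounds the probability of closing up
    before reaching depth n by some al < 1, which depends neither on n nor on
    N, provided T is large.

    The walks from k vertices with disjoint subtrees read disjoint sets of
    bits, so all of them close up with probability at most al ^ k.  Let N, then
    n and finally k tend to infinity.  That sigma_T exists is proved by cutting
    [0, T] into intervals so short that the edges ringing in one of them form
    only finite clusters. *)

(** * Outer probability and revealed bits *)

(** The potential argument closes on itself: [al] bounds the failure from a fresh subtree, and is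
    also the value obtained each time a level sends the walk into one. Outside the window the clocks
    of [x] and [w] race on equal terms, for the values 1 and [al], so a level is worth a factor
    [ze >= (1 + al) / 2]. Entering a fresh subtree with [J] levels behind costs at most
    [al * ze ^+ J]; replacing this by a chord, linear in [J], leaves only the expected number of
    levels to estimate, candidate by candidate. A block yields about [m' * c2 / 6] of them, while
    running out of time costs [mu * m] with [mu] of order [1 / T]: this is where [T] must be large.
    The obstacle is that every lap reads the same bits again. A block is therefore kept shorter than
    a lap minus a window, so that it meets neither its own past nor a window inspected on the way;
    in known territory the moves are not estimated at all, only the passages through levels are
    priced. Bounds are taken relative to the weight of the revealed bits, so no conditional
    probability is ever formed. *)

Section OuterBound.
Context (d : measure_display) (Om : measurableType d) (R : realType).
Variable P : probability Om R.

(* Outer probability: the failure events below need not be measurable. *)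
Definition bd (A : set Om) (r : R) :=
  exists B, [/\ measurable B, A `<=` B & (P B <= r%:E)%E].

Lemma bd_sub A A' r r' : A `<=` A' -> r <= r' -> bd A' r -> bd A r'.
Proof.
move=> AA' rr' [B [mB A'B PB]]; exists B; split=> //; first exact: subset_trans A'B.
by rewrite (le_trans PB)// lee_fin.
Qed.

Lemma bd0 (A : set Om) r : (forall w, ~ A w) -> 0 <= r -> bd A r.
Proof.
by move=> A0 r0; exists set0; split; [|move=> w /A0|rewrite measure0 lee_fin].
Qed.

Lemma bd_setU A B a b : bd A a -> bd B b -> bd (A `|` B) (a + b).
Proof.
move=> [A' [mA AA' PA]] [B' [mB BB' PB]]; exists (A' `|` B'); split.
- exact: measurableU.
- exact: setUSS.
- rewrite EFinD; apply: le_trans (measureU2 _ mA mB) _; exact: leeD.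
Qed.

Lemma bd_seq (T : eqType) (s : seq T) (A : T -> set Om) (f : T -> R) :
  (forall x, x \in s -> bd (A x) (f x)) ->
  bd [set w | exists2 x, x \in s & A x w] (\sum_(x <- s) f x).
Proof.
elim: s => [|x s IH] H.
  by rewrite big_nil; apply: bd0 => // w [].
rewrite big_cons.
apply: bd_sub (bd_setU (H x _) (IH _)); rewrite ?mem_head//.
  move=> w [y]; rewrite inE => /orP[/eqP->|ys] Ay; [by left|by right; exists y].
by move=> y ys; apply: H; rewrite inE ys orbT.
Qed.

Lemma bd_negligible A : (forall e : R, 0 < e -> bd A e) -> P.-negligible A.
Proof.
move=> H; have /choice[B HB] n : exists B, [/\ measurable B, A `<=` B &
    (P B <= (n.+1%:R^-1)%:E)%E] by apply: H; rewrite invr_gt0.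
exists (\bigcap_n B n); split.
- by apply: bigcapT_measurable => n; case: (HB n).
- apply/eqP; rewrite eq_le measure_ge0 andbT; apply/lee_addgt0Pr => e e0.
  rewrite add0e; have [n ne] : exists n, n.+1%:R^-1 <= e.
    exists (Num.bound e^-1); rewrite invf_ple ?posrE//.
    by apply/ltW/(lt_trans (archi_boundP _)); rewrite ?ltr_nat ?invr_ge0 ?ltW.
  case: (HB n) => mB AB PB; apply: (@le_trans _ _ (P (B n))); last first.
    by rewrite (le_trans PB)// lee_fin.
  apply: le_measure; rewrite ?inE//; last exact: bigcap_inf.
  by apply: bigcapT_measurable => k; case: (HB k).
- by move=> w Aw n _; case: (HB n) => _ AB _; exact: AB.
Qed.

(** The covers [B n] need not increase. The intersection [C m] of all [B n] with [m <= n] does, lies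
    in [B m], and still contains [A m] because [A] increases. This allows the depth to tend to
    infinity for events not known to be measurable. *)
Lemma bd_incr (A : nat -> set Om) r :
  (forall n m, (n <= m)%N -> A n `<=` A m) -> (forall n, bd (A n) r) ->
  bd (\bigcup_n A n) r.
Proof.
move=> Ai /choice[B HB].
have mB n : measurable (B n) by case: (HB n).
pose C m := \bigcap_(n in [set n | (m <= n)%N]) B n.
have mC m : measurable (C m) by apply: bigcap_measurableType => n _.
exists (\bigcup_m C m); split.
- exact: bigcupT_measurable.
- move=> w [n _ An]; exists n => // m /= nm; case: (HB m) => _ AB _.
  by apply: AB; apply: Ai An.
- have cC : {homo C : n m / (n <= m)%N >-> (n <= m)%O}.
    move=> n m nm; apply/subsetPset => w Cn k /= mk; apply: Cn => /=; exact: leq_trans mk.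
  have := @nondecreasing_cvg_mu _ _ _ P _ mC (bigcupT_measurable _ mC) cC.
  move=> /cvg_lim <- //; apply: lime_le.
    apply: ereal_nondecreasing_is_cvgn => n m nm.
    by apply: le_measure; rewrite ?inE//; apply/subsetPset/cC.
  apply: nearW => n /=; case: (HB n) => _ _; apply: le_trans.
  by apply: le_measure; rewrite ?inE//; apply: bigcap_inf => /=.
Qed.

End OuterBound.

(** * Revealed bits, their weights, and averages over further bits *)

Section Info.
Variables (C : eqType) (Om : Type) (R : realType) (X : C -> Om -> bool) (q : R).

Definition wt (b : bool) : R := if b then 1 - q else q.

Definition cyl (s : seq (C * bool)) : set Om :=
  [set w | forall cb, cb \in s -> X cb.1 w = cb.2].

Definition pc (s : seq (C * bool)) : R := \prod_(cb <- s) wt cb.2.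

Fixpoint get (s : seq (C * bool)) (c : C) : option bool :=
  if s is cb :: s' then if cb.1 == c then Some cb.2 else get s' c else None.

Lemma get_mem s c b : get s c = Some b -> (c, b) \in s.
Proof.
elim: s => //= -[c' b'] s IH /=; case: eqP => [->|_]; last by rewrite inE => /IH ->; rewrite orbT.
by move=> [->]; rewrite inE eqxx.
Qed.

Lemma cyl_get s w c b : cyl s w -> get s c = Some b -> X c w = b.
Proof. by move=> cw /get_mem /cw. Qed.

Lemma get_None s c : (get s c == None) = (c \notin unzip1 s).
Proof.
elim: s => //= -[c' b'] s IH /=; rewrite inE negb_or (eq_sym c).
by case: (c' =P c).
Qed.

Lemma cyl_cons s c b w : cyl ((c, b) :: s) w <-> X c w = b /\ cyl s w.
Proof.
split=> [H|[Xc H] cb].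
  by split=> [|cb cbs]; [apply: (H (c, b)); rewrite mem_head|apply: H; rewrite inE cbs orbT].
by rewrite inE => /orP[/eqP->|/H].
Qed.

Lemma pc_cons s c b : pc ((c, b) :: s) = wt b * pc s.
Proof. by rewrite /pc big_cons. Qed.

End Info.

Section Reveal.
Context (d : measure_display) (Om : measurableType d) (R : realType).
Variables (P : probability Om R) (C : eqType) (X : C -> Om -> bool) (q : R).
Hypothesis q01 : 0 <= q <= 1.

Lemma wt_ge0 b : 0 <= wt q b. Proof. by case/andP: q01 => q0 q1; case: b; rewrite /wt; lra. Qed.

Lemma pc_ge0 (s : seq (C * bool)) : 0 <= pc q s.
Proof. by apply: prodr_ge0 => cb _; exact: wt_ge0. Qed.

(* The conditional probability of F given the revealed bits s is at most v. *)
Definition bnd (s : seq (C * bool)) (F : set Om) (v : R) :=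
  bd P (cyl X s `&` F) (v * pc q s).

Lemma bnd_le s F v v' : v <= v' -> bnd s F v -> bnd s F v'.
Proof. by move=> vv'; apply: bd_sub => //; rewrite ler_wpM2r// pc_ge0. Qed.

Lemma bnd_sub s F F' v : (forall w, cyl X s w -> F w -> F' w) -> bnd s F' v -> bnd s F v.
Proof. by move=> FF'; apply: bd_sub => // w [cw Fw]; split=> //; exact: FF'. Qed.

Lemma bnd_False s F v : 0 <= v -> (forall w, cyl X s w -> ~ F w) -> bnd s F v.
Proof.
move=> v0 F0; apply: bd0; last by rewrite mulr_ge0// pc_ge0.
by move=> w [cw]; exact: F0.
Qed.

Lemma bnd_reveal s c F v1 v0 :
  bnd ((c, true) :: s) F v1 -> bnd ((c, false) :: s) F v0 ->
  bnd s F ((1 - q) * v1 + q * v0).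
Proof.
rewrite /bnd !pc_cons /= => b1 b0; apply: bd_sub (bd_setU b1 b0); last by nra.
move=> w [cw Fw]; case Xc : (X c w); [left|right]; split=> //; exact/cyl_cons.
Qed.

(* Expectation of k after the bits of cs unknown to s have been revealed. *)
Fixpoint Ex (s : seq (C * bool)) (cs : seq C) (k : seq (C * bool) -> R) : R :=
  if cs is c :: cs' then
    if get s c is Some _ then Ex s cs' k
    else (1 - q) * Ex ((c, true) :: s) cs' k + q * Ex ((c, false) :: s) cs' k
  else k s.

(* [ext s cs s']: s' extends s by revealing exactly the coordinates of cs that s does not know *)
Fixpoint ext (s : seq (C * bool)) (cs : seq C) (s' : seq (C * bool)) : Prop :=
  if cs is c :: cs' then
    if get s c is Some _ then ext s cs' s'
    else ext ((c, true) :: s) cs' s' \/ ext ((c, false) :: s) cs' s'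
  else s' = s.

Lemma bnd_Ex s cs F k : (forall s', ext s cs s' -> bnd s' F (k s')) -> bnd s F (Ex s cs k).
Proof.
elim: cs s => [|c cs IH] s H /=; first exact: H.
move: H => /=; case: (get s c) => [b|] H; first exact: IH.
by apply: bnd_reveal; apply: IH => s' es'; apply: H; [left|right].
Qed.

Lemma ext_get s cs s' c b : ext s cs s' -> get s c = Some b -> get s' c = Some b.
Proof.
elim: cs s => [|c' cs IH] s /=; first by move=> ->.
case gc' : (get s c') => [b'|] => [/IH|[] es' gc]; first exact.
- by apply: (IH _ es') => /=; case: eqP => // e; rewrite -e gc' in gc.
- by apply: (IH _ es') => /=; case: eqP => // e; rewrite -e gc' in gc.
Qed.

Lemma ext_notin s cs s' c : ext s cs s' -> c \notin cs -> get s' c = get s c.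
Proof.
elim: cs s => [|c' cs IH] s /=; first by move=> ->.
rewrite inE negb_or => + /andP[cc' ccs].
case gc' : (get s c') => [b'|] => [/IH|[] /IH] -> //=; by rewrite eq_sym (negbTE cc').
Qed.

Lemma ext_in s cs s' c : ext s cs s' -> c \in cs -> exists b, get s' c = Some b.
Proof.
elim: cs s => [|c' cs IH] s //=; rewrite inE.
case gc' : (get s c') => [b'|] => [es'|[] es'] /orP[/eqP->|]; try exact: IH es'.
- by exists b'; apply: ext_get es' _.
- by exists true; apply: ext_get es' _; rewrite /= eqxx.
- by exists false; apply: ext_get es' _; rewrite /= eqxx.
Qed.

Lemma ext_uniq s cs s' : ext s cs s' -> uniq (unzip1 s) -> uniq (unzip1 s').
Proof.
elim: cs s => [|c cs IH] s /=; first by move=> ->.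
case gc : (get s c) => [b|]; first exact: IH.
by move=> [] /IH H us; apply: H => /=; rewrite us andbT -get_None gc.
Qed.

Lemma ext_all s cs s' (p : pred C) : ext s cs s' -> all p (unzip1 s) -> all p cs -> all p (unzip1 s').
Proof.
elim: cs s => [|c cs IH] s /=; first by move=> ->.
by case gc : (get s c) => [b|] => [/IH H s0|[] /IH H s0] /andP[pc pcs]; apply: H => //=; rewrite pc.
Qed.

Lemma Ex_le s cs k v : (forall s', ext s cs s' -> k s' <= v) -> Ex s cs k <= v.
Proof.
elim: cs s => [|c cs IH] s H /=; first exact: H.
move: H => /=; case: (get s c) => [b|] H; first exact: IH.
have h1 := IH ((c, true) :: s) (fun s' h => H s' (or_introl h)).
have h0 := IH ((c, false) :: s) (fun s' h => H s' (or_intror h)).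
case/andP: q01 => q0 q1; nra.
Qed.

(** Bits already known to be silent only help: total silence then has conditional weight at least
    [q ^+ size cs], and [a <= a'] turns this into an upper bound. *)
Lemma Ex_allF s cs k a a' : a <= a' ->
  (forall c, c \in cs -> get s c != Some true) ->
  (forall s', ext s cs s' -> (forall c, c \in cs -> get s' c = Some false) -> k s' <= a) ->
  (forall s', ext s cs s' -> k s' <= a') ->
  Ex s cs k <= q ^+ size cs * a + (1 - q ^+ size cs) * a'.
Proof.
move=> aa'; elim: cs s => [|c cs IH] s Hs Ha Ha' /=.
  by rewrite expr0 mul1r subrr mul0r addr0; apply: Ha.
have qn : 0 <= q ^+ size cs <= 1.
  by rewrite exprn_ge0 ?exprn_ile1//; case/andP: q01.
have Hs' : forall c', c' \in cs -> get s c' != Some true.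
  by move=> c' h; apply: Hs; rewrite inE h orbT.
move: Ha Ha' => /=; case gc : (get s c) => [b|] Ha Ha'.
  have b0 : b = false by have := Hs c; rewrite mem_head gc; case: (b) => // /(_ isT).
  have h : Ex s cs k <= q ^+ size cs * a + (1 - q ^+ size cs) * a'.
    apply: IH => // s' e H; apply: Ha => // c'; rewrite inE => /orP[/eqP->|/H//].
    by rewrite (ext_get e gc) b0.
  case/andP: q01 => q0 q1; case/andP: qn => qn0 qn1; rewrite exprS.
  have : 0 <= q ^+ size cs * (1 - q) * (a' - a) by rewrite !mulr_ge0 ?subr_ge0.
  lra.
have h1 : Ex ((c, true) :: s) cs k <= a'.
  by apply: Ex_le => s' e; apply: Ha'; left.
have h0 : Ex ((c, false) :: s) cs k <= q ^+ size cs * a + (1 - q ^+ size cs) * a'.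
  apply: IH => [c' c'cs|s' e H|s' e] /=.
  - by case: (c =P c') => // _; exact: Hs'.
  - apply: Ha; first by right.
    move=> c'; rewrite inE => /orP[/eqP->|/H//].
    by apply: ext_get e _; rewrite /= eqxx.
  - by apply: Ha'; right.
case/andP: q01 => q0 q1; rewrite exprS.
have := lerD (ler_wpM2l (_ : 0 <= 1 - q) h1) (ler_wpM2l q0 h0).
by rewrite subr_ge0 => /(_ q1); lra.
Qed.

(** For distinct unread bits the weight of silence is exactly [q ^+ size cs], so [a] and [a'] need
    not be ordered; [Ex_one] uses the value 0 for a ring. *)
Lemma Ex_allN s cs k a a' : uniq cs -> (forall c, c \in cs -> get s c = None) ->
  (forall s', ext s cs s' -> (forall c, c \in cs -> get s' c = Some false) -> k s' <= a) ->
  (forall s' c, ext s cs s' -> c \in cs -> get s' c = Some true -> k s' <= a') ->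
  Ex s cs k <= q ^+ size cs * a + (1 - q ^+ size cs) * a'.
Proof.
elim: cs s => [|c cs IH] s /= => [_ _ Ha _|/andP[ccs ucs] Hs].
  by rewrite expr0 mul1r subrr mul0r addr0; apply: Ha.
rewrite Hs ?mem_head// => Ha Ha'.
have h1 : Ex ((c, true) :: s) cs k <= a'.
  apply: Ex_le => s' e; apply: (Ha' s' c); rewrite ?mem_head//; first by left.
  by apply: ext_get e _; rewrite /= eqxx.
have h0 : Ex ((c, false) :: s) cs k <= q ^+ size cs * a + (1 - q ^+ size cs) * a'.
  apply: IH => // [c' c'cs|s' e H|s' c' e c'cs gc'] /=.
  - by case: (c =P c') => [e|_]; [rewrite e c'cs in ccs|apply: Hs; rewrite inE c'cs orbT].
  - apply: Ha; first by right.
    move=> c'; rewrite inE => /orP[/eqP->|/H//].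
    by apply: ext_get e _; rewrite /= eqxx.
  - by apply: (Ha' s' c'); [right|rewrite inE c'cs orbT|].
case/andP: q01 => q0 q1; rewrite exprS.
have := lerD (ler_wpM2l (_ : 0 <= 1 - q) h1) (ler_wpM2l q0 h0).
by rewrite subr_ge0 => /(_ q1); lra.
Qed.

Lemma Ex_one s cs k K0 (K : C -> R) : uniq cs -> (forall c, c \in cs -> get s c = None) ->
  (forall s', ext s cs s' -> (forall c, c \in cs -> get s' c = Some false) -> k s' <= K0) ->
  (forall s' c, ext s cs s' -> c \in cs -> get s' c = Some true ->
     (forall c', c' \in cs -> c' != c -> get s' c' = Some false) -> k s' <= K c) ->
  (forall s' c c', ext s cs s' -> c \in cs -> c' \in cs -> c' != c -> get s' c = Some true ->
     get s' c' = Some true -> k s' <= 0) ->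
  Ex s cs k <= q ^+ size cs * K0 + (1 - q) * q ^+ (size cs).-1 * \sum_(c <- cs) K c.
Proof.
elim: cs s => [|c cs IH] s /= => [_ _ Ha _ _|/andP[ccs ucs] Hs].
  by rewrite expr0 mul1r big_nil mulr0 addr0; apply: Ha.
have Hs' b c' : c' \in cs -> get ((c, b) :: s) c' = None.
  by move=> c'cs /=; case: (c =P c') => [e|_]; [rewrite e c'cs in ccs|apply: Hs; rewrite inE c'cs orbT].
rewrite Hs ?mem_head// => H0 H1 H2.
have h1 : Ex ((c, true) :: s) cs k <= q ^+ size cs * K c + (1 - q ^+ size cs) * 0.
  apply: Ex_allN => // [|s' e H|s' c' e c'cs gc']; first exact: Hs'.
    apply: H1; rewrite ?mem_head//; first by left.
      by apply: ext_get e _; rewrite /= eqxx.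
    by move=> c'; rewrite inE => /orP[/eqP->|/H//]; rewrite eqxx.
  apply: (H2 s' c c'); rewrite ?mem_head// ?inE ?c'cs ?orbT//; first by left.
    by apply: contraNneq ccs => <-.
  by apply: ext_get e _; rewrite /= eqxx.
have h0 : Ex ((c, false) :: s) cs k <=
    q ^+ size cs * K0 + (1 - q) * q ^+ (size cs).-1 * \sum_(c <- cs) K c.
  apply: IH => // [|s' e H|s' c' e c'cs gc' H|s' c1 c2 e c1cs c2cs n12 g1 g2]; first exact: Hs'.
  - apply: H0; first by right.
    move=> c'; rewrite inE => /orP[/eqP->|/H//].
    by apply: ext_get e _; rewrite /= eqxx.
  - apply: H1; [by right|by rewrite inE c'cs orbT|by []|].
    move=> c2; rewrite inE => /orP[/eqP-> _|/H//].
    by apply: ext_get e _; rewrite /= eqxx.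
  - by apply: (H2 s' c1 c2); rewrite ?inE ?c1cs ?c2cs ?orbT//; right.
case/andP: q01 => q0 q1; rewrite big_cons exprS.
have := lerD (ler_wpM2l (_ : 0 <= 1 - q) h1) (ler_wpM2l q0 h0).
rewrite subr_ge0 => /(_ q1) /le_trans; apply.
rewrite mulr0 addr0 le_eqVlt; apply/orP; left; apply/eqP.
case: (cs) => [|c' cs'] /=; first by rewrite !big_nil expr0; ring.
by rewrite exprS; ring.
Qed.

End Reveal.
Arguments ext : simpl never.

(** * Elementary inequalities for powers *)

Section Num.
Variable R : realType.
Implicit Types z q : R.

(** The left side is the probability of at most one success in [k] trials. *)
Lemma binom_le1 q k : 0 <= q <= 1 -> q ^+ k + k%:R * ((1 - q) * q ^+ k.-1) <= 1.
Proof.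
move=> /andP[q0 q1]; elim: k => [|k IH]; first by rewrite mul0r addr0 expr0.
have qk : q ^+ k <= 1 by exact: exprn_ile1.
have h1 : q * (q ^+ k + k%:R * ((1 - q) * q ^+ k.-1)) <= q * 1 by exact: ler_wpM2l.
have h2 : (1 - q) * q ^+ k <= (1 - q) * 1 by apply: ler_wpM2l => //; rewrite subr_ge0.
have e : q * (k%:R * ((1 - q) * q ^+ k.-1)) = k%:R * ((1 - q) * q ^+ k).
  by case: k {IH qk h1 h2} => [|k]; rewrite ?mul0r ?mulr0// exprS /=; ring.
rewrite /= exprS -natr1; move: h1 h2; rewrite mulrDr e; lra.
Qed.

Lemma pow_convex z k : 0 <= z <= 1 -> k.+1%:R * z ^+ k <= 1 + k%:R * z ^+ k.+1.
Proof.
move=> /andP[z0 z1]; elim: k => [|k IH]; first by rewrite mul0r addr0 expr0 mulr1.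
have h1 := ler_wpM2l z0 IH.
have zk : z ^+ k.+1 <= 1 by exact: exprn_ile1.
have h2 : (1 - z) * z ^+ k.+1 <= (1 - z) * 1 by apply: ler_wpM2l => //; rewrite subr_ge0.
move: h1 h2; rewrite (exprS z k.+1) (exprS z k) -!natr1; lra.
Qed.

(** By concavity of [1 - z ^+ k] in [k], the slopes [(1 - z ^+ k) / k] decrease; [pow_convex]
    compares two consecutive ones. *)
Lemma pow_chord z J k : 0 <= z <= 1 -> (J <= k)%N -> J%:R * (1 - z ^+ k) <= k%:R * (1 - z ^+ J).
Proof.
move=> z01; elim: k => [|k IH]; first by rewrite leqn0 => /eqP->.
rewrite leq_eqVlt => /orP[/eqP->//|]; rewrite ltnS => Jk.
case: k => [|k] in IH Jk *.
  by move: Jk; rewrite leqn0 => /eqP->; rewrite mul0r expr0 subrr mulr0.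
have h := pow_convex k.+1 z01.
have h1 : k.+1%:R * (1 - z ^+ k.+2) <= k.+2%:R * (1 - z ^+ k.+1) by move: h; rewrite -!natr1; lra.
have h2 := ler_wpM2l (ler0n R J) h1.
have h3 := ler_wpM2l (ler0n R k.+2) (IH Jk).
have h4 : k.+1%:R * (J%:R * (1 - z ^+ k.+2)) <= k.+1%:R * (k.+2%:R * (1 - z ^+ J)).
  by rewrite [leRHS]mulrCA (le_trans _ h3)// mulrCA (le_trans h2)// mulrCA.
by move: h4; rewrite ler_pM2l.
Qed.

End Num.

(** * Discretised exponential clocks *)

Section Gap.
Variables (R : realType) (h : R).
Hypothesis h_gt0 : 0 < h.

Lemma gap_ex (x : R) : exists g : nat, x <= g.+1%:R * h.
Proof.
exists (Num.bound (`|x| / h)).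
rewrite -ler_pdivrMr//; apply: (@le_trans _ _ (`|x| / h)).
  by rewrite ler_pM2r ?invr_gt0// ler_norm.
apply/ltW/(lt_trans (archi_boundP _)); rewrite ?ltr_nat//.
by rewrite divr_ge0// ltW.
Qed.

(** For [x > 0] this is the ceiling of [x / h] minus one, which makes an exponential waiting time
    exactly geometric. Nonpositive [x] get the value 0. *)
Definition gap (x : R) : nat := ex_minn (gap_ex x).

Lemma gap_leE x g : (gap x <= g)%N = (x <= g.+1%:R * h).
Proof.
rewrite /gap; case: ex_minnP => m xm mmin; apply/idP/idP; last exact: mmin.
by move=> mg; rewrite (le_trans xm)// ler_pM2r// ler_nat.
Qed.

Lemma gap_gtE x g : (g < gap x)%N = (g.+1%:R * h < x).
Proof. by rewrite ltnNge gap_leE ltNge. Qed.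

Lemma gap_ub x : x <= (gap x).+1%:R * h.
Proof. by rewrite -gap_leE. Qed.

Lemma gap_lb x : 0 <= x -> (gap x)%:R * h <= x.
Proof.
case gx : (gap x) => [|g]; first by rewrite mul0r.
by move=> _; apply/ltW; rewrite -gap_gtE gx.
Qed.

Lemma measurable_gap_ge c : measurable [set x | (c <= gap x)%N].
Proof.
case: c => [|c].
  by rewrite (_ : [set x | _] = setT)//; apply/seteqP; split.
rewrite (_ : [set x | _] = `]c.+1%:R * h, +oo[%classic); first exact: measurable_itv.
by apply/seteqP; split=> x /=; rewrite gap_gtE in_itv/= andbT.
Qed.

Lemma measurable_gap_eq c : measurable [set x | gap x = c].
Proof.
rewrite (_ : [set x | _] = [set x | (c <= gap x)%N] `\` [set x | (c.+1 <= gap x)%N]).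
  by apply: measurableD; exact: measurable_gap_ge.
apply/seteqP; split=> x /=; first by move=> ->; rewrite leqnn ltnn.
by move=> [h1 h2]; apply/eqP; rewrite eqn_leq h1 andbT leqNgt; exact/negP.
Qed.

(* The summand k makes the slots of the successive rings distinct; with it the
   indicators of the slots hit by a clock are exactly i.i.d. Bernoulli. *)
Definition slot (t : nat -> R) (k : nat) : nat := (\sum_(j < k.+1) gap (t j) + k)%N.

Lemma slotS t k : slot t k.+1 = (slot t k + gap (t k.+1)).+1.
Proof. by rewrite /slot big_ord_recr /=; lia. Qed.

Lemma slot_lt t k k' : (k < k')%N -> (slot t k < slot t k')%N.
Proof.
elim: k' => // k' IH; rewrite ltnS leq_eqVlt => /orP[/eqP->|/IH]; rewrite slotS; lia.
Qed.

Lemma slot_inj t : injective (slot t).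
Proof.
move=> k k' e; case: (ltngtP k k') => // /(slot_lt t); lia.
Qed.

Lemma slot_ub (t : nat -> R) k : \sum_(j < k.+1) t j <= (slot t k).+1%:R * h.
Proof.
elim: k => [|k IH].
  by rewrite /slot !big_ord_recr !big_ord0 /= add0r addn0 add0n gap_ub.
rewrite big_ord_recr /= slotS.
have := gap_ub (t k.+1); rewrite -!natr1 natrD; lra.
Qed.

Lemma slot_lb (t : nat -> R) k : (forall j, 0 <= t j) -> (slot t k)%:R * h <= \sum_(j < k.+1) t j + k%:R * h.
Proof.
move=> t0; elim: k => [|k IH].
  by rewrite /slot !big_ord_recr !big_ord0 /= add0r addn0 add0n mul0r addr0 gap_lb.
rewrite [X in _ <= X + _]big_ord_recr /= slotS.
have := gap_lb (t0 k.+1); rewrite -!natr1 natrD; lra.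
Qed.

(* the constraints on the gaps equivalent to a given hit pattern of the slots *)
Fixpoint cons_pat (k c : nat) (b : seq bool) : seq (nat * set R) :=
  match b with
  | [::] => [:: (k, [set x | (c <= gap x)%N])]
  | false :: b' => cons_pat k c.+1 b'
  | true :: b' => (k, [set x | gap x = c]) :: cons_pat k.+1 0 b'
  end.

Fixpoint sat (t : nat -> R) (L : seq (nat * set R)) : Prop :=
  if L is (k, B) :: L' then B (t k) /\ sat t L' else True.

Lemma sat_pat t b k c : (c <= gap (t k))%N ->
  (forall i, (i < size b)%N ->
     (exists l, (\sum_(j < l.+1) gap (t (k + j)%N) + l = i + c)%N) <-> nth false b i) ->
  sat t (cons_pat k c b).
Proof.
have sum0 k0 : (\sum_(j < 1) gap (t (k0 + j)%N))%N = gap (t k0).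
  by rewrite big_ord_recr big_ord0 /= addn0.
have sumS k0 l : (\sum_(j < l.+2) gap (t (k0 + j)%N) =
    gap (t k0) + \sum_(j < l.+1) gap (t (k0.+1 + j)%N))%N.
  by rewrite big_ord_recl /= addn0; congr addn; apply: eq_bigr => i _; rewrite addSnnS.
elim: b k c => [|b0 b IH] k c ck Hb //=.
have H0 := Hb 0%N isT; case: b0 H0 {Hb} (fun i => Hb i.+1) => /= H0 Hb.
- have gk : gap (t k) = c.
    by have [[|l]] := H0.2 isT; rewrite ?sum0 ?sumS; lia.
  split=> //; apply: IH => // i ib; rewrite -(Hb i)//.
  split=> -[l]; first by move=> e; exists l.+1; rewrite sumS; lia.
  case: l => [|l]; first by rewrite sum0; lia.
  by rewrite sumS => e; exists l; lia.
- apply: IH => [|i ib].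
    rewrite ltn_neqAle ck andbT; apply/eqP => e.
    by apply/notF/H0.1; exists 0%N; rewrite sum0; lia.
  by rewrite -(Hb i)// addSnnS.
Qed.

Lemma pat_key k c b l : l \in map fst (cons_pat k c b) -> (k <= l)%N.
Proof.
elim: b k c => [|[] b IH] k c /=; rewrite ?inE; first by move=> /eqP->.
- by case/orP=> [/eqP->//|/IH]; lia.
- exact: IH.
Qed.

Lemma uniq_pat k c b : uniq (map fst (cons_pat k c b)).
Proof.
elim: b k c => [|[] b IH] k c //=.
by rewrite IH andbT; apply/negP => /pat_key; rewrite ltnn.
Qed.

End Gap.

(** * The slot bits of all edges are independent: upper bounds for cylinders *)

Section Bits.
Context (d : measure_display) (Om : measurableType d) (R : realType).
Variables (P : probability Om R) (E : eqType) (tau : E -> nat -> Om -> R).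
Hypothesis mtau : forall e k, measurable_fun setT (tau e k).
Hypothesis itau : mutually_independent P (fun ek : E * nat => tau ek.1 ek.2).
Hypothesis etau : forall e k, exp1_distributed P (tau e k).

Fixpoint satE (w : Om) (L : seq ((E * nat) * set R)) : Prop :=
  if L is (c, B) :: L' then B (tau c.1 c.2 w) /\ satE w L' else True.

Fixpoint mble (L : seq ((E * nat) * set R)) : Prop :=
  if L is (c, B) :: L' then measurable B /\ mble L' else True.

Lemma mble_nth L l0 i : mble L -> (i < size L)%N -> measurable (nth l0 L i).2.
Proof. by elim: L i => [|[c B] L IH] [|i] //= [mB mL] iL//; exact: IH. Qed.

Lemma satE_nth w L l0 : satE w L <->
  forall i, (i < size L)%N -> (nth l0 L i).2 (tau (nth l0 L i).1.1 (nth l0 L i).1.2 w).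
Proof.
elim: L => [|[c B] L IH] //=; split=> [[HB HL] [|i]//= iL|H]; first exact: IH.1.
by split; [exact: (H 0%N)|apply/IH => i iL; exact: (H i.+1)].
Qed.

Lemma indep_seq (L : seq ((E * nat) * set R)) : uniq (map fst L) -> mble L ->
  measurable [set w | satE w L] /\
  P [set w | satE w L] = (\prod_(l <- L) P (tau l.1.1 l.1.2 @^-1` l.2))%E.
Proof.
case: L => [|l0 L0].
  move=> _ _; have -> : [set w | satE w [::]] = setT by apply/seteqP; split.
  by rewrite big_nil probability_setT.
set L := l0 :: L0 => uL mL.
pose f (i : 'I_(size L)) := (nth l0 L i).1.
pose B (i : 'I_(size L)) := (nth l0 L i).2.
have finj : injective f.
  move=> i j; rewrite /f => e; apply: val_inj => /=.
  have := nth_uniq l0.1 (s := map fst L) (i := i) (j := j).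
  rewrite size_map !ltn_ord => /(_ isT isT uL).
  by rewrite !(nth_map l0)// e eqxx => /esym/eqP.
have mB i : measurable (B i) by apply: mble_nth.
have E1 : [set w | satE w L] = \bigcap_(k in [set: 'I_(size L)]) (tau (f k).1 (f k).2 @^-1` B k).
  apply/seteqP; split=> w /=; first by move=> /(satE_nth w L l0).1 H i _; exact: H.
  by move=> H; apply: (satE_nth w L l0).2 => i iL; exact: (H (Ordinal iL)).
split.
  rewrite E1; apply: fin_bigcap_measurable => [|i _]; first exact: finite_finset.
  by rewrite -[X in measurable X]setTI; apply: mtau.
rewrite E1 (itau finj mB); rewrite (big_nth l0) big_mkord.
by [].
Qed.

Variable h : R.
Hypothesis h_gt0 : 0 < h.
Let q := expR (- h).

Lemma q_01 : 0 <= q <= 1.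
Proof. by rewrite /q expR_ge0 /= -[leRHS]expR0 ler_expR oppr_le0 ltW. Qed.

Lemma P_gap_ge e k c : P (tau e k @^-1` [set x | (c <= gap h_gt0 x)%N]) = (q ^+ c)%:E.
Proof.
case: c => [|c].
  by rewrite (_ : _ @^-1` _ = setT) ?probability_setT//; apply/seteqP; split.
rewrite (_ : _ @^-1` _ = [set w | c.+1%:R * h < tau e k w]).
  by rewrite etau ?mulr_ge0 ?ltW// -mulrN expRM_natl.
by apply/seteqP; split=> w /=; rewrite gap_gtE.
Qed.

Lemma P_gap_eq e k c : P (tau e k @^-1` [set x | gap h_gt0 x = c]) = ((1 - q) * q ^+ c)%:E.
Proof.
pose A c := tau e k @^-1` [set x | (c <= gap h_gt0 x)%N].
have mA n : measurable (A n).
  rewrite -[X in measurable X]setTI; apply: mtau => //; exact: measurable_gap_ge.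
rewrite (_ : _ @^-1` _ = A c `\` A c.+1).
  have PA n : P (A n) = (q ^+ n)%:E by exact: P_gap_ge.
  have := measureD (mu := P) (mA c) (mA c.+1); rewrite [X in (X < _)%E -> _](PA c) ltry => /(_ isT) ->.
  rewrite (_ : A c `&` A c.+1 = A c.+1); last by apply/setIidPr => w; rewrite /A /=; lia.
  transitivity ((q ^+ c)%:E - (q ^+ c.+1)%:E)%E; first by congr (_ - _)%E; exact: P_gap_ge.
  by rewrite -EFinB exprS mulrBl mul1r.
apply/seteqP; split=> w; rewrite /A /=; first by move=> ->; rewrite leqnn ltnn.
by move=> [h1 h2]; apply/eqP; rewrite eqn_leq h1 andbT leqNgt; exact/negP.
Qed.

Definition hit (c : E * nat) (w : Om) : bool :=
  `[< exists k, slot h_gt0 (tau c.1 ^~ w) k = c.2 >].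

Let L1 (e : E) (b : seq bool) := [seq ((e, kB.1), kB.2) | kB <- cons_pat h_gt0 0 0 b].

(** The factor [q ^+ c] pays for the silent slots already counted in the gap under way. *)
Lemma prod_L1 e k c b :
  (\prod_(l <- [seq ((e, kB.1), kB.2) | kB <- cons_pat h_gt0 k c b])
     P (tau l.1.1 l.1.2 @^-1` l.2) = (q ^+ c * \prod_(x <- b) wt q x)%:E)%E.
Proof.
rewrite big_map /=; elim: b k c => [|[] b IH] k c /=.
- by rewrite big_seq1 big_nil mulr1 P_gap_ge.
- rewrite big_cons IH P_gap_eq big_cons expr0 mul1r -EFinM /=; congr EFin.
  by rewrite /wt; ring.
- by rewrite IH big_cons /= /wt exprS; congr EFin; ring.
Qed.

Lemma mble_cat L L' : mble (L ++ L') <-> mble L /\ mble L'.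
Proof. by elim: L => [|[c B] L IH] /=; rewrite ?IH; tauto. Qed.

Lemma satE_cat w L L' : satE w (L ++ L') <-> satE w L /\ satE w L'.
Proof. by elim: L => [|[c B] L IH] /=; rewrite ?IH; tauto. Qed.

Lemma mble_L1 e b : mble (L1 e b).
Proof.
rewrite /L1; move: 0%N {1}0%N => k c.
elim: b k c => [|[] b IH] k c /=; rewrite -/(cons_pat _ _ _).
- by split=> //; exact: measurable_gap_ge.
- by split=> //; exact: measurable_gap_eq.
- exact: IH.
Qed.

Lemma satE_L1 e b w : (forall i, (i < size b)%N -> hit (e, i) w = nth false b i) -> satE w (L1 e b).
Proof.
move=> Hb; have : sat (tau e ^~ w) (cons_pat h_gt0 0 0 b).
  apply: sat_pat => // i ib; rewrite -(Hb i ib) /hit.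
  split=> [[l]|/asboolP[l e1]]; last by exists l; rewrite addn0; exact: e1.
  by rewrite addn0 => e1; apply/asboolP; exists l; exact: e1.
rewrite /L1; elim: (cons_pat _ _ _ _) => [//|[k B] L IH] /= [H1 H2]; split=> //; exact: IH.
Qed.

Lemma full_pattern (us : seq E) (n : nat) (b : E -> nat -> bool) : uniq us ->
  bd P [set w | forall u i, u \in us -> (i < n)%N -> hit (u, i) w = b u i]
     (\prod_(u <- us) \prod_(i <- iota 0 n) wt q (b u i)).
Proof.
move=> uu; pose L := flatten [seq L1 u (mkseq (b u) n) | u <- us].
have [uL mL pL] : [/\ uniq (map fst L), mble L &
   (\prod_(l <- L) P (tau l.1.1 l.1.2 @^-1` l.2) =
     (\prod_(u <- us) \prod_(i <- iota 0 n) wt q (b u i))%:E)%E].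
  rewrite /L {L}; elim: us uu => [|u us IH] /=; first by rewrite !big_nil.
  move=> /andP[uus /IH[uL mL pL]]; split.
  - rewrite map_cat cat_uniq uL andbT; apply/andP; split.
      rewrite -map_comp (_ : _ \o _ = (fun k => (u, k)) \o fst)//.
      by rewrite map_comp map_inj_uniq ?uniq_pat// => k k' [].
    apply/hasPn => c /mapP[l /flatten_mapP[u' u'us /mapP[kB _ ->]] ->] /=.
    apply/mapP => -[l' /mapP[kB' _ ->]] /= [e _].
    by move: uus; rewrite -e u'us.
  - by apply/mble_cat; split=> //; exact: mble_L1.
  - by rewrite big_cat pL big_cons prod_L1 expr0 mul1r EFinM big_map.
have [mS PS] := indep_seq uL mL.
exists [set w | satE w L]; split=> //; last by rewrite PS pL.
move=> w /= H; rewrite /L; elim: us {uu L uL mL pL mS PS} H => //= u us IH H.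
apply/satE_cat; split; last by apply: IH => u' i u's; apply: H; rewrite inE u's orbT.
apply: satE_L1 => i; rewrite size_mkseq => im.
by rewrite nth_mkseq//; apply: H => //; rewrite mem_head.
Qed.

(** Only patterns that decide all slots from 0 on translate into constraints on gaps. A partial
    pattern is therefore completed to a rectangle of edges and slots; the weights of its completions
    add up because [Ex] of the constant 1 is 1. *)
Lemma cyl_bd (s : seq ((E * nat) * bool)) : uniq (unzip1 s) -> bd P (cyl hit s) (pc q s).
Proof.
move=> us; pose U := undup [seq c.1 | c <- unzip1 s].
pose n := (\max_(c <- unzip1 s) c.2).+1.
pose all := [seq (u, i) | u <- U, i <- iota 0 n].
have q01 := q_01.
have allu : uniq all by apply: allpairs_uniq; rewrite ?undup_uniq ?iota_uniq// => -[? ?] [].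
have sall c : c \in unzip1 s -> c \in all.
  move=> cs; apply/allpairsP; exists c; rewrite -surjective_pairing; split=> //.
    by rewrite mem_undup; apply/mapP; exists c.
  by rewrite mem_iota /= add0n ltnS; apply: (leq_bigmax_seq (F := snd)).
suff : bnd P hit q s setT 1 by rewrite /bnd mul1r setIT.
have -> : 1 = Ex q s all (fun _ => 1).
  by elim: (all) (s) => //= c cs IH s'; case: (get s' c) => // ; rewrite -!IH; ring.
apply: bnd_Ex => s' es'.
have us' := ext_uniq es' us.
have ds' : perm_eq (unzip1 s') all.
  apply: uniq_perm => // c; apply/idP/idP.
    have /allP : seq.all (mem all) (unzip1 s'); last exact.
    by apply: ext_all es' _ _; apply/allP => // x /sall.
  by move=> ca; rewrite -[_ \in _]negbK -get_None; have [b ->] := ext_in es' ca.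
pose b u i := odflt false (get s' (u, i)).
have := @full_pattern U n b (undup_uniq _).
rewrite /bnd mul1r setIT; apply: bd_sub.
  move=> w cw u i uU iin; have ia : (u, i) \in all.
    by apply/allpairsP; exists (u, i); split=> //; rewrite mem_iota.
  by have [b0 e] := ext_in es' ia; rewrite (cyl_get cw e) /b e.
rewrite le_eqVlt; apply/orP; left; apply/eqP.
rewrite -(big_allpairs (F := fun c => wt q (b c.1 c.2))) -/all.
rewrite -(perm_big _ ds') /= /pc /unzip1 big_map big_seq [RHS]big_seq; apply: eq_bigr => -[[u i] b0] cs /=.
congr (wt q _); rewrite /b.
have : get s' (u, i) = Some b0; last by move=> ->.
move: us' cs; clear; elim: s' => //= -[c b1] s IH /= /andP[cs us].
rewrite inE => /orP[/eqP[<- <-]|cbs]; first by rewrite eqxx.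
case: eqP => [e|_]; last exact: IH.
by case/negP: cs; rewrite e; apply/mapP; exists (u, i, b0).
Qed.

End Bits.

(** * Rooted trees *)

Section Tree.
Variables (V : eqType) (r : V) (parent : V -> V).
Hypothesis tree : rooted_tree r parent.

Lemma dep_ex v : exists n, iter n parent v == r.
Proof. by have [n e] := tree.2 v; exists n; apply/eqP. Qed.

Definition dep v := ex_minn (dep_ex v).

Lemma iter_dep v : iter (dep v) parent v = r.
Proof. by rewrite /dep; case: ex_minnP => m /eqP. Qed.

Lemma dep_le v n : iter n parent v = r -> (dep v <= n)%N.
Proof. by move=> e; rewrite /dep; case: ex_minnP => m _; apply; apply/eqP. Qed.

Lemma dep_r : dep r = 0%N.
Proof. by apply/eqP; rewrite -leqn0; apply: dep_le. Qed.

Lemma dep0 v : dep v = 0%N -> v = r.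
Proof. by move=> e; have := iter_dep v; rewrite e. Qed.

Lemma dep_parent v : v != r -> dep v = (dep (parent v)).+1.
Proof.
move=> vr; apply/eqP; rewrite eqn_leq; apply/andP; split.
  by apply: dep_le; rewrite iterSr iter_dep.
have := iter_dep v; case e : (dep v) => [|n]; first by move: vr; rewrite (dep0 e) eqxx.
by rewrite iterSr ltnS => /dep_le.
Qed.

Lemma dep_parent_le v : (dep (parent v) <= dep v)%N.
Proof.
case: (eqVneq v r) => [->|/dep_parent->//]; by rewrite tree.1.
Qed.

Definition desc (x u : V) : bool := `[< exists k, iter k parent u = x >].

Lemma desc_refl x : desc x x. Proof. by apply/asboolP; exists 0%N. Qed.

Lemma desc_trans y x z : desc x y -> desc y z -> desc x z.
Proof.
move=> /asboolP[k ek] /asboolP[l el]; apply/asboolP; exists (k + l)%N.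
by rewrite iterD el.
Qed.

Lemma desc_parent x u : desc x (parent u) -> desc x u.
Proof. by move=> /asboolP[k ek]; apply/asboolP; exists k.+1; rewrite iterSr. Qed.

Lemma desc_up x u : desc x u -> u != x -> desc x (parent u).
Proof.
move=> /asboolP[[|k] ek]; first by rewrite -ek eqxx.
by move=> _; apply/asboolP; exists k; rewrite -iterSr.
Qed.

Lemma desc_dep x u : desc x u -> u != x -> (dep x < dep u)%N.
Proof.
move=> /asboolP[k]; elim: k u => [|k IH] u; first by move=> /= ->; rewrite eqxx.
rewrite iterSr => e ux; case: (eqVneq u r) => ur.
  have fx l : iter l parent r = r by elim: l => //= l ->; exact: tree.1.
  by move: e ux; rewrite ur tree.1 fx => ->; rewrite eqxx.
rewrite (dep_parent ur); case: (eqVneq (parent u) x) => [->//|/(IH _ e)]; lia.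
Qed.

Lemma desc_dep_le x u : desc x u -> (dep x <= dep u)%N.
Proof. by move=> xu; case: (eqVneq u x) => [->//|/(desc_dep xu)/ltnW]. Qed.

Lemma desc_anti x u : desc x u -> desc u x -> u = x.
Proof.
move=> xu ux; apply/eqP; case: eqVneq => // n; have := desc_dep xu n.
by have := desc_dep_le ux; lia.
Qed.

Lemma desc_cmp a b u : desc a u -> desc b u -> desc a b || desc b a.
Proof.
move=> /asboolP[k ek] /asboolP[l el]; case: (leqP k l) => kl; apply/orP.
  by right; apply/asboolP; exists (l - k)%N; rewrite -ek -iterD subnK.
by left; apply/asboolP; exists (k - l)%N; rewrite -el -iterD subnK// ltnW.
Qed.

Lemma desc_r u : desc r u.
Proof. by apply/asboolP; exists (dep u); exact: iter_dep. Qed.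

Variables (ch : V -> seq V).
Hypothesis chP : forall x u, (u \in ch x) = (u != r) && (parent u == x).

Lemma ch_parent x u : u \in ch x -> parent u = x.
Proof. by rewrite chP => /andP[_ /eqP]. Qed.

Lemma ch_nr x u : u \in ch x -> u != r.
Proof. by rewrite chP => /andP[]. Qed.

Lemma ch_dep x u : u \in ch x -> dep u = (dep x).+1.
Proof. by move=> ux; rewrite (dep_parent (ch_nr ux)) (ch_parent ux). Qed.

Lemma ch_desc x u : u \in ch x -> desc x u.
Proof. by move=> ux; apply: desc_parent; rewrite (ch_parent ux) desc_refl. Qed.

Lemma ch_ndesc x u : u \in ch x -> ~~ desc u x.
Proof. by move=> ux; apply/negP => /desc_dep_le; rewrite (ch_dep ux) ltnn. Qed.

Lemma ch_neq x u : u \in ch x -> u != x.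
Proof. by move=> ux; apply: contraNneq (ch_ndesc ux) => ->; rewrite desc_refl. Qed.

Lemma mem_ch x : x != r -> x \in ch (parent x).
Proof. by rewrite chP eqxx andbT. Qed.

Lemma desc_nr v x : v != r -> desc v x -> x != r.
Proof.
move=> vr vx; apply: contraNneq vr => xr; move: vx; rewrite xr => vx.
by apply/eqP; apply: desc_anti => //; exact: desc_r.
Qed.

Lemma desc_ch w x u : u \in ch x -> desc w u -> u = w \/ desc w x.
Proof.
move=> ux wu; case: (eqVneq u w) => [->|uw]; [by left|right].
by rewrite -(ch_parent ux); apply: desc_up.
Qed.

(** For a child [w] of [x]: [w] branches off the path from [x] down to [rho], so the subtrees of [w]
    and of [rho] are disjoint and whatever is read below [rho] leaves both [x] and the subtree of
    [w] untouched. *)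
Definition below (rho x w : V) := [&& desc x rho, rho != x & ~~ desc w rho].

Lemma below_desc rho rho' x w : w \in ch x -> below rho x w -> desc rho rho' -> below rho' x w.
Proof.
move=> wx /and3P[xr rx wr] rr'; apply/and3P; split.
- exact: desc_trans rr'.
- apply: contraNneq rx => e; apply/eqP; apply: desc_anti => //; by rewrite -e.
- apply/negP => wr'; have /orP[rw|wrho] := desc_cmp rr' wr'; last by rewrite wrho in wr.
  case: (desc_ch wx rw) => [e|rx']; first by rewrite e desc_refl in wr.
  by move: rx; rewrite (desc_anti xr rx') eqxx.
Qed.

Lemma below_nx rho x w : below rho x w -> ~~ desc rho x.
Proof.
by move=> /and3P[xr rx _]; apply: contraNN rx => rx'; rewrite (desc_anti xr rx').
Qed.

Lemma below_nw rho x w u : w \in ch x -> below rho x w -> desc w u -> ~~ desc rho u.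
Proof.
move=> wx b wu; apply/negP => ru; have := below_desc wx b ru.
by move=> /and3P[_ _]; rewrite wu.
Qed.

End Tree.

(** * The exploration of a subtree *)

Section Slots.
Variable N : nat.

Definition nxs i := if i.+1 == N then 0%N else i.+1.
(* [rem t i] is the number of slots from slot i to slot t in cyclic time; [bk t]
   is its inverse. *)
Definition rem t i : nat := (if i <= t then t - i else t + N - i)%N.
Definition bk t e : nat := (if e <= t then t - e else t + N - e)%N.

Lemma nxs_lt i : (i < N)%N -> (nxs i < N)%N.
Proof. by rewrite /nxs; case: eqP; lia. Qed.

Lemma rem_nxs t i : (t < N)%N -> (i < N)%N ->
  rem t (nxs i) = if rem t i == 0%N then N.-1 else (rem t i).-1.
Proof. by rewrite /rem /nxs => *; repeat case: ifP; lia. Qed.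

Lemma bk_rem t i : (t < N)%N -> (i < N)%N -> bk t (rem t i) = i.
Proof. by rewrite /rem /bk => *; repeat case: ifP; lia. Qed.

Lemma rem_bk t e : (t < N)%N -> (e < N)%N -> (bk t e < N)%N /\ rem t (bk t e) = e.
Proof.
by move=> tN eN; rewrite /bk; case: ifP => et; rewrite /rem; case: ifP => h; split; lia.
Qed.

Lemma rem_sub t i i' : (t < N)%N -> (i < N)%N -> (i' < N)%N ->
  (rem t i' <= rem t i)%N -> rem i' i = (rem t i - rem t i')%N.
Proof. by move=> tN iN i'N; rewrite /rem; repeat case: ifP; lia. Qed.

(** Distance 0 is followed by distance [N - 1 > L], so the window can only be entered at its
    beginning. *)
Lemma rem_arr L t i : (t < N)%N -> (i < N)%N -> (L.+1 < N)%N -> ~~ (0 < rem t i <= L)%N ->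
  (rem t (nxs i) <= L)%N -> rem t (nxs i) = L.
Proof. by move=> tN iN LN; rewrite rem_nxs//; case: eqP; lia. Qed.

End Slots.

Ltac slia := repeat match goal with T : realType |- _ => clear dependent T end; lia.

Section Explore.
Context (d : measure_display) (Om : measurableType d) (R : realType).
Variable P : probability Om R.
Variables (V : eqType) (r : V) (parent : V -> V).
Hypothesis tree : rooted_tree r parent.
Variable ch : V -> seq V.
Hypothesis chP : forall x u, (u \in ch x) = (u != r) && (parent u == x).
Hypothesis uch : forall x, uniq (ch x).
Variable X : V * nat -> Om -> bool.
Variables (q : R) (N n : nat) (v : V).
Hypothesis q01 : 0 < q < 1.
Hypothesis vr : v != r.

Local Notation dep := (dep tree).
Local Notation desc := (desc parent).
Local Notation below := (below parent).
Local Notation nxs := (nxs N).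
Local Notation rem := (rem N).
Local Notation info := (seq ((V * nat) * bool)).

(* An edge is named by its lower endpoint. *)
Definition edges x := x :: ch x.
Definition mv (x u : V) := if u == x then parent x else u.

(* The walk from (v, 0) fails if, before it reaches depth n, it leaves the
   subtree of v or closes up.  Meeting two rings in one slot, or running out of
   the fuel M, does not count as a failure. *)
Fixpoint fail (M : nat) (hist : seq (V * nat)) (pos : V * nat) (w : Om) : bool :=
  if M is M'.+1 then
    let s := [seq u <- edges pos.1 | X (u, pos.2) w] in
    if (1 < size s)%N then false else
    let pos' := (if s is u :: _ then mv pos.1 u else pos.1, nxs pos.2) in
    if (n <= dep pos'.1)%N then false else
    if ~~ desc v pos'.1 then true else
    if pos' \in pos :: hist then pos' == (v, 0%N) else
    fail M' (pos :: hist) pos' w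
  else false.

Lemma failS M hist pos w : fail M.+1 hist pos w =
    let s := [seq u <- edges pos.1 | X (u, pos.2) w] in
    if (1 < size s)%N then false else
    let pos' := (if s is u :: _ then mv pos.1 u else pos.1, nxs pos.2) in
    if (n <= dep pos'.1)%N then false else
    if ~~ desc v pos'.1 then true else
    if pos' \in pos :: hist then pos' == (v, 0%N) else
    fail M (pos :: hist) pos' w.
Proof. by []. Qed.

Variable okc : pred (V * nat).
Hypothesis okv : forall u i, desc v u -> okc (u, i).
Definition wf (s : info) := uniq (unzip1 s) && all okc (unzip1 s).

(** [FF] will be the joint failure of the walks from the other starting vertices. Its bound [kap]
    survives any reading inside the subtree of [v], which is how the bounds of several walks come to
    be multiplied. *)
Variables (FF : set Om) (kap : R).
Hypothesis kap0 : 0 <= kap.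
Hypothesis FFb : forall s, wf s -> bnd P X q s FF kap.

Definition F M hist pos : set Om := [set w | fail M hist pos w] `&` FF.

Let q01' : 0 <= q <= 1. Proof. by case/andP: q01 => *; rewrite !ltW. Qed.

Lemma uniq_edges x : uniq (edges x).
Proof.
rewrite /edges /= uch andbT; apply/negP => h.
by have := ch_neq tree chP h; rewrite eqxx.
Qed.

Lemma edges_desc x u : u \in edges x -> desc x u.
Proof. by rewrite inE => /orP[/eqP->|/(ch_desc chP)//]; exact: desc_refl. Qed.

Definition safe (pos : V * nat) := desc v pos.1 && (pos != (v, 0%N)).

(** At an unsafe position the walk has failed and only [FF] is left to bound, hence the demand
    [kap <= k s'] there. *)
Definition okn M hist pos (k : info -> R) (s' : info) pos' :=
  (safe pos' \/ kap <= k s') /\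
  (desc v pos'.1 -> pos' \notin pos :: hist -> bnd P X q s' (F M (pos :: hist) pos') (k s')).

(** Once the bits of the slot are read the move is determined, and only silence or a single ring can
    lead to failure. The order of [cs] is left free, so that the decisive clocks can be averaged
    first. *)
Lemma step_bnd M hist pos (s : info) k cs : wf s -> desc v pos.1 ->
  cs =i [seq (u, pos.2) | u <- edges pos.1] ->
  (forall s', 0 <= k s') ->
  (forall s', ext s cs s' -> wf s' ->
     (forall u, u \in edges pos.1 -> get s' (u, pos.2) = Some false) ->
     okn M hist pos k s' (pos.1, nxs pos.2)) ->
  (forall s' u, ext s cs s' -> wf s' -> u \in edges pos.1 -> get s' (u, pos.2) = Some true ->
     (forall u', u' \in edges pos.1 -> u' != u -> get s' (u', pos.2) = Some false) ->
     okn M hist pos k s' (mv pos.1 u, nxs pos.2)) ->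
  bnd P X q s (F M.+1 hist pos) (Ex q s cs k).
Proof.
move=> wfs vx csE k0 Hstay Hmove; apply: bnd_Ex => s' es'.
have wfs' : wf s'.
  case/andP: wfs => us oks; apply/andP; split; first exact: ext_uniq es' us.
  apply: ext_all es' oks _; apply/allP => c; rewrite csE => /mapP[u ue ->].
  by apply: okv; apply: desc_trans vx _; exact: edges_desc.
have rev u : u \in edges pos.1 -> exists b, get s' (u, pos.2) = Some b.
  by move=> ue; apply: ext_in es' _; rewrite csE; apply/mapP; exists u.
pose rg := [seq u <- edges pos.1 | get s' (u, pos.2) == Some true].
have rgE w : cyl X s' w -> [seq u <- edges pos.1 | X (u, pos.2) w] = rg.
  move=> cw; apply: eq_in_filter => u ue; have [b e] := rev u ue.
  by rewrite (cyl_get cw e) e; case: (b).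
have fin pos' : okn M hist pos k s' pos' ->
    (forall w, cyl X s' w -> F M.+1 hist pos w ->
      ~~ (n <= dep pos'.1)%N && (~~ desc v pos'.1 || (if pos' \in pos :: hist then pos' == (v, 0%N)
         else fail M (pos :: hist) pos' w))) ->
    bnd P X q s' (F M.+1 hist pos) (k s').
  move=> [sk bk] H.
  case vp' : (desc v pos'.1); last first.
    case: sk => [/andP[]|sk]; first by rewrite vp'.
    by apply: bnd_sub (bnd_le q01' sk (FFb wfs')) => w _ [].
  case: (boolP (pos' \in pos :: hist)) => ph; last first.
    apply: bnd_sub (bk vp' ph) => w cw Fw; have := H w cw Fw; rewrite vp' (negbTE ph) /= => /andP[_ f].
    by split=> //; case: Fw.
  case: (eqVneq pos' (v, 0%N)) => e.
    case: sk => [/andP[]|sk]; first by rewrite e eqxx.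
    by apply: bnd_sub (bnd_le q01' sk (FFb wfs')) => w _ [].
  apply: bnd_False => // w cw Fw; have := H w cw Fw.
  by rewrite vp' ph (negbTE e) andbF.
case rgs : rg => [|u [|u' l]].
- apply: (fin (pos.1, nxs pos.2)).
    apply: Hstay => // u ue; have [[] e] := rev u ue; last by [].
    by have : u \in rg by [rewrite mem_filter e eqxx]; rewrite rgs.
  move=> w cw []; rewrite /mkset failS (rgE w cw) rgs /=.
  by case: ifP => //= _; case: ifP.
- have ur : u \in rg by rewrite rgs mem_head.
  have /andP[/eqP gu ue] : (get s' (u, pos.2) == Some true) && (u \in edges pos.1).
    by move: ur; rewrite mem_filter.
  apply: (fin (mv pos.1 u, nxs pos.2)).
    apply: Hmove => // u' u'e u'u; have [[] e] := rev u' u'e; last by [].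
    have : u' \in rg by rewrite mem_filter e eqxx.
    by rewrite rgs inE (negbTE u'u).
  move=> w cw []; rewrite /mkset failS (rgE w cw) rgs /=.
  by case: ifP => //= _; case: ifP.
- apply: bnd_False => // w cw [f _]; move: f; by rewrite /mkset failS (rgE w cw) rgs.
Qed.

(* A level l = (x, w, t) consists of a vertex x, entered from its parent in slot
   t, and of a child w of x below which nothing is known.  By Lw, in the window
   of L slots before t no edge at x other than w rings: a walk that is back at x
   with k window slots ahead enters the fresh subtree of w unless w is silent
   in all of them, whence the bound vv k for the probability of failure. *)
Variables (L : nat) (al ze : R).
Hypothesis LN : (L.+1 < N)%N.
Hypothesis al01 : 0 < al < 1.
Hypothesis ze01 : 0 < ze <= 1.
Hypothesis alze : 1 + al <= 2 * ze.
Hypothesis vvL : 1 - (1 - al) * (1 - q ^+ L) <= ze.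

Definition lx (l : V * V * nat) := l.1.1.
Definition lw (l : V * V * nat) := l.1.2.
Definition lt (l : V * V * nat) := l.2.

(** Field [lv_wF]: the clock of [w] has been read only in slots in which the walk was at [x], so it
    is unread at every new visit. Field [lv_x]: the only ring of [x] that may be known is the one
    that brought the walk there. *)
Record Lv0 (s : info) (hist : seq (V * nat)) (l : V * V * nat) : Prop := {
  lv_ch : lw l \in ch (lx l);
  lv_v : desc v (lx l);
  lv_nv : lx l != v;
  lv_t : (lt l < N)%N;
  lv_below : forall u i, desc (lw l) u -> u != lw l -> get s (u, i) = None;
  lv_wF : forall i b, get s (lw l, i) = Some b -> b = false /\ (lx l, i) \in hist;
  lv_x : forall i, get s (lx l, i) = Some true -> i = lt l
}.

Definition Lw (s : info) (l : V * V * nat) : Prop :=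
  forall u i, (i < N)%N -> (0 < rem (lt l) i <= L)%N -> u \in edges (lx l) -> u != lw l ->
    get s (u, i) = Some false.

Definition Lv s hist l := Lv0 s hist l /\ Lw s l.

Lemma Lv0_ext s hist s' hist' l rho : Lv0 s hist l -> below rho (lx l) (lw l) ->
  (forall c, ~~ desc rho c.1 -> get s' c = get s c) ->
  {subset hist <= hist'} -> Lv0 s' hist' l.
Proof.
move=> [h1 h2 h3 h4 h5 h6 h7] br E sub.
have Ew u i : desc (lw l) u -> get s' (u, i) = get s (u, i).
  by move=> wu; apply: E; exact: (below_nw tree chP h1 br wu).
split=> //.
- by move=> u i wu uw; rewrite Ew// h5.
- by move=> i b; rewrite Ew ?desc_refl// => /h6[-> /sub].
- by move=> i; rewrite E; [exact: h7|exact: (below_nx tree br)].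
Qed.

Lemma Lv_ext s hist s' hist' l rho : Lv s hist l -> below rho (lx l) (lw l) ->
  (forall c, ~~ desc rho c.1 -> get s' c = get s c) ->
  (forall c b, get s c = Some b -> get s' c = Some b) ->
  {subset hist <= hist'} -> Lv s' hist' l.
Proof.
move=> [h0 hw] br E mono sub; split; first exact: Lv0_ext h0 br E sub.
by move=> u i iN rL ue uw; apply: mono; exact: hw.
Qed.

(** Levels are listed from the deepest upwards. *)
Fixpoint chain rho (ls : seq (V * V * nat)) : Prop :=
  if ls is l :: tl then below rho (lx l) (lw l) /\ chain (lx l) tl else True.

Lemma chain_desc rho rho' ls s hist : (forall l, l \in ls -> Lv0 s hist l) ->
  chain rho ls -> desc rho rho' -> chain rho' ls.
Proof.
case: ls => // l tl H [b c] rr'; split=> //.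
exact: (below_desc tree chP (lv_ch (H l (mem_head _ _))) b rr').
Qed.

Lemma chain_below rho ls s hist : (forall l, l \in ls -> Lv0 s hist l) ->
  chain rho ls -> forall l, l \in ls -> below rho (lx l) (lw l).
Proof.
elim: ls rho => //= l tl IH rho H [b c] l'; rewrite inE => /orP[/eqP->//|l't].
have Ht : forall l, l \in tl -> Lv0 s hist l by move=> l0 h; apply: H; rewrite inE h orbT.
apply: (below_desc tree chP (lv_ch (Ht _ l't)) (IH (lx l) Ht c l' l't)).
by case/and3P: b.
Qed.

Definition vv k : R := 1 - (1 - al) * (1 - q ^+ k).
Definition wgt (l : V * V * nat) (pos : V * nat) : R :=
  if (pos.1 == lx l) && (rem (lt l) pos.2 <= L)%N then vv (rem (lt l) pos.2) else ze.
(** The walk must pass the levels one after the other, so only the nearest is priced according to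
    the current slot; those above count [ze] each. *)
Definition W1 ls pos : R := if ls is l :: tl then wgt l pos * ze ^+ size tl else 1.

(** The situation in known territory: the walk lies under the deepest level and outside its fresh
    subtree, and nothing is assumed about the bits it is going to meet, except those of the
    levels. *)
Definition cond1 s hist pos ls := [/\ wf s, (pos.2 < N)%N,
  (forall l, l \in ls -> Lv s hist l) &
  if ls is l :: tl then [/\ desc (lx l) pos.1, ~~ desc (lw l) pos.1 & chain (lx l) tl] else True].

Lemma vv_ge0 k : 0 < vv k.
Proof.
have h : 0 <= q ^+ k <= 1 by case/andP: q01' => *; rewrite exprn_ge0 ?exprn_ile1.
by rewrite /vv; case/andP: al01 => *; case/andP: h => *; nra.
Qed.

Lemma wgt_ge0 l pos : 0 <= wgt l pos.
Proof. by rewrite /wgt; case: ifP => _; [exact/ltW/vv_ge0|case/andP: ze01 => /ltW]. Qed.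

Lemma zen_ge0 k : 0 <= ze ^+ k.
Proof. by apply: exprn_ge0; case/andP: ze01 => /ltW. Qed.

Lemma W1_ge0 ls pos : 0 <= W1 ls pos.
Proof. by case: ls => //= l tl; rewrite mulr_ge0 ?wgt_ge0 ?zen_ge0. Qed.

Lemma cond1_safe s hist pos ls : cond1 s hist pos ls ->
  safe pos \/ kap <= kap * W1 ls pos.
Proof.
case: ls => [_|l tl [_ _ H [xp _ _]]]; first by right; rewrite /= mulr1.
left; have [h _] := H l (mem_head _ _).
rewrite /safe (desc_trans (lv_v h) xp) /=; apply/eqP => e.
by move: xp; rewrite e /= => /(desc_anti tree (lv_v h)) /eqP; rewrite (negbTE (lv_nv h)).
Qed.

Lemma W1_chain rho s hist ls pos : (forall l, l \in ls -> Lv s hist l) ->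
  chain rho ls -> desc rho pos.1 -> W1 ls pos = ze ^+ size ls.
Proof.
case: ls => //= l tl H [b _] rp.
rewrite /wgt; case: eqP => /= [e|_]; last by rewrite -exprS.
have [h _] := H l (mem_head _ _).
by have /and3P[_] := below_desc tree chP (lv_ch h) b rp; rewrite e eqxx.
Qed.

(* No arrival at x happens inside the window, where the clocks are silent. *)
Lemma wgt_arr s hist l u i : Lv s hist l -> (i < N)%N -> get s (u, i) = Some true ->
  u \in ch (lx l) -> u != lw l -> wgt l (lx l, nxs i) <= ze.
Proof.
move=> [h0 hw] iN gu ux uw; rewrite /wgt /= eqxx /=; case: ifP => // rL.
have tN := lv_t h0.
have nw : ~~ (0 < rem (lt l) i <= L)%N.
  by apply/negP => /(hw u _ iN); rewrite inE ux orbT gu => /(_ isT uw).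
by rewrite (rem_arr tN iN LN nw rL).
Qed.

Lemma cond1_tl s hist pos l tl : cond1 s hist pos (l :: tl) -> cond1 s hist pos tl.
Proof.
move=> [wfs iN H [xp wp c]]; split=> //; first by move=> l' h; apply: H; rewrite inE h orbT.
case: tl H c => //= l2 tl H [b c]; split=> //.
  by apply: desc_trans xp; case/and3P: b.
have /H[h _] : l2 \in [:: l, l2 & tl] by rewrite !inE eqxx orbT.
by have /and3P[] := below_desc tree chP (lv_ch h) b xp.
Qed.

(** The new vertex may have known silent slots, since it can be the child [w] of a level that was
    waited for; its only known ring is the one just used. *)
Definition entry s hist pos ls := [/\ wf s, (pos.2 < N)%N & desc v pos.1] /\
  [/\ pos.1 != v, chain pos.1 ls, (forall l, l \in ls -> Lv s hist l),
   (forall u i, desc pos.1 u -> u != pos.1 -> get s (u, i) = None) &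
   (forall i, (i < N)%N -> get s (pos.1, i) = Some true -> nxs i = pos.2)].

Definition read s s' (pos : V * nat) :=
  [/\ (forall c, c \notin [seq (u, pos.2) | u <- edges pos.1] -> get s' c = get s c) &
      (forall c b, get s c = Some b -> get s' c = Some b)].

Lemma ext_read s s' pos cs : cs =i [seq (u, pos.2) | u <- edges pos.1] -> ext s cs s' ->
  read s s' pos.
Proof.
move=> csE e; split=> [c|c b]; last exact: (ext_get e).
by rewrite -csE; apply: ext_notin e.
Qed.

Lemma read_slot s s' pos u i : read s s' pos -> i != pos.2 -> get s' (u, i) = get s (u, i).
Proof.
by move=> [E _] ip; apply: E; apply/mapP => -[u' _ [_ e]]; rewrite e eqxx in ip.
Qed.

Lemma read_notin s s' pos u i : read s s' pos -> u \notin edges pos.1 ->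
  get s' (u, i) = get s (u, i).
Proof.
by move=> [E _] ip; apply: E; apply/mapP => -[u' u'e [e _]]; rewrite e u'e in ip.
Qed.

Lemma read_desc s s' pos c : read s s' pos -> ~~ desc pos.1 c.1 -> get s' c = get s c.
Proof.
case: c => u i rd nd; apply: (read_notin _ rd); apply: contraNN nd; exact: edges_desc.
Qed.

Lemma read_Lv s s' hist pos l : read s s' pos -> Lv s hist l -> below pos.1 (lx l) (lw l) ->
  Lv s' (pos :: hist) l.
Proof.
move=> rd h b; apply: (Lv_ext h b) => [c|c c'|c ch'].
- exact: read_desc.
- by case: rd => _; apply.
- by rewrite inE ch' orbT.
Qed.

Lemma read_LvT s s' hist pos ls : read s s' pos -> (forall l, l \in ls -> Lv s hist l) ->
  chain pos.1 ls -> forall l, l \in ls -> Lv s' (pos :: hist) l.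
Proof.
move=> rd H c l ll; apply: read_Lv (H l ll) _ => //.
by apply: (@chain_below pos.1 ls s hist) => // l' /H[].
Qed.

Lemma edges_nr x : x != r -> (x \in edges x) /\ parent x != x.
Proof.
move=> xr; rewrite mem_head; split=> //; apply/eqP => e.
by have := dep_parent tree xr; rewrite e; slia.
Qed.

(** * One step of the walk in known territory, under its levels *)

Section LevelStep.
Variable M : nat.
Hypothesis IH1 : forall s hist pos ls, cond1 s hist pos ls -> pos \notin hist ->
  bnd P X q s (F M hist pos) (kap * W1 ls pos).
Hypothesis IHnew : forall s hist pos ls, entry s hist pos ls -> pos \notin hist ->
  bnd P X q s (F M hist pos) (kap * (al * ze ^+ size ls)).

Lemma okn_cond1 s' hist pos pos' ls (k : info -> R) :
  cond1 s' (pos :: hist) pos' ls -> kap * W1 ls pos' <= k s' -> okn M hist pos k s' pos'.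
Proof.
move=> c1 ck; split.
  by case: (cond1_safe c1) => h; [left|right; exact: le_trans ck].
by move=> _ ph; apply: (bnd_le q01' ck); exact: IH1.
Qed.

Lemma okn_entry s' hist pos pos' ls (k : info -> R) :
  entry s' (pos :: hist) pos' ls -> kap * (al * ze ^+ size ls) <= k s' -> okn M hist pos k s' pos'.
Proof.
move=> c1 ck; split; last by move=> _ ph; apply: (bnd_le q01' ck); exact: IHnew.
left; case: c1 => -[_ _ vp] [nv _ _ _ _]; rewrite /safe vp /=.
by apply: contraNneq nv => ->.
Qed.

(** Away from [x] the price is constant, so nothing is averaged; the one point to check is the
    arrival at [x], which [wgt_arr] keeps out of the interior of the window. *)
Lemma level_dead s hist x0 i l tl : cond1 s hist (x0, i) (l :: tl) -> x0 != lx l ->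
  bnd P X q s (F M.+1 hist (x0, i)) (kap * W1 (l :: tl) (x0, i)).
Proof.
move=> c1 x0x; have [wfs /= iN H [xp wp c]] := c1.
have [h0 hw] := H l (mem_head _ _).
have vx0 : desc v x0 by exact: (desc_trans (lv_v h0) xp).
have b0 : below x0 (lx l) (lw l) by apply/and3P.
have W1E : W1 (l :: tl) (x0, i) = ze * ze ^+ size tl by rewrite /= /wgt /= (negbTE x0x).
pose cs := [seq (u, i) | u <- edges x0].
pose k (s' : info) := kap * W1 (l :: tl) (x0, i).
suff B : bnd P X q s (F M.+1 hist (x0, i)) (Ex q s cs k).
  by apply: (bnd_le q01') B; apply: Ex_le.
have cond s' x' : ext s cs s' -> wf s' -> desc (lx l) x' -> ~~ desc (lw l) x' ->
    cond1 s' ((x0, i) :: hist) (x', nxs i) (l :: tl).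
  move=> es' wfs' xx' wx'.
  have rd := ext_read (pos := (x0, i)) (fun c => erefl) es'.
  by split=> //=; [exact: nxs_lt|apply: (read_LvT rd)].
apply: (step_bnd (pos := (x0, i))) => //=.
- by move=> s'; rewrite mulr_ge0 ?W1_ge0.
- move=> s' es' wfs' _; apply: okn_cond1 (cond s' x0 es' wfs' xp wp) _.
  by rewrite /k W1E /= /wgt /= (negbTE x0x).
- move=> s' u es' wfs' ue gu _.
  have [xx' wx'] : desc (lx l) (mv x0 u) /\ ~~ desc (lw l) (mv x0 u).
    rewrite /mv; case: eqP => [_|/eqP ux0].
      split; first exact: desc_up.
      by apply: contraNN wp; exact: desc_parent.
    move: ue; rewrite inE (negbTE ux0) /= => ux; split; first exact: (desc_trans xp (ch_desc chP ux)).
    apply/negP => /(desc_ch chP ux)[e|]; last by apply/negP.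
    by move: x0x; rewrite -(ch_parent chP ux) e (ch_parent chP (lv_ch h0)) eqxx.
  have c1' := cond s' _ es' wfs' xx' wx'; apply: (okn_cond1 c1').
  rewrite /k W1E /= ler_wpM2l// ler_wpM2r ?zen_ge0//.
  case: (eqVneq (mv x0 u) (lx l)) => [e|ne]; last by rewrite /wgt /= (negbTE ne).
  have [_ _ H' _] := c1'; have h' := H' l (mem_head _ _).
  rewrite e; apply: (wgt_arr h' iN gu).
    move: e; rewrite /mv; case: eqP => [->|/eqP ux0] e.
      rewrite -e; apply: (mem_ch chP); exact: (desc_nr tree vr vx0).
    move: ue; rewrite inE (negbTE ux0) /= => ux.
    by have := below_nx tree b0; rewrite -e (ch_desc chP ux).
  apply: contraNneq wp => uw; move: e; rewrite /mv uw; case: eqP => [->|_ wx]; first by rewrite desc_refl.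
  by move: (ch_neq tree chP (lv_ch h0)); rewrite wx eqxx.
Qed.

(** At [x] there are three cases. In slot [t] the level is given up, its factor being 1. Inside the
    window only [w] can ring, and [vv] solves the recursion of this wait. Outside, [x] and [w] race
    on equal terms. *)
Lemma level_step s hist pos ls : cond1 s hist pos ls -> pos \notin hist ->
  bnd P X q s (F M.+1 hist pos) (kap * W1 ls pos).
Proof.
elim: ls => [|l tl IHl] c1 ph.
  by case: c1 => wfs _ _ _; rewrite /= mulr1; apply: bnd_sub (FFb wfs) => w _ [].
case: pos c1 ph IHl => x0 i c1 ph IHl.
case: (eqVneq x0 (lx l)) => [e|ne]; last exact: level_dead.
subst x0; have [wfs /= iN H [xp wp c]] := c1.
have [h0 hw] := H l (mem_head _ _).
have Ht l' : l' \in tl -> Lv s hist l' by move=> h; apply: H; rewrite inE h orbT.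
have tN := lv_t h0.
have vx : desc v (lx l) := lv_v h0.
have xr : lx l != r := desc_nr tree vr vx.
have [xe pxx] := edges_nr xr.
have wch := lv_ch h0.
have we : lw l \in edges (lx l) by rewrite inE wch orbT.
have wx := ch_neq tree chP wch.
(* This is a new visit to [x] in slot [i], so [lv_wF] excludes that the bit was read. *)
have gw : get s (lw l, i) = None.
  by case gwi : (get s (lw l, i)) => [b|//]; have [_] := lv_wF h0 gwi; rewrite (negbTE ph).
have zt := zen_ge0 (size tl).
rewrite [wgt l _]/wgt /= eqxx /=.
case: (eqVneq (rem (lt l) i) 0%N) => r0.
  rewrite r0 leq0n /vv expr0 subrr mulr0 subr0 mul1r -(W1_chain (pos := (lx l, i)) Ht c xp).
  by apply: IHl => //; exact: (cond1_tl c1).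
(* The bits of [w] and [x] come first, to be averaged explicitly; [w] occurs again among the
   children, but is known by then and is skipped. *)
pose cs := (lw l, i) :: (lx l, i) :: [seq (u, i) | u <- ch (lx l)].
have csE : cs =i [seq (u, i) | u <- edges (lx l)].
  move=> c'; rewrite /cs /edges /= !inE orbA; case: (c' =P (lw l, i)) => //= ->.
  by rewrite (map_f (fun u => (u, i)) wch) orbT.
pose rm := rem (lt l) i.
pose st (b : bool) : R := if b then wgt l (lx l, i) else 0.
have cond_same s' x' : ext s cs s' -> wf s' -> get s' (lw l, i) = Some false ->
    get s' (lx l, i) != Some true -> desc (lx l) x' -> ~~ desc (lw l) x' ->
    cond1 s' ((lx l, i) :: hist) (x', nxs i) (l :: tl).
  move=> es' wfs' gw' gx' xx' wx'.
  have rd := ext_read (pos := (lx l, i)) csE es'.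
  split=> //=; first exact: nxs_lt.
  move=> l'; rewrite inE => /orP[/eqP->|l't]; last exact: (read_LvT rd Ht c).
  split; last by move=> u i' i'N rL ue uw; case: rd => _; apply; exact: hw.
  split; [exact: wch|exact: vx|exact: (lv_nv h0)|exact: tN| | |].
  - move=> u i' wu uw; rewrite (read_notin _ rd) ?(lv_below h0)//=.
    rewrite inE negb_or; apply/andP; split.
      by apply: contraTneq wu => ->; exact: (ch_ndesc tree chP wch).
    apply: contra uw => ux; case: (desc_ch chP ux wu) => [->//|wxx].
    by rewrite (negbTE (ch_ndesc tree chP wch)) in wxx.
  - move=> i' b; case: (eqVneq i' i) => [->|ii]; first by rewrite gw' => -[<-]; rewrite mem_head.
    by rewrite (read_slot _ rd ii) => /(lv_wF h0)[-> h]; rewrite inE h orbT.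
  - move=> i'; case: (eqVneq i' i) => [->|ii]; first by move/eqP; rewrite (negbTE gx').
    by rewrite (read_slot _ rd ii); exact: (lv_x h0).
have cond_new s' : ext s cs s' -> wf s' -> entry s' ((lx l, i) :: hist) (lw l, nxs i) tl.
  move=> es' wfs'; have rd := ext_read (pos := (lx l, i)) csE es'.
  split; first by split=> //=; [exact: nxs_lt|exact: (desc_trans vx (ch_desc chP wch))].
  split=> /=.
  - apply: contraNneq (lv_nv h0) => wv; apply/eqP; apply: (desc_anti tree vx).
    by rewrite -wv; exact: (ch_desc chP wch).
  - by apply: chain_desc c (ch_desc chP wch) => l' /Ht[h _]; exact: h.
  - exact: (read_LvT rd Ht c).
  - move=> u i' wu uw; rewrite (read_notin _ rd) ?(lv_below h0)//=.
    rewrite inE negb_or; apply/andP; split.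
      by apply: contraTneq wu => ->; exact: (ch_ndesc tree chP wch).
    apply: contra uw => ux; case: (desc_ch chP ux wu) => [->//|wxx].
    by rewrite (negbTE (ch_ndesc tree chP wch)) in wxx.
  - move=> i' i'N; case: (eqVneq i' i) => [->//|ii].
    by rewrite (read_slot _ rd ii) => /(lv_wF h0)[].
case: (leqP rm L) => rL.
  pose k (s' : info) := kap * (if get s' (lw l, i) == Some true then al * ze ^+ size tl
       else vv rm.-1 * ze ^+ size tl).
  have kw : Ex q s cs k <= kap * (vv rm * ze ^+ size tl).
    rewrite /cs /= gw.
    have h1 : Ex q ((lw l, i, true) :: s) ((lx l, i) :: [seq (u, i) | u <- ch (lx l)]) k
        <= kap * (al * ze ^+ size tl).
      by apply: (Ex_le q01') => s' e; rewrite /k (@ext_get _ _ _ _ (lw l, i) true e)//= eqxx.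
    have h2 : Ex q ((lw l, i, false) :: s) ((lx l, i) :: [seq (u, i) | u <- ch (lx l)]) k
        <= kap * (vv rm.-1 * ze ^+ size tl).
      by apply: (Ex_le q01') => s' e; rewrite /k (@ext_get _ _ _ _ (lw l, i) false e)//= eqxx.
    have vvS : vv rm = (1 - q) * al + q * vv rm.-1.
      by rewrite /vv -{1}(prednK (n := rm)) ?lt0n// exprS; ring.
    have [q0 q1] := andP q01'.
    apply: le_trans (lerD (ler_wpM2l (_ : 0 <= 1 - q) h1) (ler_wpM2l q0 h2)) _; first by rewrite subr_ge0.
    by rewrite vvS le_eqVlt; apply/orP; left; apply/eqP; ring.
  have othF u : u \in edges (lx l) -> u != lw l -> get s (u, i) = Some false.
    by move=> ue uw; apply: hw => //; rewrite lt0n r0.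
  apply: (bnd_le q01' kw); apply: (step_bnd (pos := (lx l, i))) => //=.
  - move=> s'; rewrite mulr_ge0//; case: ifP => _; rewrite mulr_ge0//.
      by case/andP: al01 => /ltW.
    exact/ltW/vv_ge0.
  - move=> s' es' wfs' allF.
    apply: (okn_cond1 (cond_same s' (lx l) es' wfs' (allF _ we) _ xp wp)); first by rewrite allF.
    rewrite /k allF//= /wgt /= eqxx /= rem_nxs// (negbTE r0).
    by rewrite ifT//; move: rL; rewrite /rm; slia.
  - move=> s' u es' wfs' ue gu oth; case: (eqVneq u (lw l)) => [e|uw]; last first.
      by have := ext_get es' (othF u ue uw); rewrite gu.
    subst u; rewrite /mv (negbTE wx); apply: (okn_entry (cond_new s' es' wfs')).
    by rewrite /k gu eqxx.
pose k (s' : info) := kap * ze ^+ size tl *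
   (if get s' (lw l, i) == Some true then if get s' (lx l, i) == Some true then 0 else al
    else if get s' (lx l, i) == Some true then 1 else ze).
have gx : get s (lx l, i) != Some true.
  apply/eqP => /(lv_x h0) it; move: r0; rewrite it; rewrite /rem leqnn; slia.
have kz : 0 <= kap * ze ^+ size tl by rewrite mulr_ge0.
have [z0 z1] := andP ze01; have [a0 a1] := andP al01; have [q0 q1] := andP q01'.
have kw : Ex q s cs k <= kap * (ze * ze ^+ size tl).
  rewrite [leRHS](_ : _ = kap * ze ^+ size tl * ze); last by ring.
  have ex (b b' : bool) : get s (lx l, i) = None \/ b' = false ->
      (get s (lx l, i) = None \/ get s (lx l, i) = Some false) ->
      Ex q (if get s (lx l, i) is Some _ then (lw l, i, b) :: s else (lx l, i, b') :: (lw l, i, b) :: s)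
        [seq (u, i) | u <- ch (lx l)] k <= kap * ze ^+ size tl *
      (if b then if b' then 0 else al else if b' then 1 else ze).
    move=> hb hx; apply: (Ex_le q01') => s' e; rewrite /k.
    have -> : get s' (lw l, i) = Some b.
      apply: ext_get e _; case: (get s (lx l, i)) => [_|] /=; rewrite ?eqxx//.
      by rewrite xpair_eqE eq_sym (negbTE wx).
    have -> : get s' (lx l, i) = Some b'.
      apply: ext_get e _; case gxi : (get s (lx l, i)) hb hx => [b0|] hb hx /=; last by rewrite eqxx.
      rewrite xpair_eqE (negbTE wx) /= gxi; case: hb => // ->; by case: hx.
    by clear; case: b; case: b'.
  rewrite /cs /= gw /= !xpair_eqE !(negbTE wx) /=.
  case gxi : (get s (lx l, i)) gx ex => [[]|] // _ ex.
    have e1 := ex true false (or_intror erefl) (or_intror erefl).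
    have e0 := ex false false (or_intror erefl) (or_intror erefl).
    have p0 : 0 <= 1 - q by rewrite subr_ge0.
    apply: le_trans (lerD (ler_wpM2l p0 e1) (ler_wpM2l q0 e0)) _ => /=.
    rewrite -subr_ge0 (_ : _ - _ = kap * ze ^+ size tl * ((1 - q) * (ze - al))); last by ring.
    by rewrite mulr_ge0// mulr_ge0// subr_ge0 -(ler_pM2l (ltr0n R 2)) (le_trans _ alze)// mulrDl mul1r lerD2r ltW.
  have e11 := ex true true (or_introl erefl) (or_introl erefl).
  have e10 := ex true false (or_introl erefl) (or_introl erefl).
  have e01 := ex false true (or_introl erefl) (or_introl erefl).
  have e00 := ex false false (or_introl erefl) (or_introl erefl).
  rewrite /= in e11 e10 e01 e00.
  have p0 : 0 <= 1 - q by rewrite subr_ge0.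
  apply: le_trans (lerD (ler_wpM2l p0 (lerD (ler_wpM2l p0 e11) (ler_wpM2l q0 e10)))
     (ler_wpM2l q0 (lerD (ler_wpM2l p0 e01) (ler_wpM2l q0 e00)))) _.
  (* A single ring of [w] has value [al], a single ring of [x] value 1, with equal weights
     [(1 - q) * q]: this is the origin of [1 + al <= 2 * ze]. A double ring costs nothing, which
     leaves the square term. *)
  rewrite -subr_ge0 (_ : _ - _ = kap * ze ^+ size tl *
    ((1 - q) * q * (2 * ze - 1 - al) + (1 - q) ^+ 2 * ze)); last by ring.
  by rewrite mulr_ge0// addr_ge0// ?mulr_ge0 ?sqr_ge0 ?(ltW z0)//; move: alze; lra.
apply: (bnd_le q01' kw); apply: (step_bnd (pos := (lx l, i))) => //=.
- by move=> s'; rewrite /k mulr_ge0//; case: ifP => _; case: ifP => _ //; exact: ltW.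
- move=> s' es' wfs' allF.
  apply: (okn_cond1 (cond_same s' (lx l) es' wfs' (allF _ we) _ xp wp)); first by rewrite allF.
  rewrite /k !allF// /= -mulrA ler_wpM2l// [leRHS]mulrC ler_wpM2r//.
  rewrite /wgt /= eqxx /= rem_nxs// (negbTE r0); case: ifP => // rL'.
  by have -> : (rem (lt l) i).-1 = L by move: rL rL'; rewrite /rm; slia.
- move=> s' u es' wfs' ue gu oth; case: (eqVneq u (lw l)) => [e|uw].
    subst u; rewrite /mv (negbTE wx); apply: (okn_entry (cond_new s' es' wfs')).
    rewrite /k gu eqxx oth//; last by rewrite eq_sym.
    by rewrite /= le_eqVlt; apply/orP; left; apply/eqP; ring.
  have gw' : get s' (lw l, i) = Some false by apply: oth => //; rewrite eq_sym.
  case: (eqVneq u (lx l)) => [e|ux].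
    subst u; rewrite /mv eqxx.
    have rd := ext_read (pos := (lx l, i)) csE es'.
    have c1' : cond1 s' ((lx l, i) :: hist) (parent (lx l), nxs i) tl.
      split=> //=; [exact: nxs_lt|exact: (read_LvT rd Ht c)|].
      case: (tl) c => // l2 tl2 [/and3P[b1 b2 b3] c']; split=> //; first exact: desc_up.
      by apply: contraNN b3; exact: desc_parent.
    apply: (okn_cond1 c1'); rewrite /k gw' gu /= mulr1 ler_wpM2l//.
    case: (tl) c c1' => //= l2 tl2 [b c'] c1'; rewrite exprS ler_wpM2r ?zen_ge0//.
    case: (eqVneq (parent (lx l)) (lx l2)) => [e|ne]; last by rewrite /wgt /= (negbTE ne).
    have [_ _ H' _] := c1'; have h' := H' l2 (mem_head _ _).
    rewrite e; apply: (wgt_arr h' iN gu); first by rewrite -e; exact: (mem_ch chP).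
    by case/and3P: b => _ _; apply: contraNneq => <-; rewrite desc_refl.
  rewrite /mv (negbTE ux); move: (ue); rewrite inE (negbTE ux) /= => uch'.
  have uw' : ~~ desc (lw l) u.
    apply/negP => /(desc_ch chP uch')[e|]; first by rewrite e eqxx in uw.
    by apply/negP; exact: (ch_ndesc tree chP wch).
  apply: (okn_cond1 (cond_same s' u es' wfs' gw' _ (ch_desc chP uch') uw')).
    by rewrite oth//; rewrite eq_sym.
  rewrite /k gw' oth//; last by rewrite eq_sym.
  rewrite /= -mulrA ler_wpM2l// [leRHS]mulrC ler_wpM2r//.
  by rewrite /wgt /= (negbTE ux).
Qed.

End LevelStep.

(* A block: the walker, in a fresh subtree with root y, is followed for at most
   N2 slots and down to depth m below y.  The stage of the l-th candidate
   for a level, at depth lev l below y, is S0 (not reached yet), S1 t (just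
   reached, in slot t), S2 l (a level has been created) or SZ (lost). *)
Variables (m' D N2 : nat) (c2 mu : R).
Hypothesis m'0 : (0 < m')%N.
Hypothesis chD : forall x, (2 <= size (ch x) <= D)%N.
Hypothesis c201 : 0 < c2 <= 1.
Hypothesis c2q : c2 <= q ^+ (D * L).
Hypothesis N2N : (N2 + L + 2 <= N)%N.
Hypothesis N20 : (0 < N2)%N.
Hypothesis mu0 : 0 <= mu.

Let m := (2 * m' + 1)%N.
Let p' := (1 - q) * q ^+ D.
(** Minus the slope of the chord from the value 1 at [J = 0] to [al * ze ^+ m'] at [J = m']. *)
Let lam := (1 - al * ze ^+ m') / m'%:R.
Hypothesis muN : 1 <= mu * (p' * N2%:R).
Hypothesis startle : 1 - lam * (m'%:R * (c2 / 6)) + mu * m%:R <= al.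

Inductive stage := S0 | S1 of nat | S2 of V * V * nat | SZ.

(** Creating a level reads the clocks of its vertex and of its children. Candidates two generations
    apart thus do not share clocks, and none of them is the vertex [y] itself. *)
Definition lev l := (2 * l + 1)%N.

(** Exactly what makes a vertex at depth [k] below [y] fresh at its first visit. *)
Definition Frk (s : info) y k := forall u i, desc y u ->
  ((dep u = dep y + k)%N -> get s (u, i) <> Some true) /\
  ((dep y + k < dep u)%N -> get s (u, i) = None).

(** In stage [S1 t] the inequality on [rem] says that the arrival dates back at most [j + 1] slots;
    what has been read during the stay is then outside the window before [t]. *)
Definition stOK (s : info) (hist : seq (V * nat)) (pos : V * nat) y j k (st : stage) : Prop :=
  match st with
  | S0 => (dep pos.1 < dep y + k)%N /\ Frk s y k
  | S1 t => [/\ dep pos.1 = (dep y + k)%N, (t < N)%N & (N <= rem t pos.2 + j.+1)%N] /\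
     [/\ (forall i, get s (pos.1, i) = Some true -> i = t),
      (forall u i, desc pos.1 u -> u != pos.1 -> u \notin ch pos.1 -> get s (u, i) = None) &
      (forall u i b, u \in ch pos.1 -> get s (u, i) = Some b ->
         [/\ b = false, (pos.1, i) \in hist & ~~ (0 < rem t i <= L)%N])]
  | S2 l => [/\ Lv s hist l, below pos.1 (lx l) (lw l), dep (lx l) = (dep y + k)%N & desc y (lx l)]
  | SZ => True
  end.

(** Here [j] counts the slots used by the block. Field [b_fresh]: apart from silent slots of [y], no
    known bit in the subtree is met again before the block ends. Field [b_v0]: in a block started at
    [v] the slot is [j], so the initial state cannot recur. *)
Record blk (s : info) (hist : seq (V * nat)) (pos : V * nat) y j (st : nat -> stage)
   (ls : seq (V * V * nat)) : Prop := {
  b_wf : wf s;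
  b_slot : (pos.2 < N)%N;
  b_j : (j < N2)%N;
  b_vy : desc v y;
  b_yx : desc y pos.1;
  b_d : (dep pos.1 < dep y + m)%N;
  b_chain : chain y ls;
  b_Lv : forall l, l \in ls -> Lv s hist l;
  b_v0 : y = v -> pos.2 = j;
  b_fresh : forall u i b, (i < N)%N -> desc y u -> get s (u, i) = Some b -> (u != y) || b ->
     (N2 - j <= rem i pos.2)%N;
  b_Fr : Frk s y m;
  b_st : forall l, (l < m')%N -> stOK s hist pos y j (lev l) (st l)
}.

Definition upd x' i y k st :=
  match st with
  | S0 => if dep x' == (dep y + k)%N then S1 i else S0
  | S1 t => SZ
  | S2 l => if x' == lx l then SZ else S2 l
  | SZ => SZ
  end.

Lemma mv_neq x u : x != r -> u \in edges x -> mv x u != x.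
Proof.
move=> xr; have [_ px] := edges_nr xr; by rewrite /mv; case: (u =P x) => [//|/eqP].
Qed.

Lemma blk_nr s hist pos y j st ls : blk s hist pos y j st ls -> pos.1 != r.
Proof. by move=> B; apply: (desc_nr tree vr); apply: desc_trans (b_vy B) (b_yx B). Qed.

Lemma edges_dep x u : x != r -> u \in edges x -> (dep u <= (dep x).+1)%N.
Proof. by move=> xr; rewrite inE => /orP[/eqP->//|/(ch_dep tree chP)->]. Qed.

Lemma read_Frk s s' pos x' y k : read s s' pos -> pos.1 != r -> Frk s y k ->
  (dep pos.1 < dep y + k)%N -> (dep x' < dep y + k)%N ->
  (forall u, u \in edges pos.1 -> get s' (u, pos.2) = Some true -> mv pos.1 u = x') ->
  Frk s' y k.
Proof.
move=> rd xr fr dx dx' tr u i yu; have [f1 f2] := fr u i yu.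
case: (boolP (u \in edges pos.1)) => ue; last by rewrite (read_notin _ rd ue).
case: (eqVneq i pos.2) => [ei|ii]; last by rewrite (read_slot _ rd ii).
have du := edges_dep xr ue.
split; last by move: dx du; clear; lia.
rewrite ei => dk /(tr u ue); rewrite /mv; case: eqP => [uE|_ uE].
  by move: dx dk; rewrite uE; clear; lia.
by move: dx' dk; rewrite -uE; clear; lia.
Qed.

Lemma stOK_upd s s' hist pos y j st ls x' l : blk s hist pos y j st ls -> read s s' pos ->
  x' = parent pos.1 \/ x' \in ch pos.1 ->
  (forall u, u \in edges pos.1 -> get s' (u, pos.2) = Some true -> mv pos.1 u = x') ->
  (l < m')%N ->
  stOK s' (pos :: hist) (x', nxs pos.2) y j.+1 (lev l) (upd x' pos.2 y (lev l) (st l)).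
Proof.
move=> B rd x'x tr lm; have xr := blk_nr B; have := b_st B lm.
have dx' : (dep x' <= (dep pos.1).+1)%N.
  case: x'x => [->|/(ch_dep tree chP)->//]; have := dep_parent_le tree pos.1.
  by clear; lia.
case: (st l) => [|t|l1|] //=.
  move=> [dx fr]; case: eqP => [dk|dk]; last first.
    have dx2 : (dep x' < dep y + lev l)%N by move: dx' dx dk; clear; lia.
    by split=> //; apply: (read_Frk rd xr fr dx dx2 tr).
  have x'c : x' \in ch pos.1.
    case: x'x => // e; have := dep_parent_le tree pos.1; rewrite -e; move: dx dk; clear; lia.
  have dd := ch_dep tree chP x'c.
  have yx' : desc y x' by exact: (desc_trans (b_yx B) (ch_desc chP x'c)).
  have nd u i : desc x' u -> u != x' -> get s' (u, i) = None.
    move=> x'u ux'; have ddu := desc_dep tree x'u ux'.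
    rewrite (read_notin _ rd).
      by have [_ ->//] := fr u i (desc_trans yx' x'u); move: ddu dk; clear; lia.
    by apply/negP => /(edges_dep xr); move: ddu dd; clear; lia.
  split; split=> //=.
  - exact: b_slot B.
  - rewrite rem_nxs ?(b_slot B)//; rewrite (_ : rem pos.2 pos.2 = 0%N) /=; last by rewrite /rem leqnn subnn.
    by clear; lia.
  - move=> i gi; apply/eqP; apply/negPn/negP => ii; move: gi; rewrite (read_slot _ rd ii).
    by have [f1 _] := fr x' i yx'; exact: f1.
  - by move=> u i x'u ux' _; exact: nd.
  - by move=> u i b ux'; rewrite nd//; [exact: (ch_desc chP ux')|exact: (ch_neq tree chP ux')].
move=> [lv b dk yl]; case: eqP => [//|ne] /=; split=> //.
- exact: (read_Lv rd lv b).
- have [/and3P[b1 b2 b3] [h0 _]] := (b, lv).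
  case: x'x => [e|x'c]; last exact: (below_desc tree chP (lv_ch h0) b (ch_desc chP x'c)).
  apply/and3P; split; [by rewrite e; exact: desc_up|exact/eqP|].
  by rewrite e; apply: contraNN b3; exact: desc_parent.
Qed.

Lemma stOK_stay s s' hist pos y j st ls l : blk s hist pos y j st ls -> read s s' pos ->
  (forall u, u \in edges pos.1 -> get s' (u, pos.2) = Some false) -> (l < m')%N ->
  stOK s' (pos :: hist) (pos.1, nxs pos.2) y j.+1 (lev l) (st l).
Proof.
move=> B rd allF lm; have xr := blk_nr B; have := b_st B lm.
case: (st l) => [|t|l1|] //=.
- move=> [dx fr]; split=> //; apply: (read_Frk rd xr fr dx dx) => u ue; by rewrite allF.
- move=> [[dk tN tr] [h1 h2 h3]].
  have jN := b_j B; have iN := b_slot B.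
  split; split=> //=.
  + rewrite rem_nxs//; case: eqP => [_|r0]; move: tr jN N2N; try move: r0; clear; lia.
  + move=> i; case: (eqVneq i pos.2) => [->|ii]; first by rewrite allF ?mem_head.
    by rewrite (read_slot _ rd ii); exact: h1.
  + move=> u i xu ux uc; rewrite (read_notin _ rd) ?h2//.
    by rewrite inE negb_or ux.
  + move=> u i b uc; case: (eqVneq i pos.2) => [->|ii].
      rewrite allF ?inE ?uc ?orbT// => -[<-]; split=> //; first by rewrite -surjective_pairing eqxx.
      move: tr jN N2N; clear; lia.
    rewrite (read_slot _ rd ii) => /(h3 _ _ _ uc)[-> h w]; split=> //.
    by rewrite inE h orbT.
- by move=> [lv b dk yl]; split=> //; exact: (read_Lv rd lv b).
Qed.

Lemma blk_move s s' hist pos y j st ls x' st' : blk s hist pos y j st ls -> read s s' pos -> wf s' ->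
  (j.+1 < N2)%N -> desc y x' -> (dep x' < dep y + m)%N ->
  (forall u, u \in edges pos.1 -> get s' (u, pos.2) = Some true -> mv pos.1 u = x') ->
  (forall l, (l < m')%N -> stOK s' (pos :: hist) (x', nxs pos.2) y j.+1 (lev l) (st' l)) ->
  blk s' (pos :: hist) (x', nxs pos.2) y j.+1 st' ls.
Proof.
move=> B rd wfs' jN yx' dx' tr Hst; have iN := b_slot B; have xr := blk_nr B.
have jl := b_j B.
split=> //=.
- exact: nxs_lt.
- exact: b_vy B.
- exact: b_chain B.
- apply: (read_LvT rd (b_Lv B)); apply: chain_desc (b_chain B) (b_yx B) => l /(b_Lv B)[h _]; exact: h.
- by move=> /(b_v0 B) ij; rewrite ij /nxs; case: eqP => //; move: jN N2N; clear; lia.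
- move=> u i b iN' yu; case: (eqVneq i pos.2) => [->|ii].
    move=> _ _; rewrite rem_nxs// (_ : rem pos.2 pos.2 = 0%N) /=; last by rewrite /rem leqnn subnn.
    by move: N2N; clear; lia.
  rewrite (read_slot _ rd ii) => /(b_fresh B iN' yu) h /h; rewrite rem_nxs//.
  by case: eqP => [->|r0]; move: jN; try move: r0; clear; lia.
- exact: (read_Frk rd xr (b_Fr B) (b_d B) dx' tr).
Qed.

(** An interrupted block keeps only the older levels [ls]; those created in it are forgotten. *)
Lemma cond1_of_blk s s' hist pos y j st ls x' : blk s hist pos y j st ls -> read s s' pos -> wf s' ->
  x' = pos.1 \/ x' = parent pos.1 \/ x' \in ch pos.1 ->
  cond1 s' (pos :: hist) (x', nxs pos.2) ls.
Proof.
move=> B rd wfs' x'x.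
have c : chain pos.1 ls by apply: chain_desc (b_chain B) (b_yx B) => l /(b_Lv B)[h _]; exact: h.
split=> //=; first exact: (nxs_lt (b_slot B)).
  exact: (read_LvT rd (b_Lv B) c).
case: (ls) c (b_Lv B) => // l tl [b c] HL; have [h0 _] := HL l (mem_head _ _).
have /and3P[b1 b2 b3] := b; split=> //.
- case: x'x => [->//|[->|xc]]; first exact: desc_up.
  exact: (desc_trans b1 (ch_desc chP xc)).
- case: x'x => [->//|[->|xc]]; first by apply: contraNN b3; exact: desc_parent.
  by have /and3P[] := below_desc tree chP (lv_ch h0) b (ch_desc chP xc).
Qed.

Definition e2 k : R := (1 / 2) ^+ k.

(* gv, gc and gp: contribution of a candidate to the potential now, after a step
   to a child and after a step to the parent. *)
Definition gv k st (dd : nat) : R :=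
  match st with
  | S0 | S1 _ => c2 / 3 * (1 - e2 dd.+1)
  | S2 _ => 1 - e2 (dd - k)
  | SZ => 0
  end.

Definition gc k st (dd : nat) : R :=
  match st with
  | S0 => c2 / 3 * (1 - e2 dd.+2)
  | S1 _ => c2 / 2
  | S2 _ => 1 - e2 (dd.+1 - k)
  | SZ => 0
  end.

Definition gp k st (dd : nat) : R :=
  match st with
  | S0 => c2 / 3 * (1 - e2 dd)
  | S2 _ => 1 - e2 (dd.-1 - k)
  | _ => 0
  end.

(** The term in [G] is the expected gain from levels, [m - dd] the way still to go, and [p' * j] a
    charge for time that lifts the value to 1 after [N2] slots. [p'] is a lower bound for the
    probability that one given clock at a vertex rings alone in a slot. *)
Definition beta (G : R) (dd j : nat) : R := 1 - lam * G + mu * (m%:R - dd%:R + p' * j%:R).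

Lemma e2S k : e2 k.+1 = e2 k / 2. Proof. by rewrite /e2 exprS; lra. Qed.

Lemma e2_01 k : 0 < e2 k <= 1.
Proof. by rewrite /e2 exprn_gt0 ?exprn_ile1//; lra. Qed.

(** Against [b >= 2] clocks leading down there is one leading up, so [1 - e2 d] bounds from below
    the chance never to climb [d] generations. The constant [c2 / 3] is [2/3 * c2 * 1/2]: leave the
    candidate downwards, find the window silent, never come back from distance 1. Its companion
    [1 - e2 dd.+1] stands for not leaving the subtree of [y]. *)
Lemma g_avg s hist pos y j k st b dd : stOK s hist pos y j k st -> desc y pos.1 -> (2 <= b)%N ->
  dd = (dep pos.1 - dep y)%N ->
  (b%:R + 1) * gv k st dd <= b%:R * gc k st dd + gp k st dd.
Proof.
move=> h yx b2 ddE; have b2' : 2 <= b%:R :> R by rewrite ler_nat.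
have [c0 c1] := andP c201.
have bb : 0 <= b%:R - 2 :> R by rewrite subr_ge0.
have c3 : 0 <= c2 / 3 by rewrite divr_ge0// ltW.
have := e2_01 dd; case: st h => [|t|l|] /= h.
- move=> /andP[e0 e1]; rewrite !e2S.
  have := mulr_ge0 c3 (mulr_ge0 bb (ltW e0)).
  by lra.
- move=> /andP[e0 e1]; rewrite e2S.
  have := mulr_ge0 c3 bb.
  have := mulr_ge0 (mulr_ge0 (addr_ge0 (ler0n R b) ler01) c3) (ltW e0).
  by lra.
- case: h => -[h0 _] /and3P[b1 b2'' _] dk yl _; have := desc_dep tree b1 b2''.
  have ddk : (dep pos.1 = dep y + dd)%N.
    by move: ddE; have := desc_dep_le tree yx; clear; lia.
  rewrite dk ddk ltn_add2l => kd.
  have -> : (dd.+1 - k = (dd - k).+1)%N by move: kd; clear; lia.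
  have -> : (dd - k = (dd.-1 - k).+1)%N by move: kd; clear; lia.
  have /andP[e0 e1] := e2_01 (dd.-1 - k); rewrite !e2S.
  have := mulr_ge0 bb (ltW e0).
  by lra.
- by rewrite !mulr0 addr0.
Qed.

Lemma g_le1 k st dd : gv k st dd <= 1 /\ gc k st dd <= 1.
Proof.
have [c0 c1] := andP c201.
have h e : 0 < e <= 1 -> c2 / 3 * (1 - e) <= 1.
  move=> /andP[e0 e1]; have := mulr_ge0 (ltW c0) (ltW e0); lra.
case: st => [|t|l|] /=; split; try (by apply: h; exact: e2_01); try lra.
- by have /andP[e0 e1] := e2_01 (dd - k); lra.
- by have /andP[e0 e1] := e2_01 (dd.+1 - k); lra.
Qed.

Lemma lam_ge0 : 0 <= lam /\ lam * m'%:R = 1 - al * ze ^+ m'.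
Proof.
have [a0 a1] := andP al01; have [z0 z1] := andP ze01.
have zm : al * ze ^+ m' <= 1.
  by rewrite -[leRHS](mul1r 1) ler_pM ?(ltW a0) ?(ltW a1) ?zen_ge0// exprn_ile1// ltW.
rewrite /lam; split; first by rewrite divr_ge0// subr_ge0.
by rewrite divfK// pnatr_eq0; move: m'0; clear; case: (m').
Qed.

Lemma sum_le1 (G : nat -> R) : (forall l, G l <= 1) -> lam * \sum_(l < m') G l <= 1.
Proof.
move=> G1; have [l0 le] := lam_ge0.
apply: (@le_trans _ _ (lam * m'%:R)).
  apply: ler_wpM2l => //; rewrite -[m'%:R](_ : \sum_(l < m') 1 = _).
    by apply: ler_sum => i _; exact: G1.
  by rewrite sumr_const card_ord.
by rewrite le gerBl mulr_ge0 ?zen_ge0//; case/andP: al01 => /ltW.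
Qed.

Lemma p'0 : 0 < p'.
Proof. by have [q0 q1] := andP q01; rewrite mulr_gt0 ?exprn_gt0// subr_gt0. Qed.

Lemma beta_ge0 (G : nat -> R) dd j : (forall l, G l <= 1) -> (dd <= m)%N ->
  0 <= beta (\sum_(l < m') G l) dd j.
Proof.
move=> G1 dm; rewrite /beta addr_ge0 ?subr_ge0 ?sum_le1// mulr_ge0// addr_ge0 ?subr_ge0 ?ler_nat//.
by rewrite mulr_ge0// ltW// p'0.
Qed.

Lemma beta_timeout (G : nat -> R) dd : (forall l, G l <= 1) -> (dd <= m)%N ->
  1 <= beta (\sum_(l < m') G l) dd N2.
Proof.
move=> G1 dm; rewrite /beta; have := sum_le1 G1.
have : 0 <= mu * (m%:R - dd%:R) by rewrite mulr_ge0// subr_ge0 ler_nat.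
by move: muN; lra.
Qed.

(* The potential is a supermartingale of the free walk. *)
Lemma beta_avg b (G Gc Gp : R) (dd j : nat) : (2 <= b <= D)%N ->
  (b%:R + 1) * G <= b%:R * Gc + Gp -> 0 <= beta G dd j ->
  q ^+ b.+1 * beta G dd j.+1 + (1 - q) * q ^+ b *
     ((beta Gp dd j.+1 + mu) + b%:R * (beta Gc dd j.+1 - mu)) <= beta G dd j.
Proof.
move=> /andP[b2 bD] hG bt0; have [q0 q1] := andP q01'.
have [l0 _] := lam_ge0.
have p0 : 0 <= 1 - q by rewrite subr_ge0.
have qb : 0 <= q ^+ b by exact: exprn_ge0.
have b2' : 2 <= b%:R :> R by rewrite ler_nat.
have p'q : p' <= (1 - q) * q ^+ b.
  by rewrite /p' ler_wpM2l// ler_wiXn2l.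
have bS (G0 : R) : beta G0 dd j.+1 = beta G0 dd j + mu * p'.
  by rewrite /beta -natr1; ring.
have bG (G0 : R) : beta G0 dd j = beta G dd j + lam * (G - G0) by rewrite /beta; ring.
rewrite !bS (bG Gc) (bG Gp); move: (beta G dd j) bt0 => bt bt0.
have hl := ler_wpM2l l0 hG.
have mup : 0 <= mu * p' by rewrite mulr_ge0// ltW// p'0.
(* The [b] gains of [mu] against one loss leave at least [mu] since [b >= 2]; multiplied by the
   weight of a single ring this pays the time charge [mu * p']. *)
have step : (bt + lam * (G - Gp) + mu * p' + mu) + b%:R * (bt + lam * (G - Gc) + mu * p' - mu)
    <= (b%:R + 1) * (bt + mu * p') - mu.
  have b2'' : 0 <= b%:R - 2 :> R by rewrite subr_ge0.
  have := mulr_ge0 b2'' mu0.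
  by move: hl; lra.
have step2 := ler_wpM2l (mulr_ge0 p0 qb) step.
have S1 : q ^+ b.+1 + b.+1%:R * ((1 - q) * q ^+ b) <= 1 by have := binom_le1 b.+1 q01'.
have S2 := ler_wpM2r (addr_ge0 bt0 mup) S1.
have S3 := ler_wpM2l mu0 p'q.
move: step2 S2 S3; rewrite -natr1; set Q := q ^+ b.+1; set QQ := (1 - q) * q ^+ b.
by lra.
Qed.

(** The case of a walk at [y] when the clock of [y] is known to be silent in the current slot: only
    the [b] clocks of the children are averaged. Dropping the step up is allowed because [G] is
    nonnegative. *)
Lemma beta_avg_top b (G Gc : R) (dd j : nat) : (2 <= b <= D)%N ->
  (b%:R + 1) * G <= b%:R * Gc -> 0 <= G -> 0 <= beta G dd j ->
  q ^+ b * beta G dd j.+1 + (1 - q) * q ^+ b.-1 * (b%:R * (beta Gc dd j.+1 - mu)) <= beta G dd j.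
Proof.
move=> /andP[b2 bD] hG G0 bt0; have [q0 q1] := andP q01'.
have [l0 _] := lam_ge0.
have p0 : 0 <= 1 - q by rewrite subr_ge0.
have qb : 0 <= q ^+ b.-1 by exact: exprn_ge0.
have b2' : 2 <= b%:R :> R by rewrite ler_nat.
have p'q : p' <= (1 - q) * q ^+ b.-1.
  by rewrite /p' ler_wpM2l// ler_wiXn2l// (leq_trans (leq_pred _)).
have bS (H : R) : beta H dd j.+1 = beta H dd j + mu * p'.
  by rewrite /beta -natr1; ring.
have bG (H : R) : beta H dd j = beta G dd j + lam * (G - H) by rewrite /beta; ring.
rewrite !bS (bG Gc); move: (beta G dd j) bt0 => bt bt0.
have hl := ler_wpM2l l0 hG.
have lG : 0 <= lam * G by exact: mulr_ge0.
have mup : 0 <= mu * p' by rewrite mulr_ge0// ltW// p'0.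
have step : b%:R * (bt + lam * (G - Gc) + mu * p' - mu) <= b%:R * (bt + mu * p') - mu.
  have b2'' : 0 <= b%:R - 2 :> R by rewrite subr_ge0.
  have := mulr_ge0 b2'' mu0.
  by move: hl; move: mu0; lra.
have step2 := ler_wpM2l (mulr_ge0 p0 qb) step.
have S1 : q ^+ b + b%:R * ((1 - q) * q ^+ b.-1) <= 1 by have := binom_le1 b q01'.
have S2 := ler_wpM2r (addr_ge0 bt0 mup) S1.
have S3 := ler_wpM2l mu0 p'q.
move: step2 S2 S3; set Q := q ^+ b; set QQ := (1 - q) * q ^+ b.-1.
by lra.
Qed.

Lemma entry_blk s hist pos ls : entry s hist pos ls ->
  blk s hist pos pos.1 0 (fun=> S0) ls.
Proof.
move=> [[wfs iN vx] [nv c HL nd tr]].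
have Fr k : (0 < k)%N -> Frk s pos.1 k.
  move=> k0 u i yu; have ux : (dep pos.1 < dep u)%N -> u != pos.1.
    by apply: contraTneq => ->; rewrite ltnn.
  split=> [du|du]; rewrite nd//; apply: ux; move: k0 du; clear; lia.
split=> //=.
- exact: desc_refl.
- by rewrite /m; clear; lia.
- by move=> e; rewrite e eqxx in nv.
- move=> u i b iN' yu gu ub.
  case: (eqVneq u pos.1) ub gu => [->|uy] /= b1; last by rewrite nd.
  rewrite b1 => /(tr _ iN') <-; rewrite rem_nxs// (_ : rem i i = 0%N) /=; last by rewrite /rem leqnn subnn.
  by move: N2N; clear; lia.
- by apply: Fr; rewrite /m; clear; lia.
- by move=> l lm; split; [rewrite /lev; clear; lia|apply: Fr; rewrite /lev; clear; lia].
Qed.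

Lemma start_blk s : wf s -> (forall u i, desc v u -> get s (u, i) = None) ->
  blk s [::] (v, 0%N) v 0 (fun=> S0) [::].
Proof.
move=> wfs nd.
have Fr k : Frk s v k by move=> u i vu; rewrite nd.
split=> //=.
- by move: LN; clear; lia.
- exact: desc_refl.
- exact: desc_refl.
- by rewrite /m; clear; lia.
- by move=> u i b _ vu; rewrite nd.
- by move=> l lm; split=> //; rewrite /lev; clear; lia.
Qed.

(** The [c2 / 6] of [startle] is the value [c2 / 3 * (1 - 1 / 2)] of an untouched candidate seen
    from [y]. *)
Lemma beta_start0 : beta (\sum_(l < m') gv (lev l) S0 0) 0 0 <= al.
Proof.
apply: le_trans startle; rewrite /beta sumr_const card_ord /= e2S /e2 expr0 mulr0 addr0 subr0.
rewrite -[X in lam * X]mulr_natl; lra.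
Qed.

Definition win (l : V * V * nat) : seq (V * nat) :=
  [seq (u, bk N (lt l) e) | u <- [seq u <- edges (lx l) | u != lw l], e <- iota 1 L].

Lemma win_size l : lw l \in ch (lx l) -> (size (win l) <= D * L)%N.
Proof.
move=> wc; rewrite size_allpairs size_iota leq_mul2r; apply/orP; right.
rewrite -(rem_filter _ (uniq_edges _)) size_rem ?inE ?wc ?orbT//=.
by case/andP: (chD (lx l)).
Qed.

Lemma winP l c : (lt l < N)%N -> c \in win l ->
  [/\ c.1 \in edges (lx l), c.1 != lw l, (c.2 < N)%N & (0 < rem (lt l) c.2 <= L)%N].
Proof.
move=> tN /allpairsP[[u e] [h1 h2 ->]]; move: h1 h2.
rewrite mem_filter mem_iota => /andP[/= uw ue] /= eL.
have [|h3 h4] := @rem_bk N (lt l) e tN; first by move: LN eL; clear; lia.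
by split=> //; rewrite h4; move: eL; clear; lia.
Qed.

Lemma mem_win l u i : (lt l < N)%N -> u \in edges (lx l) -> u != lw l -> (i < N)%N ->
  (0 < rem (lt l) i <= L)%N -> (u, i) \in win l.
Proof.
move=> tN ue uw iN rL; apply/allpairsP; exists (u, rem (lt l) i); split.
- by rewrite mem_filter uw.
- by rewrite mem_iota /= add1n ltnS.
- by rewrite /= bk_rem.
Qed.

Definition setst (st : nat -> stage) l0 x := fun l => if l == l0 then x else st l.

(** * Reading the window of a candidate that has just been left downwards *)

Section Arm.
Variables (s : info) (hist : seq (V * nat)) (pos : V * nat) (y : V) (j : nat).
Variables (st : nat -> stage) (ls : seq (V * V * nat)) (l0 : nat) (l : V * V * nat).
Hypotheses (B : blk s hist pos y j st ls) (l0m : (l0 < m')%N) (stl0 : st l0 = SZ).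
Hypotheses (h0 : Lv0 s hist l) (xc : pos.1 \in ch (lx l)) (pw : pos.1 != lw l).
Hypotheses (dk : dep (lx l) = (dep y + lev l0)%N) (yl : desc y (lx l)).
Hypothesis rt : (N <= rem (lt l) pos.2 + j.+1)%N.

(** The window concerns only clocks at depths [lev l0] and [lev l0 + 1] below [y], hence no other
    candidate, and only slots that the block will not meet any more. So the invariant survives
    whatever the window shows. *)
Lemma arm_blk s' : ext s (win l) s' ->
  blk s' hist pos y j st ls /\
  ((forall c, c \in win l -> get s' c = Some false) ->
   blk s' hist pos y j (setst st l0 (S2 l)) ls).
Proof.
move=> es'; have tN := lv_t h0; have wch := lv_ch h0.
have dp := ch_dep tree chP xc.
have xr : lx l != r := desc_nr tree vr (lv_v h0).
have same c : c \notin win l -> get s' c = get s c by move=> cn; exact: (ext_notin es' cn).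
have mono c b : get s c = Some b -> get s' c = Some b by move=> cn; exact: (ext_get es' cn).
have sameD u i : (dep y + lev l0 + 1 < dep u)%N -> get s' (u, i) = get s (u, i).
  move=> du; apply: same; apply/negP => /(winP tN)[/= ue _ _ _].
  by have := edges_dep xr ue; move: du dk; clear; lia.
have sameB c : ~~ desc (lx l) c.1 -> get s' c = get s c.
  move=> nd; apply: same; apply: contraNN nd => /(winP tN)[ue _ _ _]; exact: edges_desc.
have wfs' : wf s'.
  case/andP: (b_wf B) => us oks; apply/andP; split; first exact: ext_uniq es' us.
  apply: ext_all es' oks _; apply/allP => -[u i] /(winP tN)[/= ue _ _ _].
  by apply: okv; apply: desc_trans (lv_v h0) _; exact: edges_desc.
have st' : forall l', (l' < m')%N -> stOK s' hist pos y j (lev l') (st l').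
  move=> l' l'm; have := b_st B l'm; case E : (st l') => [|t|l2|] //=.
  - move=> [dx fr]; split=> // u i yu; have [f1 f2] := fr u i yu.
    have d2 : (lev l0 + 1 < lev l')%N by move: dx dp dk; rewrite /lev; clear; lia.
    by split=> du; rewrite sameD; [exact: f1|move: d2 du; clear; lia|exact: f2|move: d2 du; clear; lia].
  - by move=> [[+ _ _] _]; move: dp dk; rewrite /lev; clear; lia.
  - move=> [lv b dk2 yl2]; split=> //; have [h2 _] := lv.
    apply: (Lv_ext (rho := lx l) lv _ sameB mono) => //.
    have /and3P[b1 b2 b3] := b; apply/and3P; split.
    + by rewrite -(ch_parent chP xc); exact: desc_up.
    + apply/eqP => e; move: dk2; rewrite -e dk => /addnI el.
      have {}el : l' = l0 by move: el; rewrite /lev; clear; lia.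
      by move: E; rewrite el stl0.
    + by apply: contraNN b3 => wx; apply: desc_trans wx (ch_desc chP xc).
have B' st1 : (forall l', (l' < m')%N -> stOK s' hist pos y j (lev l') (st1 l')) ->
    blk s' hist pos y j st1 ls.
  move=> Hst; split=> //; try by case: B.
  - move=> l' l'l; apply: (Lv_ext (b_Lv B l'l) (rho := lx l)) => //.
    apply: (chain_below (ls := ls) (s := s) (hist := hist)) => //; first by move=> l2 /(b_Lv B)[].
    by apply: chain_desc (b_chain B) yl => l2 /(b_Lv B)[h _]; exact: h.
  - move=> u i b iN yu; case: (boolP ((u, i) \in win l)) => [/(winP tN)[/= ue uw _ /andP[r0 rL]] _ _|ni].
      have jN := b_j B.
      rewrite (@rem_sub N (lt l) pos.2 i) ?(b_slot B)//; move: rL rt N2N jN; clear; lia.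
    by rewrite same//; exact: (b_fresh B).
  - move=> u i yu; have [f1 f2] := b_Fr B i yu.
    have d2 : (lev l0 + 1 < m)%N by move: l0m; rewrite /lev /m; clear; lia.
    by split=> du; rewrite sameD; [exact: f1|move: d2 du; clear; lia|exact: f2|move: d2 du; clear; lia].
split; first exact: B'.
move=> allF; apply: B' => l' l'm; rewrite /setst; case: eqP => [->|_]; last exact: st'.
have wx := ch_ndesc tree chP wch.
split=> //.
  split; last by move=> u i iN rL ue uw; apply: allF; exact: mem_win.
  split; [exact: wch|exact: (lv_v h0)|exact: (lv_nv h0)|exact: tN| | |].
  - move=> u i wu uw; rewrite same ?(lv_below h0)//; apply/negP => /(winP tN)[/=].
    rewrite inE => /orP[/eqP e|uc] _ _ _; first by rewrite e (negbTE wx) in wu.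
    by case: (desc_ch chP uc wu) => [e|]; [rewrite e eqxx in uw|apply/negP].
  - move=> i b; rewrite same; first exact: (lv_wF h0).
    by apply/negP => /(winP tN)[/= _]; rewrite eqxx.
  - move=> i; case: (boolP ((lx l, i) \in win l)) => [/allF->//|ni].
    by rewrite same//; exact: (lv_x h0).
apply/and3P; split; [exact: (ch_desc chP xc)|exact: (ch_neq tree chP xc)|].
by apply/negP => /(desc_ch chP xc)[e|]; [move: pw; rewrite e eqxx|apply/negP].
Qed.

Hypothesis noT : forall c, c \in win l -> get s c != Some true.

Local Notation dd := (dep pos.1 - dep y)%N.
Local Notation GG st := (\sum_(l < m') gv (lev l) (st l) dd).

Lemma arm_sum : GG (setst st l0 (S2 l)) = GG st + 1 / 2.
Proof.
rewrite (bigD1 (Ordinal l0m)) //= [in RHS](bigD1 (Ordinal l0m)) //= stl0 /= /setst eqxx /=.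
rewrite add0r (_ : dd - lev l0 = 1)%N; last first.
  by rewrite (ch_dep tree chP xc) dk; clear; lia.
rewrite e2S /e2 expr0 addrC; congr (_ + _); last by lra.
apply: eq_bigr => i il; have /negbTE -> // : (i : nat) != l0.
by apply: contra il => /eqP e; apply/eqP/val_inj.
Qed.

(** The window is silent with weight at least [c2], since it has at most [D * L] bits, none known to
    ring; the new level, seen from distance 1, is then worth [1 / 2]. *)
Lemma arm_bnd M :
  (forall s hist pos y j st ls, blk s hist pos y j st ls -> pos \notin hist ->
    bnd P X q s (F M hist pos) (kap * (ze ^+ size ls *
      beta (\sum_(l < m') gv (lev l) (st l) (dep pos.1 - dep y)) (dep pos.1 - dep y) j))) ->
  pos \notin hist ->
  bnd P X q s (F M hist pos) (kap * (ze ^+ size ls * (beta (GG st) dd j - lam * (c2 / 2)))).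
Proof.
move=> IHB ph.
pose a := kap * (ze ^+ size ls * beta (GG (setst st l0 (S2 l))) dd j).
pose a' := kap * (ze ^+ size ls * beta (GG st) dd j).
pose k (s' : info) := if all (fun c => get s' c == Some false) (win l) then a else a'.
have aE : a = a' - kap * ze ^+ size ls * (lam / 2).
  by rewrite /a /a' arm_sum /beta; ring.
have [lam0 _] := lam_ge0.
have kz : 0 <= kap * ze ^+ size ls by rewrite mulr_ge0 ?zen_ge0.
have aa' : a <= a' by rewrite aE gerBl mulr_ge0// divr_ge0.
apply: (@bnd_le _ _ _ _ _ _ _ q01' _ _ (Ex q s (win l) k)); last first.
  apply: bnd_Ex => s' es'; have [B1 B2] := arm_blk es'.
  rewrite /k; case: ifP => [/allP H|_]; last exact: IHB.
  by apply: IHB => //; apply: B2 => c /H/eqP.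
have := @Ex_allF _ _ _ q01' s (win l) k a a' aa' noT.
move=> /(_ _ _)/le_trans; apply.
- move=> s' _ H; rewrite /k ifT//; apply/allP => c /H->; exact: eqxx.
- by move=> s' _; rewrite /k; case: ifP.
have qw : c2 <= q ^+ size (win l).
  have [q0 q1] := andP q01'.
  by apply: (le_trans c2q); rewrite ler_wiXn2l// win_size//; exact: (lv_ch h0).
rewrite (_ : _ + _ = a' - kap * ze ^+ size ls * (lam / 2) * q ^+ size (win l)); last by rewrite aE; ring.
rewrite [leRHS](_ : _ = a' - kap * ze ^+ size ls * (lam / 2) * c2); last by rewrite /a'; ring.
by rewrite lerD2l lerN2 ler_wpM2l// mulr_ge0// divr_ge0.
Qed.

End Arm.

Fixpoint lsS (st : nat -> stage) (ls : seq (V * V * nat)) k :=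
  if k is k'.+1 then if st k' is S2 l then l :: lsS st ls k' else lsS st ls k' else ls.

Lemma lsS_mem st ls k l : l \in lsS st ls k -> l \in ls \/ exists2 k', (k' < k)%N & st k' = S2 l.
Proof.
elim: k => [|k IH] /=; first by left.
case e : (st k) => [|t|l2|]; rewrite ?inE.
1,2,4: by move=> /IH[h|[k' k'k e']]; [left|right; exists k' => //; apply: leq_trans k'k _].
case/orP=> [/eqP->|/IH[h|[k' k'k e']]]; first by right; exists k.
  by left.
by right; exists k' => //; exact: leq_trans k'k _.
Qed.

Lemma lsS_chain s hist pos y j st ls k rho : blk s hist pos y j st ls -> (k <= m')%N -> desc y rho ->
  (forall k' l, (k' < k)%N -> st k' = S2 l -> below rho (lx l) (lw l)) ->
  chain rho (lsS st ls k).
Proof.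
move=> B; elim: k rho => [|k IH] rho km yr H /=.
  by apply: chain_desc (b_chain B) yr => l /(b_Lv B)[h _]; exact: h.
have IH' := IH _ (ltnW km).
have rec : chain rho (lsS st ls k) by apply: IH' => // k' l k'k; apply: H; exact: ltnW.
case e : (st k) => [|t|l|] //=; have bl := H k l (leqnn _) e; split=> //.
have := b_st B km; rewrite e /= => -[lv b dk yl].
apply: IH' => // k' l2 k'k e2'; have b2 := H k' l2 (ltnW k'k) e2'.
have := b_st B (ltn_trans k'k km); rewrite e2' /= => -[lv2 _ dk2 yl2].
have dlt : (dep (lx l2) < dep (lx l))%N by rewrite dk dk2 /lev; move: k'k; clear; lia.
have [/and3P[b11 b12 b13] /and3P[b21 b22 b23]] := (bl, b2).
apply/and3P; split.
- have /orP[//|h] := desc_cmp b21 b11.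
  by have := desc_dep_le tree h; move: dlt; clear; lia.
- by apply/eqP => e1; move: dlt; rewrite e1 ltnn.
- by apply: contraNN b23 => h; exact: (desc_trans h b11).
Qed.

Lemma lsS_size st ls k dd : (forall l, (l < k)%N -> (if st l is S2 _ then true else false) || (if st l is SZ then true else false)) ->
  exists J, [/\ (J <= k)%N, size (lsS st ls k) = (size ls + J)%N &
    \sum_(l < k) gc (lev l) (st l) dd <= J%:R].
Proof.
elim: k => [|k IH] H; first by exists 0%N; rewrite big_ord0 /= addn0.
have [J [Jk sz le]] := IH (fun l lk => H l (ltnW lk)).
rewrite /= big_ord_recr /=; have := H k (leqnn _); case: (st k) => [|t|l|] //= _.
  exists J.+1; rewrite /= sz addnS; split=> //.
  rewrite -natr1 lerD// gerBl; by have /andP[/ltW] := e2_01 (dd.+1 - lev k).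
by exists J; rewrite addr0; split=> //; exact: ltnW.
Qed.

(** [pow_chord] scaled by [al]; the chord starts at 1 rather than at [al], which leaves room
    [(1 - al) * (m' - J)]. *)
Lemma al_chord J : (J <= m')%N -> al * ze ^+ J <= 1 - lam * J%:R.
Proof.
move=> Jm; have [a0 a1] := andP al01; have [z0 z1] := andP ze01.
have zz : 0 <= ze <= 1 by rewrite ltW.
have h := pow_chord zz Jm.
have [_ le] := lam_ge0.
have m0 : 0 < m'%:R :> R by rewrite ltr0n.
rewrite -(ler_pM2l m0).
have e : m'%:R * (1 - lam * J%:R) = m'%:R - (lam * m'%:R) * J%:R by ring.
rewrite e le.
have Jm' : J%:R <= m'%:R :> R by rewrite ler_nat.
have h1 := ler_wpM2l (ltW a0) h.
have h2 : 0 <= (1 - al) * (m'%:R - J%:R) by rewrite mulr_ge0// subr_ge0// ltW.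
by move: h1 h2; lra.
Qed.

(** * One step of the walk inside a block *)

Section BlockStep.
Variable M : nat.
Hypothesis IH1 : forall s hist pos ls, cond1 s hist pos ls -> pos \notin hist ->
  bnd P X q s (F M hist pos) (kap * W1 ls pos).
Hypothesis IHB : forall s hist pos y j st ls, blk s hist pos y j st ls -> pos \notin hist ->
    bnd P X q s (F M hist pos) (kap * (ze ^+ size ls *
      beta (\sum_(l < m') gv (lev l) (st l) (dep pos.1 - dep y)) (dep pos.1 - dep y) j)).

Lemma new_bnd s hist pos ls : entry s hist pos ls -> pos \notin hist ->
  bnd P X q s (F M hist pos) (kap * (al * ze ^+ size ls)).
Proof.
move=> en ph; have := IHB (entry_blk en) ph; apply: (bnd_le q01').
rewrite subnn ler_wpM2l// [leRHS]mulrC ler_wpM2l ?zen_ge0//; exact: beta_start0.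
Qed.

Variables (s : info) (hist : seq (V * nat)) (x : V) (i : nat) (y : V) (j : nat).
Variables (st : nat -> stage) (ls : seq (V * V * nat)).
Hypotheses (B : blk s hist (x, i) y j st ls) (ph : (x, i) \notin hist).
Local Notation pos := (x, i).
Let dd := (dep x - dep y)%N.
Let G := \sum_(l < m') gv (lev l) (st l) dd.
Let Gc := \sum_(l < m') gc (lev l) (st l) dd.
Let Gp := \sum_(l < m') gp (lev l) (st l) dd.
Let kz := kap * ze ^+ size ls.

Lemma kz0 : 0 <= kz. Proof. by rewrite mulr_ge0 ?zen_ge0. Qed.
Lemma ddE : dep x = (dep y + dd)%N.
Proof. by have := desc_dep_le tree (b_yx B); rewrite /dd /=; clear; lia. Qed.
Lemma ddm : (dd < m)%N.
Proof. by have := b_d B; rewrite /= ddE ltn_add2l. Qed.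
Lemma gp_le1 k st0 d0 : gp k st0 d0 <= 1.
Proof.
have [c0 c1] := andP c201; case: st0 => [|t|l|] /=; try lra.
  by have /andP[e0 e1] := e2_01 d0; have := mulr_ge0 (ltW c0) (ltW e0); lra.
by have /andP[e0 e1] := e2_01 (d0.-1 - k); lra.
Qed.

Lemma safe_blk s' x' st' : blk s' (pos :: hist) (x', nxs i) y j.+1 st' ls -> safe (x', nxs i).
Proof.
move=> B'; rewrite /safe /= (desc_trans (b_vy B') (b_yx B')) /=.
apply/eqP => -[e1 e2']; have yv : y = v.
  by apply: (desc_anti tree (b_vy B')); have := b_yx B'; rewrite /= e1.
by have := b_v0 B' yv; rewrite /= e2'.
Qed.

Lemma okn_blk s' x' st' (k : info -> R) : blk s' (pos :: hist) (x', nxs i) y j.+1 st' ls ->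
  kz * beta (\sum_(l < m') gv (lev l) (st' l) (dep x' - dep y)) (dep x' - dep y) j.+1 <= k s' ->
  okn M hist pos k s' (x', nxs i).
Proof.
move=> B' kk; split; first by left; exact: safe_blk B'.
move=> _ ph'; apply: (bnd_le q01' kk); have := IHB B' ph'.
by rewrite /kz mulrA.
Qed.

(** The end of a block without success, by timeout or by leaving the subtree of [y]: the charge is
    one factor [ze] for each older level, also when the walk lands on the vertex of the nearest one,
    by [wgt_arr]. *)
Lemma okn_out s' x' (k : info -> R) : read s s' pos -> wf s' ->
  x' = x \/ x' = parent x \/ x' \in ch x -> (forall u, u \in edges x -> get s' (u, i) = Some true -> mv x u = x') ->
  (x' = x -> forall u, u \in edges x -> get s' (u, i) = Some false) ->
  (exists2 u, u \in edges x & get s' (u, i) = Some true) \/ x' = x ->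
  kz <= k s' -> okn M hist pos k s' (x', nxs i).
Proof.
move=> rd wfs' x'x tr F1 F2 kk.
have c1 := @cond1_of_blk s s' hist pos y j st ls x' B rd wfs' x'x.
apply: (okn_cond1 IH1 c1); apply: le_trans kk; rewrite /kz ler_wpM2l//.
have ze0 := zen_ge0.
have cx : chain x ls by apply: chain_desc (b_chain B) (b_yx B) => l /(b_Lv B)[h _]; exact: h.
case: (ls) c1 cx (b_Lv B) => //= l tl c1 [b c] HL; rewrite exprS ler_wpM2r//.
case: (eqVneq x' (lx l)) => [e|ne]; last by rewrite /wgt /= (negbTE ne).
have [_ _ H' _] := c1; have lv := H' l (mem_head _ _).
have [h0 _] := lv; have /and3P[b1 b2 b3] := b.
have xr := blk_nr B; rewrite /= in xr.
case: x'x => [e'|[e'|xc]].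
- by move: b2; rewrite -e' e eqxx.
- case: F2 => [[u ue gu]|e2']; last by move: b2; rewrite -e2' e eqxx.
  have := tr u ue gu; rewrite /mv; case: eqP => [ux _|ux ux'].
    rewrite ux in gu; rewrite e; apply: (wgt_arr lv (b_slot B) gu); first by rewrite -e e' (mem_ch chP).
    by apply: contraNneq b3 => ->; rewrite desc_refl.
  move: ue; rewrite inE; case/orP=> [/eqP //|uc].
  by have := below_nx tree b; rewrite -e -ux' (ch_desc chP uc).
- by have := below_nx tree b; rewrite -e (ch_desc chP xc).
Qed.

Lemma hit_entry s' u : read s s' pos -> wf s' -> u \in ch x -> dd.+1 = m ->
  get s' (u, i) = Some true ->
  entry s' (pos :: hist) (u, nxs i) (lsS st ls m').
Proof.
move=> rd wfs' uc dm gu; have xr := blk_nr B; rewrite /= in xr.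
have du := ch_dep tree chP uc; have dE := ddE.
have yu : desc y u by exact: (desc_trans (b_yx B) (ch_desc chP uc)).
have dum : (dep u = dep y + m)%N by rewrite du dE -dm addnS.
have bl k' l : (k' < m')%N -> st k' = S2 l -> below u (lx l) (lw l) /\ Lv s' (pos :: hist) l.
  move=> km e; have := b_st B km; rewrite e /= => -[lv b _ _]; have [h0 _] := lv.
  split; first exact: (below_desc tree chP (lv_ch h0) b (ch_desc chP uc)).
  exact: (read_Lv rd lv b).
split; split=> //=.
- exact: (nxs_lt (b_slot B)).
- exact: (desc_trans (b_vy B) yu).
- apply/eqP => uv; have := desc_dep_le tree (b_vy B); rewrite -uv dum /m; clear; lia.
- by apply: (lsS_chain B) => // k' l km e; case: (bl k' l km e).
- move=> l /lsS_mem[lls|[k' km e]]; last by case: (bl k' l km e).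
  apply: (read_LvT rd (b_Lv B)) => //.
  by apply: chain_desc (b_chain B) (b_yx B) => l2 /(b_Lv B)[h _]; exact: h.
- move=> u' i' uu' u'u; have ddu := desc_dep tree uu' u'u.
  rewrite (read_notin _ rd).
    by have [_ ->//] := b_Fr B i' (desc_trans yu uu'); rewrite -dum.
  by apply/negP => /(edges_dep xr) /=; move: ddu du; clear; lia.
- move=> i' i'N; case: (eqVneq i' i) => [->//|ii]; rewrite (read_slot _ rd ii).
  by have [+ _] := b_Fr B i' yu => /(_ dum) h /h.
Qed.

Lemma okn_hit s' u (k : info -> R) : read s s' pos -> wf s' -> u \in ch x -> dd.+1 = m ->
  get s' (u, i) = Some true -> kz * (beta Gc dd j.+1 - mu) <= k s' ->
  okn M hist pos k s' (u, nxs i).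
Proof.
move=> rd wfs' uc dm gu kk; have en := hit_entry rd wfs' uc dm gu.
(* The walk stands at the even depth [2 * m'], under all candidates and on none of them, so every
   candidate is either a level or lost. *)
have [|J [Jm sz le]] := @lsS_size st ls m' dd.
  move=> l lm; have := b_st B lm; case: (st l) => [|t|l2|] //=.
    by rewrite ddE => -[+ _]; move: lm dm; rewrite /lev /m; clear; lia.
  by rewrite ddE => -[[+ _ _] _]; move: lm dm; rewrite /lev /m; clear; lia.
apply: (okn_entry new_bnd en); apply: le_trans kk; rewrite sz exprD.
rewrite /kz -mulrA ler_wpM2l// mulrCA ler_wpM2l ?zen_ge0//.
apply: (le_trans (al_chord Jm)); rewrite /beta.
have [l0 _] := lam_ge0; have := ler_wpM2l l0 le; rewrite -/Gc.
have : 0 <= mu * (p' * j.+1%:R) by rewrite mulr_ge0// mulr_ge0// ltW// p'0.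
have -> : m%:R = dd%:R + 1 :> R by rewrite -dm natr1.
by lra.
Qed.

(** Leaving a candidate downwards is the moment to create a level: the second offspring [w] provides
    the fresh subtree. The candidate is first marked lost, and [arm_bnd] then earns [c2 / 2], which
    is its entry in [Gc]. *)
Lemma okn_child s' u (k : info -> R) : read s s' pos -> wf s' -> u \in ch x -> (dd.+1 < m)%N ->
  (j.+1 < N2)%N -> get s' (u, i) = Some true ->
  (forall u', u' \in edges x -> u' != u -> get s' (u', i) = Some false) ->
  kz * (beta Gc dd j.+1 - mu) <= k s' -> okn M hist pos k s' (u, nxs i).
Proof.
move=> rd wfs' uc dm jN gu oth kk; have xr := blk_nr B; rewrite /= in xr.
have du := ch_dep tree chP uc; have dE := ddE.
have ux := ch_neq tree chP uc.
have ndu := ch_ndesc tree chP uc.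
have yu : desc y u by exact: (desc_trans (b_yx B) (ch_desc chP uc)).
have tr u' : u' \in edges x -> get s' (u', i) = Some true -> mv x u' = u.
  move=> ue gu'; rewrite /mv; case: (eqVneq u' u) => [->|nu]; first by rewrite (negbTE ux).
  by rewrite oth in gu'.
pose st' l := upd u i y (lev l) (st l).
have dud : (dep u - dep y = dd.+1)%N by rewrite du dE; clear; lia.
have B' : blk s' (pos :: hist) (u, nxs i) y j.+1 st' ls.
  apply: (blk_move B rd wfs' jN yu) => //=; first by rewrite du dE -addnS ltn_add2l.
  by move=> l lm; apply: (stOK_upd B rd _ tr lm); right.
have gE l : (l < m')%N -> (forall t, st l <> S1 t) -> gv (lev l) (st' l) dd.+1 = gc (lev l) (st l) dd.
  move=> lm; rewrite /st'; have := b_st B lm; case: (st l) => [|t|l2|] //=.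
  - by case: ifP.
  - by move=> _ /(_ t).
  - move=> [_ b _ _] _; case: eqP => // e; by have := below_nx tree b; rewrite -e (ch_desc chP uc).
case: (pselect (exists2 l0, (l0 < m')%N & exists t, st l0 = S1 t)); last first.
  move=> nS; apply: (okn_blk B'); apply: le_trans kk; rewrite dud.
  rewrite ler_wpM2l ?kz0// le_eqVlt; apply/orP; left; apply/eqP.
  rewrite (_ : \sum_(l < m') _ = Gc).
    by rewrite /beta -[dd.+1%:R]natr1; ring.
  by apply: eq_bigr => l _; apply: gE => // t e; apply: nS; exists (l : nat) => //; exists t.
move=> [l0 l0m [t st0]].
have := b_st B l0m; rewrite st0 /= => -[[dk tN rt] [h1 h2 h3]].
have [w wc wu] : exists2 w, w \in ch x & w != u.
  have /andP[c2' _] := chD x; have := uch x; move: c2'; case: (ch x) => [|a [|b l]] //= _.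
  rewrite inE negb_or => /andP[/andP[ab _] _].
  case: (eqVneq a u) => [e|ne]; last by exists a => //; rewrite mem_head.
  by exists b; [rewrite !inE eqxx orbT|rewrite -e eq_sym].
pose l := (x, w, t) : V * V * nat.
have wx := ch_neq tree chP wc.
have ndw := ch_ndesc tree chP wc.
have we : w \in edges x by rewrite inE wc orbT.
have h0 : Lv0 s' (pos :: hist) l.
  split=> //=.
  - exact: (desc_trans (b_vy B) (b_yx B)).
  - rewrite /l /lx /=; apply/eqP => xv; have := desc_dep_le tree (b_vy B).
    by rewrite -xv dk /lev; clear; lia.
  - move=> u' i' wu' u'w; rewrite (read_notin _ rd).
      apply: h2; first exact: (desc_trans (ch_desc chP wc) wu').
        by apply: contraTneq wu' => ->.
      by apply/negP => u'c; case: (desc_ch chP u'c wu') => [e|]; [rewrite e eqxx in u'w|apply/negP].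
    rewrite inE negb_or; apply/andP; split; first by apply: contraTneq wu' => ->.
    by apply/negP => u'c; case: (desc_ch chP u'c wu') => [e|]; [rewrite e eqxx in u'w|apply/negP].
  - move=> i' b; case: (eqVneq i' i) => [->|ii].
      by rewrite /lw /= oth// => -[<-]; rewrite /lx /= mem_head.
    by rewrite (read_slot _ rd ii) => /(h3 _ _ _ wc)[-> h _]; rewrite inE h orbT.
  - move=> i'; case: (eqVneq i' i) => [->|ii].
      by rewrite /lx /= oth ?mem_head// eq_sym.
    by rewrite (read_slot _ rd ii); exact: h1.
have noT c : c \in win l -> get s' c != Some true.
  move=> cw; have [/= ce cw' cN cL] := winP (l := l) tN cw; case: c ce cw' cN cL cw => u' i' /= ce cw' cN cL _.
  have ii : i' != i.
    apply/eqP => e; move: cL; rewrite e /lt /=; have := b_j B; move: rt N2N; clear; lia.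
  rewrite (read_slot _ rd ii); apply/eqP => gt.
  move: ce; rewrite inE => /orP[/eqP e|u'c].
    move: gt; rewrite e => gt; have e' := h1 _ gt; move: cL; rewrite e' /lt /= /rem leqnn subnn; clear; lia.
  by have [] := h3 _ _ _ u'c gt.
have dE' : (dep (u, nxs i).1 - dep y)%N = dd.+1 by [].
split; first by left; exact: safe_blk B'.
move=> _ ph'; apply: (bnd_le q01' kk).
have stZ : st' l0 = SZ by rewrite /st' st0.
have rt' : (N <= rem (lt l) (u, nxs i).2 + j.+2)%N.
  rewrite /lt /= rem_nxs// ?(b_slot B)//; have jl := b_j B.
  by case: eqP => [r0|r0]; move: rt jl N2N; try move: r0; clear; lia.
have yl : desc y (lx l) by exact: (b_yx B).
have := arm_bnd (l := l) B' l0m stZ h0 uc (_ : u != lw l) dk yl rt' noT IHB ph'.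
rewrite eq_sym => /(_ wu); apply: (bnd_le q01'); rewrite /kz -mulrA ler_wpM2l// ler_wpM2l ?zen_ge0//.
rewrite dE' le_eqVlt; apply/orP; left; apply/eqP.
rewrite (_ : \sum_(l < m') gv _ _ _ = Gc - c2 / 2).
  by rewrite /beta -[dd.+1%:R]natr1; ring.
rewrite /Gc (bigD1 (Ordinal l0m)) //= [in RHS](bigD1 (Ordinal l0m)) //= stZ st0 /= add0r.
rewrite [RHS]addrAC subrr add0r.
apply: eq_bigr => l1 l1l; apply: gE => // t1 e1; apply/negP: l1l; apply/negPn/eqP/val_inj => /=.
have := b_st B (ltn_ord l1); rewrite e1 /= => -[[dk1 _ _] _].
by move: dk dk1; rewrite /lev; clear; lia.
Qed.

Lemma okn_parent s' (k : info -> R) : read s s' pos -> wf s' -> x != y ->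
  (j.+1 < N2)%N -> get s' (x, i) = Some true ->
  (forall u', u' \in edges x -> u' != x -> get s' (u', i) = Some false) ->
  kz * (beta Gp dd j.+1 + mu) <= k s' -> okn M hist pos k s' (parent x, nxs i).
Proof.
move=> rd wfs' xy jN gx oth kk; have xr := blk_nr B; rewrite /= in xr.
have yp : desc y (parent x) by apply: desc_up => //; exact: (b_yx B).
have dp := dep_parent tree xr; have dE := ddE.
have dpy := desc_dep_le tree yp.
have tr u' : u' \in edges x -> get s' (u', i) = Some true -> mv x u' = parent x.
  move=> ue gu'; rewrite /mv; case: (eqVneq u' x) => // nu.
  by rewrite oth in gu'.
pose st' l := upd (parent x) i y (lev l) (st l).
have dd0 : (0 < dd)%N by move: dp dE dpy; clear; lia.
have dpd : (dep (parent x) - dep y = dd.-1)%N by move: dp dE; clear; lia.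
have B' : blk s' (pos :: hist) (parent x, nxs i) y j.+1 st' ls.
  apply: (blk_move B rd wfs' jN yp) => //=.
    by have := b_d B; rewrite /= dp; clear; lia.
  by move=> l lm; apply: (stOK_upd B rd _ tr lm); left.
apply: (okn_blk B'); apply: le_trans kk; rewrite dpd ler_wpM2l ?kz0//.
(* A level whose vertex is stepped on again becomes [SZ]; nothing is lost, as its value at distance
   0 is 0. *)
have GG : Gp <= \sum_(l < m') gv (lev l) (st' l) dd.-1.
  apply: ler_sum => l _; have := b_st B (ltn_ord l); rewrite /st'; case: (st l) => [|t|l2|] //=.
  - move=> [dx _]; rewrite ifN; last by apply/eqP; move: dx dp; clear; lia.
    by rewrite /= prednK.
  - move=> [_ b dk yl]; case: eqP => [e|//] /=.
    by rewrite -dpd e dk addKn subnn /e2 expr0 subrr.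
have [l0 _] := lam_ge0; have := ler_wpM2l l0 GG.
have e : dd%:R = dd.-1%:R + 1 :> R by rewrite natr1 prednK.
by rewrite /beta e; lra.
Qed.

Let rg (s' : info) := [seq u <- edges x | get s' (u, i) == Some true].

Lemma rg0 s' : (forall u, u \in edges x -> get s' (u, i) = Some false) -> rg s' = [::].
Proof.
move=> H; apply/eqP; rewrite -size_eq0 size_filter -leqn0 leqNgt -has_count.
by apply/hasPn => u /H->.
Qed.

Lemma rg1 s' u : u \in edges x -> get s' (u, i) = Some true ->
  (forall u', u' \in edges x -> u' != u -> get s' (u', i) = Some false) -> rg s' = [:: u].
Proof.
move=> ue gu H; rewrite -(filter_pred1_uniq (uniq_edges x) ue); apply: eq_in_filter => u' u'e /=.
by case: (eqVneq u' u) => [->|/(H u' u'e)->]; rewrite ?gu.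
Qed.

Lemma block_step : bnd P X q s (F M.+1 hist pos) (kz * beta G dd j).
Proof.
have xr := blk_nr B; rewrite /= in xr.
have [xe px] := edges_nr xr.
have k0 := kz0; have iN := b_slot B; have jN := b_j B; rewrite /= in iN.
have dm := ddm.
have g1 l : gv (lev l) (st l) dd <= 1 by case: (g_le1 (lev l) (st l) dd).
have gc1 l : gc (lev l) (st l) dd <= 1 by case: (g_le1 (lev l) (st l) dd).
have gp1 l : gp (lev l) (st l) dd <= 1 by exact: gp_le1.
have bt0 : 0 <= beta G dd j by exact: (beta_ge0 _ g1 (ltnW dm)).
have b00 : 0 <= beta G dd j.+1 by exact: (beta_ge0 _ g1 (ltnW dm)).
have bp0 : 0 <= beta Gp dd j.+1 by exact: (beta_ge0 _ gp1 (ltnW dm)).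
have bcE : beta Gc dd.+1 j.+1 = beta Gc dd j.+1 - mu by rewrite /beta -[dd.+1%:R]natr1; ring.
have bc0 : 0 <= beta Gc dd j.+1 - mu by rewrite -bcE; exact: (beta_ge0 _ gc1 dm).
pose k (s' : info) := kz * (match rg s' with
  | [::] => beta G dd j.+1
  | [:: u] => if u == x then beta Gp dd j.+1 + mu else beta Gc dd j.+1 - mu
  | _ => 0 end).
pose cs := [seq (u, i) | u <- edges x].
have freshch u : u \in ch x -> get s (u, i) = None.
  move=> uc; case gu : (get s (u, i)) => [b|//].
  have uy : u != y.
    apply: contraNneq (ch_ndesc tree chP uc) => ->; exact: (b_yx B).
  have := b_fresh B iN (desc_trans (b_yx B) (ch_desc chP uc)) gu.
  by rewrite uy => /(_ isT); rewrite /= /rem leqnn subnn; move: jN; clear; lia.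
(* This alternative decides between [beta_avg] and [beta_avg_top]. *)
have gx : get s (x, i) = None \/ x = y /\ get s (x, i) = Some false.
  case gx : (get s (x, i)) => [b|]; [right|by left].
  have := b_fresh B iN (b_yx B) gx; rewrite /= /rem leqnn subnn.
  case: (eqVneq x y) => [e|ne] /=; last by move=> /(_ isT); move: jN; clear; lia.
  by case: (b) => // /(_ isT); move: jN; clear; lia.
have avg : (( size (ch x))%:R + 1) * G <= (size (ch x))%:R * Gc + Gp.
  rewrite /G /Gc /Gp !mulr_sumr -big_split /=; apply: ler_sum => l _.
  apply: (g_avg (b_st B (ltn_ord l)) (b_yx B)) => //.
  by case/andP: (chD x).
have k1 s' u : rg s' = [:: u] -> u != x -> k s' = kz * (beta Gc dd j.+1 - mu).
  by rewrite /k => -> /negbTE ->.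
have Ek : Ex q s cs k <= kz * beta G dd j.
  have uc : uniq [seq (u, i) | u <- ch x] by rewrite map_inj_uniq// => u u' [].
  have sumch : \sum_(c <- [seq (u, i) | u <- ch x]) kz * (beta Gc dd j.+1 - mu) =
     kz * ((size (ch x))%:R * (beta Gc dd j.+1 - mu)).
    by rewrite big_map big_const_seq count_predT iter_addr_0 -mulr_natr; ring.
  case: gx => [gx|[xy gx]].
  - pose K (c : V * nat) := kz * (if c.1 == x then beta Gp dd j.+1 + mu else beta Gc dd j.+1 - mu).
    have usE : uniq cs by rewrite map_inj_uniq ?uniq_edges// => u u' [].
    have H := @Ex_one _ _ q q01' s cs k (kz * beta G dd j.+1) K usE.
    apply: le_trans (H _ _ _ _) _.
    + by move=> c /mapP[u + ->]; rewrite inE => /orP[/eqP->//|/freshch].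
    + move=> s' _ all0; rewrite /k rg0// => u ue; apply: all0; exact: map_f.
    + move=> s' c _ /mapP[u ue ->] gu oth; rewrite /k (rg1 ue gu) /K//= => u' u'e u'u.
      by apply: oth; [exact: map_f|rewrite xpair_eqE (negbTE u'u)].
    + move=> s' c c' _ /mapP[u ue ->] /mapP[u' u'e ->]; rewrite xpair_eqE eqxx andbT => u'u gu gu'.
      rewrite /k; have h1 : u \in rg s' by rewrite mem_filter gu eqxx.
      have h2 : u' \in rg s' by rewrite mem_filter gu' eqxx.
      case: (rg s') h1 h2 => [//|a [|b l]]; last by rewrite mulr0.
      by rewrite !inE => /eqP eu /eqP eu'; rewrite eu eu' eqxx in u'u.
    have -> : size cs = (size (ch x)).+1 by rewrite size_map.
    have -> : \sum_(c <- cs) K c = kz * ((beta Gp dd j.+1 + mu) + (size (ch x))%:R * (beta Gc dd j.+1 - mu)).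
      rewrite /cs /edges /= big_cons mulrDr -sumch; congr (_ + _); first by rewrite /K /= eqxx.
      rewrite !big_map big_seq [RHS]big_seq; apply: eq_bigr => u uc'.
      by rewrite /K /= (negbTE (ch_neq tree chP uc')).
    have := beta_avg (chD x) avg bt0 => /(ler_wpM2l k0); apply: le_trans.
    by rewrite le_eqVlt; apply/orP; left; apply/eqP => /=; ring.
  - have Gp0 : Gp = 0.
      rewrite /Gp big1// => l _; have := b_st B (ltn_ord l).
      have dd0 : dd = 0%N by rewrite /dd xy subnn.
      case: (st l) => [|t|l2|] //=; first by rewrite dd0 /e2 expr0 subrr mulr0.
      by move=> [_ /and3P[b1 b2 _] dk yl]; rewrite dd0 /e2 /= sub0n expr0 subrr.
    have G0 : 0 <= G.
      apply: sumr_ge0 => l _; have [c0 c1] := andP c201.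
      case: (st l) => [|t|l2|] //=; try (apply: mulr_ge0; first by rewrite divr_ge0// ltW).
      1,2: by have /andP[_] := e2_01 dd.+1; rewrite subr_ge0.
      by have /andP[_] := e2_01 (dd - lev l); rewrite subr_ge0.
    have -> : Ex q s cs k = Ex q s [seq (u, i) | u <- ch x] k by rewrite /cs /= gx.
    have H := @Ex_one _ _ q q01' s [seq (u, i) | u <- ch x] k (kz * beta G dd j.+1)
       (fun=> kz * (beta Gc dd j.+1 - mu)) uc.
    have gx' s' : ext s [seq (u, i) | u <- ch x] s' -> get s' (x, i) = Some false.
      by move=> e; exact: (ext_get e gx).
    apply: le_trans (H _ _ _ _) _.
    + by move=> c /mapP[u uc' ->]; exact: freshch.
    + move=> s' e all0; rewrite /k rg0// => u; rewrite inE => /orP[/eqP->|uc']; first exact: gx'.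
      apply: all0; exact: map_f.
    + move=> s' c e /mapP[u uc' ->] gu oth; rewrite (k1 s' u)// ?(ch_neq tree chP uc')//.
      apply: rg1 => //; first by rewrite inE uc' orbT.
      move=> u'; rewrite inE => /orP[/eqP-> _|u'e u'u]; first exact: gx'.
      by apply: oth; [exact: map_f|rewrite xpair_eqE (negbTE u'u)].
    + move=> s' c c' _ /mapP[u uc1 ->] /mapP[u' u'c ->]; rewrite xpair_eqE eqxx andbT => u'u gu gu'.
      rewrite /k; have h1 : u \in rg s' by rewrite mem_filter gu eqxx inE uc1 orbT.
      have h2 : u' \in rg s' by rewrite mem_filter gu' eqxx inE u'c orbT.
      case: (rg s') h1 h2 => [//|a [|b l]]; last by rewrite mulr0.
      by rewrite !inE => /eqP eu /eqP eu'; rewrite eu eu' eqxx in u'u.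
    rewrite sumch size_map.
    have avg' : ((size (ch x))%:R + 1) * G <= (size (ch x))%:R * Gc by move: avg; rewrite Gp0 addr0.
    have := beta_avg_top (chD x) avg' G0 bt0 => /(ler_wpM2l k0); apply: le_trans.
    by rewrite le_eqVlt; apply/orP; left; apply/eqP => /=; ring.
apply: (bnd_le q01' Ek); apply: (step_bnd (pos := pos)) => //.
- exact: (b_wf B).
- exact: (desc_trans (b_vy B) (b_yx B)).
- move=> s'; rewrite /k mulr_ge0//; case: (rg s') => [//|u [|u' l]] //.
  by case: ifP => _ //; rewrite addr_ge0.
- move=> s' e wfs' allF; have rd := ext_read (pos := pos) (fun c => erefl) e.
  have ks : k s' = kz * beta G dd j.+1 by rewrite /k rg0.
  case: (ltnP j.+1 N2) => jN2.
    have B' : blk s' (pos :: hist) (x, nxs i) y j.+1 st ls.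
      apply: (blk_move B rd wfs' jN2) => //; [exact: (b_yx B)|exact: (b_d B)| |].
        by move=> u ue; rewrite allF.
      by move=> l lm; exact: (stOK_stay B rd allF lm).
    by apply: (okn_blk B'); rewrite ks.
  apply: (okn_out rd wfs') => //; [by left|by move=> u ue; rewrite allF|by right|].
  have jE : j.+1 = N2 by move: jN jN2; clear; lia.
  rewrite ks -[leLHS]mulr1 ler_wpM2l// jE; exact: (beta_timeout g1 (ltnW dm)).
- move=> s' u e wfs' ue gu oth; have rd := ext_read (pos := pos) (fun c => erefl) e.
  have ks : k s' = kz * (if u == x then beta Gp dd j.+1 + mu else beta Gc dd j.+1 - mu).
    by rewrite /k (rg1 ue gu).
  have tr u' : u' \in edges x -> get s' (u', i) = Some true -> mv x u' = mv x u.
    move=> u'e gu'; case: (eqVneq u' u) => [->//|nu]; by rewrite oth in gu'.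
  have nx : mv x u != x by exact: mv_neq.
  have out : kz <= k s' -> okn M hist pos k s' (mv x u, nxs i).
    apply: (okn_out rd wfs') => //.
    + right; rewrite /mv; move: ue; rewrite inE; case: eqP => [_ _|_ /= uc]; [by left|by right].
    + by move=> eq; rewrite eq eqxx in nx.
    + by left; exists u.
  have tmo : (N2 <= j.+1)%N -> okn M hist pos k s' (mv x u, nxs i).
    move=> jN2; have jE : j.+1 = N2 by move: jN jN2; clear; lia.
    apply: out; rewrite ks -[leLHS]mulr1 ler_wpM2l//; case: ifP => _.
      rewrite jE (le_trans (beta_timeout gp1 (ltnW dm)))// lerDl//.
    by rewrite -bcE jE; exact: (beta_timeout gc1 dm).
  move: ks out tmo nx; rewrite /mv /=; case: (eqVneq u x) => [ux|ux] ks out tmo nx.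
    rewrite ux in gu oth.
    case: (eqVneq x y) => [xy|xy].
      apply: out; rewrite ks -[leLHS]mulr1 ler_wpM2l//.
      have Gp0 : lam * Gp <= 0.
        rewrite /Gp big1 ?mulr0// => l _.
        have dd0 : dd = 0%N by rewrite /dd xy subnn.
        case: (st l) => [|t|l2|] //=; first by rewrite dd0 /e2 expr0 subrr mulr0.
        by rewrite dd0 /e2 /= sub0n expr0 subrr.
      rewrite /beta; have : 0 <= mu * (m%:R - dd%:R + p' * j.+1%:R).
        rewrite mulr_ge0// addr_ge0 ?subr_ge0 ?ler_nat ?(ltnW dm)// mulr_ge0// ltW//; exact: p'0.
      by move: Gp0 mu0; lra.
    case: (ltnP j.+1 N2) => jN2; last exact: tmo.
    by apply: (okn_parent rd wfs' xy jN2 gu) => //; rewrite ks.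
  move: ue; rewrite inE (negbTE ux) /= => uc.
  case: (eqVneq dd.+1 m) => [dE|dN].
    by apply: (okn_hit rd wfs' uc dE gu); rewrite ks.
  have dlt : (dd.+1 < m)%N by move: dm dN; clear; lia.
  case: (ltnP j.+1 N2) => jN2; last exact: tmo.
  by apply: (okn_child rd wfs' uc dlt jN2 gu) => //; rewrite ks.
Qed.

End BlockStep.

(** The two bounds need each other at smaller fuel: a level can open a new block, and a block that
    times out or is left falls back to the levels. *)
Lemma explore M :
  (forall s hist pos ls, cond1 s hist pos ls -> pos \notin hist ->
     bnd P X q s (F M hist pos) (kap * W1 ls pos)) /\
  (forall s hist pos y j st ls, blk s hist pos y j st ls -> pos \notin hist ->
    bnd P X q s (F M hist pos) (kap * (ze ^+ size ls *
      beta (\sum_(l < m') gv (lev l) (st l) (dep pos.1 - dep y)) (dep pos.1 - dep y) j))).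
Proof.
elim: M => [|M [IH1 IHB]].
  split=> [s hist pos ls _ _|s hist pos y j st ls B _]; apply: bnd_False => //.
  - by rewrite mulr_ge0// W1_ge0.
  - by move=> w _ [].
  - rewrite mulr_ge0// mulr_ge0 ?zen_ge0//.
    apply: (@beta_ge0 (fun l => gv (lev l) (st l) (dep pos.1 - dep y))) => [l|].
      by case: (g_le1 (lev l) (st l) (dep pos.1 - dep y)).
    have := b_d B; have := desc_dep_le tree (b_yx B); clear; lia.
  - by move=> w _ [].
split=> [s hist pos ls|s hist [x i] y j st ls B ph].
  apply: level_step => //; exact: new_bnd.
by have := block_step IH1 IHB B; rewrite mulrA.
Qed.

Lemma explore_root M s : wf s -> (forall u i, desc v u -> get s (u, i) = None) ->
  bnd P X q s (F M [::] (v, 0%N)) (kap * al).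
Proof.
move=> wfs nd; have [_ H] := explore M.
have := H _ _ _ _ _ _ _ (start_blk wfs nd) isT; apply: (bnd_le q01').
rewrite /= expr0 mul1r subnn ler_wpM2l//; exact: beta_start0.
Qed.

End Explore.

(** * Trajectories of the stirring process *)

Section Paths.
Variables (R : realType) (V E : Type) (ends : E -> V * V) (ring : E -> R -> Prop) (T : R).
Hypothesis T0 : 0 <= T.
Variable e0 : E.
Hypothesis noloop : forall e, (ends e).1 <> (ends e).2.
Hypothesis nosim : forall e f t, ring e t -> ring f t -> t <= T -> e = f.

Local Notation incident := (incident ends).
Local Notation crosses := (crosses ends).

Lemma crossesC e x y : crosses e x y -> crosses e y x.
Proof. by case=> h; [right|left]. Qed.

Lemma crosses_inc e x y : crosses e x y -> incident e x.
Proof. by case=> h; rewrite /Defs.incident h; [left|right]. Qed.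

Lemma inc_crosses e x : incident e x -> exists y, crosses e x y.
Proof.
case=> h; [exists (ends e).2; left|exists (ends e).1; right]; rewrite -h; exact: surjective_pairing.
Qed.

Lemma crosses_det e x y z : crosses e x y -> crosses e x z -> y = z.
Proof.
move=> h1 h2; have := noloop (e := e).
by case: h1 => h1; case: h2; rewrite h1 => -[] //= *; subst.
Qed.

Definition jmp (a b : V * R) := exists e, [/\ a.2 < b.2, b.2 <= T, crosses e a.1 b.1, ring e b.2 &
  forall f t, incident f a.1 -> a.2 < t -> t < b.2 -> ~ ring f t].

Definition final (T' : R) (b : V * R) := forall f t, incident f b.1 -> b.2 < t -> t <= T' -> ~ ring f t.

Fixpoint reachn n (a b : V * R) : Prop :=
  if n is n'.+1 then exists2 c, jmp a c & reachn n' c b else a = b.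

Lemma reachnSr n a b : reachn n.+1 a b <-> exists2 c, reachn n a c & jmp c b.
Proof.
elim: n a => [|n IH] a.
  by split=> [[c ac <-]|[c <- cb]]; [exists a|exists b].
split=> [[c ac /IH[c' h1 h2]]|[c [c' h1 h2] h3]]; first by exists c' => //; exists c.
by exists c' => //; apply/IH; exists c.
Qed.

Definition reach a b := exists n, reachn n a b.

Lemma reach_refl a : reach a a. Proof. by exists 0%N. Qed.

Lemma reach_jmp a b c : reach a b -> jmp b c -> reach a c.
Proof. by move=> [n ab] bc; exists n.+1; apply/reachnSr; exists b. Qed.

Lemma jmp_reach a b c : jmp a b -> reach b c -> reach a c.
Proof. by move=> ab [n bc]; exists n.+1; exists b. Qed.

Lemma reach_time a b : reach a b -> a.2 <= b.2.
Proof.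
move=> [n]; elim: n a => [|n IH] a; first by move=> ->.
by move=> [c [e [/ltW h _ _ _ _]] /IH]; exact: le_trans.
Qed.

Lemma jmp_det a b c : jmp a b -> jmp a c -> b = c.
Proof.
case: b c => [y s] [z s'] [e [/= h1 h2 h3 h4 h5]] [e' [/= g1 g2 g3 g4 g5]].
case: (ltgtP s s') => ss.
- by case: (g5 e s _ h1 ss h4); exact: crosses_inc h3.
- by case: (h5 e' s' _ g1 ss g4); exact: crosses_inc g3.
- subst s'; have ee := nosim h4 g4 h2; subst e'.
  by rewrite (crosses_det h3 g3).
Qed.

Lemma final_jmp b c : final T b -> ~ jmp b c.
Proof. by move=> fb [e [h1 h2 h3 h4 _]]; apply: (fb e c.2) => //; exact: crosses_inc h3. Qed.

Lemma reach_final a b c : reach a b -> final T b -> reach a c -> reach c b.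
Proof.
move=> [n ab] fb [k ac]; elim: k n a ab ac => [|k IH] n a ab; first by move=> <-; exists n.
move=> [c' ac' c'c]; case: n ab => [|n]; first by move=> /= ab; rewrite ab in ac'; case: (final_jmp fb ac').
move=> [c'' ac'' c''b]; have e := jmp_det ac' ac''; subst c''; exact: IH c''b c'c.
Qed.

Lemma final_uniq a b c : reach a b -> final T b -> reach a c -> final T c -> b = c.
Proof.
move=> ab fb ac fc; have [[|n]] := reach_final ab fb ac; first by [].
by move=> [c' /(final_jmp fc)].
Qed.

Lemma reach_finite a b : reach a b -> final T b ->
  exists l : list V, forall c, reach a c -> List.In c.1 l.
Proof.
move=> [n ab] fb; elim: n a ab => [|n IH] a.
  move=> ->; exists [:: b.1] => c [[|k]]; first by move=> /= <-; left.
  by move=> [c' /(final_jmp fb)].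
move=> [a' aa' a'b]; have [l Hl] := IH _ a'b; exists (a.1 :: l) => c [[|k]].
  by move=> /= <-; left.
by move=> [a'' aa'' ac]; right; apply: Hl; exists k; rewrite (jmp_det aa' aa'').
Qed.

Lemma stirring_reach v w : stirring_path ends ring T v w <->
  exists s, reach (v, 0) (w, s) /\ final T (w, s).
Proof.
split=> [[n [x [s [e [x0 s0 xn H fin]]]]]|[t [[n H] fin]]].
  exists (s n); split; last by rewrite -xn => f t; exact: fin.
  suff h i : (i <= n)%N -> reach (v, 0) (x i, s i) by rewrite -xn; exact: h.
  elim: i => [|i IH] ilt; first by rewrite x0 s0; exact: reach_refl.
  apply: (reach_jmp (IH (ltnW ilt))); have [h1 h2 h3 h4 h5] := H i ilt.
  by exists (e i).
have [x [s [e [x0 s0 xn sn H']]]] : exists x s (e : nat -> E), [/\ x 0%N = v, s 0%N = 0,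
    x n = w, s n = t & forall i : nat, (i < n)%N ->
         [/\ s i < s i.+1, s i.+1 <= T, crosses (e i) (x i) (x i.+1), ring (e i) (s i.+1) &
             forall (f : E) (t : R), incident f (x i) -> s i < t -> t < s i.+1 -> ~ ring f t]].
  elim: n v (0 : R) H {fin} => [|n IH] v t0 /=.
    by move=> [-> ->]; exists (fun=> w), (fun=> t), (fun=> e0).
  move=> [[y s1] [e1 /= J] /IH[x [s [e [x0 s0 xn sn H']]]]].
  exists (fun i => if i is i'.+1 then x i' else v), (fun i => if i is i'.+1 then s i' else t0),
    (fun i => if i is i'.+1 then e i' else e1); split=> //.
  by case=> [|i] iln; [rewrite x0 s0|exact: H'].
by exists n, x, s, e; split=> //; rewrite xn sn; exact: fin.
Qed.

(** Trajectories are followed backwards. Two last jumps into [b] use the same edge, hence start from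
    the same vertex; had they arrived there at different times, the earlier one would have been
    moved by the ring that brought the later one. *)
Lemma reachn_inj n a0 x x' b : reachn n (x, a0) b -> reach (x', a0) b -> x = x'.
Proof.
elim: n b => [|n IH] b.
  move=> <- [[|k]]; first by case.
  move=> /= [c [e [/= h _ _ _ _]]] cb; have := reach_time (ex_intro _ k cb) => /=.
  by move=> /(lt_le_trans h); rewrite ltxx.
move=> /reachnSr[c xc cb] [[|k]].
  move=> /= eb; subst b; case: cb => e [/= h _ _ _ _].
  by have := reach_time (ex_intro _ n xc) => /= /le_lt_trans/(_ h); rewrite ltxx.
move=> /reachnSr[c' x'c' c'b].
have cc : c.1 = c'.1.
  case: cb c'b => e [_ h1 h2 h3 _] [e' [_ _ g2 g3 _]].
  have ee := nosim h3 g3 h1; subst e'.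
  exact: crosses_det (crossesC h2) (crossesC g2).
have late u u' (z z' : V * R) k1 : reachn k1 (u, a0) z -> reach (u', a0) z' -> z.1 = z'.1 ->
    z'.2 < z.2 -> jmp z b -> jmp z' b -> False.
  case: k1 => [|k1]; first by move=> /= <- /reach_time /= h _; rewrite ltNge h.
  move=> /reachnSr[z0 _ [e [_ h1 h2 h3 _]]] _ zz lt [e1 [g1 _ _ _ _]] [e2 [_ _ _ _ g5]].
  by apply: (g5 e z.2) => //; rewrite -zz; apply: crosses_inc (crossesC h2).
case: (ltgtP c.2 c'.2) => ct.
- by case: (late x' x c' c k) => //; exists n.
- by case: (late x x' c c' n) => //; exists k.
have e : c = c' by rewrite (surjective_pairing c) cc ct -surjective_pairing.
by rewrite e in xc; apply: (IH c' xc); exists k.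
Qed.

Lemma reach_inj a0 b0 x x' y s s' : b0 <= T -> s <= b0 -> s' <= b0 ->
  reach (x, a0) (y, s) -> final b0 (y, s) -> reach (x', a0) (y, s') -> final b0 (y, s') -> x = x'.
Proof.
move=> bT sb s'b [n h1] f1 [k h2] f2.
have late u (z : V) t t' k1 : t <= b0 -> reachn k1 (u, a0) (z, t) -> a0 <= t' -> final b0 (z, t') -> t' < t -> False.
  move=> tb; case: k1 => [|k1]; first by move=> /= [_ <-] h _; rewrite ltNge h.
  move=> /reachnSr[z0 _ [e [_ _ g2 g3 _]]] _ f lt.
  by apply: (f e t) => //; exact: crosses_inc (crossesC g2).
have [t1 t2] := (reach_time (ex_intro _ n h1), reach_time (ex_intro _ k h2)); rewrite /= in t1 t2.
case: (ltgtP s s') => ss.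
- by case: (late x' y s' s k).
- by case: (late x y s s' n).
- by subst s'; apply: reachn_inj h1 _; exists k.
Qed.

Lemma seq_min (s : seq R) : s != [::] -> exists2 x, x \in s & forall y, y \in s -> x <= y.
Proof.
elim: s => // x [|y s] IH _.
  by exists x; rewrite ?mem_head// => y; rewrite inE => /eqP->.
have [//|z zs zm] := IH; case: (leP x z) => xz.
  exists x; rewrite ?mem_head// => t; rewrite inE => /orP[/eqP->//|/zm]; exact: le_trans.
by exists z; [rewrite inE zs orbT|move=> t; rewrite inE => /orP[/eqP->|/zm//]; exact: ltW].
Qed.

(** Inside [C] all relevant ringing times lie in the finite list [Lt], so a next one can be chosen
    as a minimum; the induction is on the number of times still ahead. *)
Lemma reach_exists (C : V -> Prop) (Lt : seq R) a0 b0 : b0 <= T ->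
  (forall x e y t, C x -> crosses e x y -> a0 < t -> t <= b0 -> ring e t -> C y) ->
  (forall x e t, C x -> incident e x -> t <= b0 -> ring e t -> t \in Lt) ->
  forall x s, C x -> a0 <= s -> s <= b0 ->
  exists b, [/\ reach (x, s) b, C b.1, b.2 <= b0 & final b0 b].
Proof.
move=> bT HC HL x s; have [k] := ubnP (size [seq t <- Lt | (s < t)]).
elim: k x s => // k IH x s sz Cx as' sb.
pose cand := [seq t <- Lt | (s < t) && (t <= b0) && `[< exists2 e, incident e x & ring e t >]].
case: (eqVneq cand [::]) => [c0|/seq_min[t tc tmin]].
  exists (x, s); split=> //; first exact: reach_refl.
  move=> f t fx st tb rf; have : t \in cand.
    by rewrite mem_filter (HL x f t)// st tb andbT; apply/asboolP; exists f.
  by rewrite c0.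
move: tc; rewrite mem_filter => /andP[/andP[/andP[st tb] /asboolP[e ex re]] tL].
have [y ey] := inc_crosses ex.
have J : jmp (x, s) (y, t).
  exists e; split=> //=; first exact: le_trans bT.
  move=> f t' fx st' t't rf; have : t' \in cand.
    rewrite mem_filter (HL x f t')// ?st' ?(le_trans (ltW t't))// andbT; apply/asboolP; by exists f.
  by move=> /tmin; rewrite leNgt t't.
have [||b [h1 h2 h3 h4]] := IH y t _ (HC x e y t Cx ey (le_lt_trans as' st) tb re) _ tb.
- rewrite ltnS in sz; apply: leq_trans sz; rewrite !size_filter.
  pose gt (a u : R) := a < u.
  have -> : count (gt s) Lt = (count (gt t) Lt + count (fun u => gt s u && (u <= t)%R) Lt)%N.
    rewrite -count_predUI [X in (_ + X)%N](eq_count (a2 := pred0)) ?count_pred0 ?addn0.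
      apply: eq_count => u /=; rewrite /gt; case: (ltP t u) => tu //=; last by rewrite andbT.
      by rewrite (lt_trans st).
    by move=> u /=; rewrite /gt; case: (ltP t u) => // tu; rewrite andbF.
  rewrite -[X in (X < _)%N]addn0 ltn_add2l -has_count; apply/hasP; exists t => //.
  by rewrite /gt st lexx.
- exact: (le_trans as' (ltW st)).
- by exists b; split=> //; exact: jmp_reach J h1.
Qed.

(** The cut at time [a] is not a jump, so the first jump after it is attached to the last jump time
    [s], no clock at [y] ringing in between. *)
Lemma reach_cat v a b y s z s' : reach (v, 0) (y, s) -> s <= a -> final a (y, s) ->
  reach (y, a) (z, s') -> s' <= b -> a <= b -> final b (z, s') ->
  exists s'', [/\ reach (v, 0) (z, s''), s'' <= b & final b (z, s'')].
Proof.
move=> h1 sa f1 [[|n]] h2 s'b ab f2.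
  case: h2 => yz as'; subst z s'; exists s; split=> //; first exact: le_trans ab.
  move=> f t fy st tb; case: (leP t a) => ta; first exact: f1 ta.
  exact: f2.
exists s'; split=> //; case: h2 => c [e [/= g1 g2 g3 g4 g5]] cz.
case: h1 => k h1; exists (k.+1 + n)%N.
have J : jmp (y, s) c.
  exists e; split=> //=; first exact: le_lt_trans g1.
  move=> f t fy st tc; case: (leP t a) => ta; first exact: f1 ta.
  exact: g5.
have : reachn k.+1 (v, 0) c by apply/reachnSr; exists (y, s).
elim: k.+1 (v, 0 : R) => [|k' IH] w /=; first by move=> ->.
by move=> [c' wc' /IH]; exists c'.
Qed.

End Paths.

(** * Existence of the flow *)

Lemma reach_weak (R : realType) (V E : Type) (ends : E -> V * V) (ring : E -> R -> Prop) (T T' : R) a b :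
  T <= T' -> reach ends ring T a b -> reach ends ring T' a b.
Proof.
move=> TT [n ab]; exists n; elim: n a ab => //= n IH a [c [e [h1 h2 h3 h4 h5]] /IH cb].
by exists c => //; exists e; split=> //; exact: le_trans TT.
Qed.

Section Flow.
Variables (R : realType) (V : eqType) (r : V) (parent : V -> V).
Hypothesis tree : rooted_tree r parent.
Variable ch : V -> seq V.
Hypothesis chP : forall x u, (u \in ch x) = (u != r) && (parent u == x).

Local Notation dep := (dep tree).
Local Notation desc := (desc parent).

Fixpoint dl t n : seq V := if n is n'.+1 then flatten [seq ch x | x <- dl t n'] else [:: t].

Lemma dlP t n u : (u \in dl t n) = desc t u && (dep u == dep t + n)%N.
Proof.
elim: n u => [|n IH] u /=.
  rewrite inE addn0; apply/eqP/andP => [->|[tu /eqP du]]; first by rewrite desc_refl.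
  by apply/eqP; apply/negPn/negP => ut; have := desc_dep tree tu ut; rewrite du ltnn.
apply/flatten_mapP/andP => [[x]|[tu /eqP du]].
  rewrite IH => /andP[tx /eqP dx] ux; rewrite (desc_trans tx (ch_desc chP ux)).
  by rewrite (ch_dep tree chP ux) dx addnS.
have ut : u != t by apply/eqP => e; move: du; rewrite e; lia.
have ur : u != r by apply/eqP => e; move: du; rewrite e dep_r; lia.
exists (parent u); last by rewrite (mem_ch chP ur).
rewrite IH desc_up//=; have := dep_parent tree ur; rewrite du; lia.
Qed.

Lemma dl_size t n D : (forall x, (size (ch x) <= D)%N) -> (size (dl t n) <= D ^ n)%N.
Proof.
move=> HD; elim: n => //= n IH; rewrite size_flatten /shape -map_comp expnSr.
apply: leq_trans (leq_mul IH (leqnn D)); elim: (dl t n) => //= x s IHs.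
by rewrite mulSn leq_add// HD.
Qed.

Variables (ring : tedge r -> R -> Prop).
Let ends := tends parent (r := r).

Definition rv (u : V) (t : R) := exists h : u <> r, ring (exist _ u h) t.

Definition clus (a b : R) (t u : V) := desc t u /\
  forall w, desc t w -> desc w u -> w <> t -> exists s, [/\ a < s, s <= b & rv w s].

Lemma tends_noloop e : (ends e).1 <> (ends e).2.
Proof.
case: e => u ur /= e; have /eqP ur' := ur.
by have := dep_parent tree ur'; rewrite -e; lia.
Qed.

(** Climbing along edges that ring in the interval stops at the root at the latest. From such a top
    the cluster is closed under ringing edges, which is [clus_closed]. *)
Lemma clus_top a b v : exists2 t, clus a b t v &
  t = r \/ ~ exists s, [/\ a < s, s <= b & rv t s].
Proof.
have [k] := ubnP (dep v); elim: k v => // k IH v dv.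
have [rg|nr] := pselect (exists s, [/\ a < s, s <= b & rv v s]); last first.
  exists v; last by right.
  split; first exact: desc_refl.
  by move=> w vw wv; rewrite (desc_anti tree wv vw).
case: (eqVneq v r) => [e|vr].
  exists v; last by left.
  split; first exact: desc_refl.
  by move=> w vw wv; rewrite (desc_anti tree wv vw).
have [|t [tp ct] top] := IH (parent v); first by move: dv; rewrite (dep_parent tree vr); lia.
exists t => //; split; first exact: desc_parent.
move=> w tw wv wt; case: (eqVneq v w) => [<-//|nw].
by apply: ct => //; exact: desc_up.
Qed.

Lemma clus_closed a b t : (t = r \/ ~ exists s, [/\ a < s, s <= b & rv t s]) ->
  forall x e y s, clus a b t x -> crosses ends e x y -> a < s -> s <= b -> ring e s -> clus a b t y.
Proof.
move=> top x [u ur] y s [tx cx] cr as' sb re.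
have rg : rv u s by exists ur.
case: cr => -[/= e1 e2]; subst.
- 
  have xt : x <> t.
    move=> e; subst t; case: top => [//|]; apply; by exists s.
  split; first by apply: desc_up => //; exact/eqP.
  by move=> w tw wx; apply: cx => //; exact: desc_parent.
- split; first exact: desc_parent.
  move=> w tw wy wt; case: (eqVneq y w) => [e|nw]; first by exists s; rewrite -e.
  by apply: cx => //; exact: desc_up.
Qed.

Lemma clus_anc a b t u w : clus a b t u -> desc t w -> desc w u -> clus a b t w.
Proof.
move=> [tu c] tw wu; split=> // z tz zw; apply: c => //; exact: desc_trans zw wu.
Qed.

(** Clusters contain the path from their top, so an empty generation cuts off all deeper ones. *)
Lemma clus_finite a b t L : (forall u, clus a b t u -> dep u <> (dep t + L)%N) ->
  forall u, clus a b t u -> u \in flatten [seq dl t n | n <- iota 0 L].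
Proof.
move=> H u c; have tu := c.1; have du := desc_dep_le tree tu.
apply/flatten_mapP; exists (dep u - dep t)%N; last by rewrite dlP tu; apply/eqP; lia.
rewrite mem_iota /= add0n ltnNge; apply/negP => Lu.
have [k] := ubnP (dep u - dep t - L); elim: k u c tu du Lu => // k IH u c tu du Lu kk.
case: (eqVneq (dep u) (dep t + L)%N) => [/(H u c)//|ne].
have ut : u != t by apply/eqP => e; subst; lia.
have ur : u != r by apply/eqP => e; move: du Lu ne; rewrite e dep_r; lia.
have dp := dep_parent tree ur; have tp := desc_up tu ut.
apply: (IH (parent u)) => //.
- by apply: clus_anc c tp _; apply: desc_parent; exact: desc_refl.
- exact: desc_dep_le tree _ _ tp.
- lia.
- lia.
Qed.

Variables (T : R) (M0 : nat).
Hypothesis T0 : 0 < T.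
Hypothesis M00 : (0 < M0)%N.
Variable e0 : tedge r.
Hypothesis nosim : forall e f t, ring e t -> ring f t -> t <= T -> e = f.
Hypothesis frings : forall e, exists l : seq R, forall t, ring e t -> t <= T -> t \in l.
Hypothesis perc : forall k t, (k < M0)%N -> exists L, forall u,
  clus (k%:R * (T / M0%:R)) (k.+1%:R * (T / M0%:R)) t u -> dep u <> (dep t + L)%N.

Lemma frings_inc x : exists l : seq R, forall e t, incident ends e x -> ring e t -> t <= T -> t \in l.
Proof.
have [f Hf] := choice frings.
pose fv u := if pselect (u <> r) is left h then f (exist _ u h) else [::].
exists (flatten [seq fv u | u <- x :: ch x]) => -[u ur] t inc rt tT.
apply/flatten_mapP; exists u.
  case: inc => /= e; rewrite inE; first by rewrite e eqxx.
  by rewrite -e (mem_ch chP) ?orbT//; exact/eqP.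
rewrite /fv; case: pselect => // ur'; apply: Hf => //.
by rewrite (Prop_irrelevance ur' ur).
Qed.

(** Injectivity comes from following trajectories backwards; surjectivity from counting, as the map
    sends each finite cluster into itself. *)
Lemma interval_flow k : (k < M0)%N -> let a := k%:R * (T / M0%:R) in let b := k.+1%:R * (T / M0%:R) in
  exists phi : V -> V, bijective phi /\
   forall x, exists s, [/\ reach ends ring T (x, a) (phi x, s), s <= b & final ends ring b (phi x, s)].
Proof.
move=> kM a b.
have M1 : 0 < M0%:R :> R by rewrite ltr0n.
have bT : b <= T.
  by rewrite /b mulrA ler_pdivrMr// mulrC ler_pM2l// ler_nat.
have ab : a <= b by rewrite /a /b ler_wpM2r ?divr_ge0 ?ltW// ltr_nat.
have nosim' : forall e f t, ring e t -> ring f t -> t <= b -> e = f.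
  by move=> e f t h1 h2 tb; apply: nosim h1 h2 _; exact: le_trans bT.
have H x : exists C : seq V, [/\ uniq C, x \in C & forall x', x' \in C ->
    exists c, [/\ reach ends ring b (x', a) c, c.1 \in C & final ends ring b c]].
  have [t ct top] := clus_top a b x; have [L HL] := perc t kM.
  have fin := clus_finite HL.
  pose C := undup [seq u <- flatten [seq dl t n | n <- iota 0 L] | `[< clus a b t u >]].
  have CP u : u \in C <-> clus a b t u.
    rewrite mem_undup mem_filter; split=> [/andP[/asboolP]//|c].
    by apply/andP; split; [exact/asboolP|exact: fin].
  exists C; split; [exact: undup_uniq|exact/CP|move=> x' /CP cx'].
  have [f Hf] := choice frings_inc.
  have HL' : forall z e s, clus a b t z -> incident ends e z -> s <= b -> ring e s ->
      s \in flatten [seq f u | u <- C].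
    move=> z e s cz inc sb re; apply/flatten_mapP; exists z; first exact/CP.
    by apply: (Hf z e) => //; exact: le_trans bT.
  have [c [h1 h2 _ h4]] := reach_exists (lexx b) (clus_closed top) HL' cx' (lexx a) ab.
  by exists c; split=> //; exact/CP.
have /choice[c Hc] x : exists c, reach ends ring b (x, a) c /\ final ends ring b c.
  by have [C [_ xC /(_ x xC)[c [h1 _ h3]]]] := H x; exists c.
pose phi x := (c x).1.
have cb x : (c x).2 <= b.
  have [[[|n] h] _] := Hc x; first by rewrite -h.
  by move/reachnSr: h => [c' _ [e []]].
have pinj : injective phi.
  move=> x x' e; have [h1 f1] := Hc x; have [h2 f2] := Hc x'.
  have e' : c x' = (phi x, (c x').2) by rewrite e -surjective_pairing.
  rewrite [c x]surjective_pairing in h1 f1; rewrite e' in h2 f2.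
  exact: (reach_inj tends_noloop nosim' (lexx b) (cb x) (cb x') h1 f1 h2 f2).
have psurj y : exists x, phi x = y.
  have [C [uC yC HC]] := H y.
  have sub : {subset map phi C <= C}.
    move=> z /mapP[x xC ->]; have [c' [h1 h2 h3]] := HC x xC; have [g1 g2] := Hc x.
    by rewrite /phi (final_uniq tends_noloop nosim' g1 g2 h1 h3).
  have um : uniq (map phi C) by rewrite map_inj_uniq.
  have [|_ E] := uniq_min_size um sub; first by rewrite size_map.
  by move: yC; rewrite -E => /mapP[x _ ->]; exists x.
exists phi; split.
  have [g gP] := choice psurj; exists g => [x|//]; exact/pinj/gP.
move=> x; exists (c x).2; have [h1 f1] := Hc x; rewrite /phi -surjective_pairing.
by split=> //; exact: reach_weak bT h1.
Qed.

Lemma flow_exists : exists sigma : V -> V,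
  [/\ bijective sigma, (forall v, stirring_path ends ring T v (sigma v)) &
    forall sigma' : V -> V, (forall v, stirring_path ends ring T v (sigma' v)) -> sigma' = sigma].
Proof.
have M1 : 0 < M0%:R :> R by rewrite ltr0n.
have [sg [bij Hs]] : exists sg : V -> V, bijective sg /\ forall v, exists s,
    [/\ reach ends ring T (v, 0) (sg v, s), s <= M0%:R * (T / M0%:R) &
      final ends ring (M0%:R * (T / M0%:R)) (sg v, s)].
  suff H k : (k <= M0)%N -> exists sg : V -> V, bijective sg /\ forall v, exists s,
    [/\ reach ends ring T (v, 0) (sg v, s), s <= k%:R * (T / M0%:R) &
      final ends ring (k%:R * (T / M0%:R)) (sg v, s)] by exact: H.
  elim: k => [|k IH] kM.
    exists id; split; first by exists id.
    move=> v; exists 0; rewrite mul0r; split=> //; first exact: reach_refl.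
    by move=> f t _ /= t0; rewrite leNgt t0.
  have [sg [bij Hs]] := IH (ltnW kM); have [phi [bphi Hp]] := interval_flow kM.
  exists (phi \o sg); split; first exact: bij_comp.
  move=> v; have [s [h1 h2 h3]] := Hs v; have [s' [g1 g2 g3]] := Hp (sg v).
  apply: (reach_cat h1 h2 h3 g1 g2 _ g3).
  by rewrite ler_wpM2r ?divr_ge0 ?ltW// ltr_nat.
have ME : M0%:R * (T / M0%:R) = T by rewrite mulrCA divff ?mulr1// gt_eqF.
rewrite ME in Hs.
exists sg; split=> //.
  by move=> v; have [s [h1 _ h3]] := Hs v; apply/(stirring_reach _ _ _ e0); exists s.
move=> sg' H'; apply/funext => v; have [s [h1 _ h3]] := Hs v.
have /(stirring_reach _ _ _ e0)[s' [g1 g3]] := H' v.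
by have [->] := final_uniq tends_noloop nosim g1 g3 h1 h3.
Qed.

End Flow.

(** * From the discrete walk to the cycle *)

Section Link.
Variables (R : realType) (V : eqType) (r : V) (parent : V -> V).
Hypothesis tree : rooted_tree r parent.
Variable ch : V -> seq V.
Hypothesis chP : forall x u, (u \in ch x) = (u != r) && (parent u == x).
Hypothesis uch : forall x, uniq (ch x).
Variables (ring : tedge r -> R -> Prop) (T : R) (N n : nat) (v : V).
Hypothesis N0 : (0 < N)%N.
Hypothesis vr : v != r.
Let ends := tends parent (r := r).
Hypothesis nosim : forall e f t, ring e t -> ring f t -> t <= T -> e = f.
Variable sg : V -> V.
Hypothesis sgP : forall y, exists s, reach ends ring T (y, 0) (sg y, s) /\ final ends ring T (sg y, s).

Local Notation dep := (dep tree).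
Local Notation desc := (desc parent).
Local Notation nxs := (nxs N).
Local Notation edges := (edges ch).
Local Notation mv := (mv parent).

Context (d : measure_display) (Om : measurableType d).
Variables (X : V * nat -> Om -> bool) (w : Om) (sl : V -> nat -> R) (U : V -> Prop).
Hypothesis E1 : forall u i, U u -> (i < N)%N -> X (u, i) w -> [/\ rv ring u (sl u i), 0 < sl u i & sl u i <= T].
Hypothesis E2 : forall u t, U u -> rv ring u t -> t <= T -> exists i, [/\ (i < N)%N, X (u, i) w & sl u i = t].
Hypothesis E3 : forall u u' i i', U u -> U u' -> X (u, i) w -> X (u', i') w -> (i < i')%N -> (i' < N)%N ->
  sl u i < sl u' i'.
Hypothesis E4 : forall u u' i, U u -> U u' -> X (u, i) w -> X (u', i) w -> (i < N)%N -> u = u'.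
Hypothesis EU : forall x u, desc v x -> (dep x < n)%N -> u \in edges x -> U u.

Definition stp (p p' : V * nat) : Prop := p'.2 = nxs p.2 /\
  (((forall u, u \in edges p.1 -> ~~ X (u, p.2) w) /\ p'.1 = p.1) \/
   exists u, [/\ u \in edges p.1, X (u, p.2) w & p'.1 = mv p.1 u]).

Definition inreg (p : V * nat) := [/\ desc v p.1, (dep p.1 < n)%N & (p.2 < N)%N].

(** An edge that has moved the walk is incident to the new position as well, and by [E4] it is the
    only one ringing in that slot; so the step can be undone. *)
Lemma stp_inj p1 p2 p' : inreg p1 -> inreg p2 -> stp p1 p' -> stp p2 p' -> p1 = p2.
Proof.
case: p1 p2 p' => [a i] [b k] [z l] [/= va da ia] [/= vb db kb] [/= e1 h1] [/= e2 h2].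
have ik : i = k by move: e1 e2; rewrite /nxs; do 2 case: eqP; lia.
subst k; congr (_, _).
have nst x y u : desc v x -> (dep x < n)%N -> u \in edges x -> y = mv x u -> u \in edges y.
  move=> vx dx ue ->; rewrite /mv; case: eqP => [->|/eqP ux]; last by rewrite mem_head.
  by rewrite inE (mem_ch chP) ?orbT//; exact: (desc_nr tree vr vx).
case: h1 => [[n1 z1]|[u [ue Xu zu]]]; case: h2 => [[n2 z2]|[u' [ue' Xu' zu']]].
- by rewrite -z1 -z2.
- by have := n1 u' (nst b a u' vb db ue' (etrans (esym z1) zu')); rewrite Xu'.
- by have := n2 u (nst a b u va da ue (etrans (esym z2) zu)); rewrite Xu.
have uu : u = u' by apply: (E4 (EU va da ue) (EU vb db ue') Xu Xu').
subst u'; move: zu zu' ue ue'; rewrite /mv.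
have np x : desc v x -> parent x <> x.
  move=> vx e; have xr := desc_nr tree vr vx; have := dep_parent tree xr; rewrite e; lia.
case: eqP => [ua|/eqP ua]; case: eqP => [ub|/eqP ub] e1' e2' ue ue'.
- by rewrite -ua -ub.
- by case: (np a va); rewrite -e1' e2' ua.
- by case: (np b vb); rewrite -e2' e1' ub.
- move: ue ue'; rewrite !inE (negbTE ua) (negbTE ub) /= => /(ch_parent chP)<- /(ch_parent chP)<- //.
Qed.

Lemma inc_edges e x : incident ends e x -> sval e \in edges x.
Proof.
case: e => u ur /=; case=> /= e; rewrite inE; first by rewrite e eqxx.
by rewrite -e (mem_ch chP) ?orbT//; exact/eqP.
Qed.

(* the particle sits at x just before slot i of its l-th lap; s is its last jump time *)
Definition at_slot l x s i := [/\ reach ends ring T (iter l sg v, 0) (x, s),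
   (s = 0 \/ exists u i0, [/\ U u, (i0 < i)%N, X (u, i0) w & s = sl u i0]) &
   forall u t, u \in edges x -> rv ring u t -> s < t -> t <= T ->
     exists i', [/\ (i <= i')%N, (i' < N)%N, X (u, i') w & sl u i' = t]].

(** After the last slot no ring up to [T] is left, so the particle has reached its final place and
    the next lap starts there. *)
Lemma at_wrap l x s i : (forall u, u \in edges x -> U u) -> (i < N)%N ->
  at_slot l x s i.+1 -> exists l' s', at_slot l' x s' (nxs i).
Proof.
move=> xU iN [h1 h2 h3]; rewrite /nxs; case: eqP => [iE|_]; last by exists l, s.
exists l.+1, 0.
have fin : final ends ring T (x, s).
  move=> [u ur] t inc st tT re; have ue := inc_edges inc.
  have rvu : rv ring u t by exists ur.
  by have [i' [a b _ _]] := h3 u t ue rvu st tT; lia.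
have ex : x = iter l.+1 sg v.
  have [s' [g1 g2]] := sgP (iter l sg v).
  by have [-> _] := final_uniq (tends_noloop tree) nosim h1 fin g1 g2.
split; [by rewrite -ex; exact: reach_refl|by left|].
move=> u t ue rvu _ tT; have [i' [a b c]] := E2 (xU u ue) rvu tT.
by exists i'.
Qed.

Lemma at_stay l x s i : (forall u, u \in edges x -> ~~ X (u, i) w) -> at_slot l x s i -> at_slot l x s i.+1.
Proof.
move=> nX [h1 h2 h3]; split=> //.
  by case: h2 => [|[u [i0 [a b c e]]]]; [left|right; exists u, i0; split=> //; exact: leqW].
move=> u t ue rvu st tT; have [i' [a b c e]] := h3 u t ue rvu st tT; exists i'; split=> //.
rewrite ltn_neqAle a andbT; apply/eqP => ii; by have := nX u ue; rewrite ii c.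
Qed.

Lemma at_move l x s i u : desc v x -> (dep x < n)%N -> (i < N)%N -> u \in edges x -> X (u, i) w ->
  at_slot l x s i -> exists s', reach ends ring T (iter l sg v, 0) (mv x u, s') /\
    ((forall u', u' \in edges (mv x u) -> U u') -> at_slot l (mv x u) s' i.+1).
Proof.
move=> vx dx iN ue Xu [h1 h2 h3]; have Uu := EU vx dx ue.
have [[ur re] t0 tT] := E1 Uu iN Xu; exists (sl u i).
have st : s < sl u i.
  case: h2 => [->//|[u0 [i0 [a b c ->]]]]; exact: (E3 a Uu c Xu b iN).
have J : jmp ends ring T (x, s) (mv x u, sl u i).
  exists (exist _ u ur); split=> //=.
  - rewrite /mv /crosses /ends /tends /=; case: eqP => [->|/eqP ux]; first by left.
    by right; move: ue; rewrite inE (negbTE ux) /= => /(ch_parent chP)->.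
  - move=> [f fr] t inc st' tt rf; have fe := inc_edges inc.
    have rvf : rv ring f t by exists fr.
    have [i' [a b c e]] := h3 f t fe rvf st' (le_trans (ltW tt) tT).
    have Uf := EU vx dx fe; case: (ltngtP i i') => ii.
    + by have := E3 Uu Uf Xu c ii b; rewrite e => /(lt_trans tt); rewrite ltxx.
    + by move: a; rewrite leqNgt ii.
    + subst i'; have fu := E4 Uf Uu c Xu iN; move: tt; rewrite -e.
      by have -> : f = u := fu; rewrite ltxx.
split; first exact: reach_jmp h1 J.
move=> U'; split; [exact: reach_jmp h1 J|by right; exists u, i; split|].
move=> u' t ue' rvu tt tT'; have [i' [b c e]] := E2 (U' u' ue') rvu tT'.
exists i'; split=> //; case: (ltngtP i i') => // ii.
- by have := E3 (U' u' ue') Uu c Xu ii iN; rewrite e => /(lt_trans tt); rewrite ltxx.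
- subst i'; have uu := E4 (U' u' ue') Uu c Xu iN; move: tt; rewrite -e uu ltxx//.
Qed.

(** Since steps can be undone, the first state to be repeated is the initial one, which counts as
    failure. A walk that does not fail therefore reaches depth [n] or sees new states for ever, and
    the latter is impossible with more fuel than there are states. *)
Lemma fail_reach M hist pos : inreg pos ->
  (forall p, p \in hist -> inreg p) -> uniq hist -> pos \notin hist ->
  (forall p, p \in pos :: hist -> p != (v, 0%N) -> exists2 p0, p0 \in hist & stp p0 p) ->
  (exists l s, at_slot l pos.1 s pos.2) ->
  (size (flatten [seq dl ch v k | k <- iota 0 n]) * N < size hist + M)%N ->
  ~~ fail tree ch X N n v M hist pos w ->
  exists l x s, reach ends ring T (iter l sg v, 0) (x, s) /\ (n <= dep x)%N.
Proof.
elim: M hist pos => [|M IH] hist [x i] [vx dx iN] hreg uh ph pred [l [s at_]] sz.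
  move=> _; exfalso; move: sz; rewrite addn0 ltnNge => /negP; apply.
  rewrite -[X in (_ * X)%N](size_iota 0) -(size_allpairs pair); apply: uniq_leq_size uh _ => p /hreg[vp dp pN].
  rewrite (surjective_pairing p); apply: allpairs_f; last by rewrite mem_iota.
  apply/flatten_mapP; exists (dep p.1 - dep v)%N; last first.
    by rewrite (dlP tree chP) vp /= eq_sym subnKC// (desc_dep_le tree vp).
  by rewrite mem_iota /= add0n (leq_ltn_trans (leq_subr _ _) dp).
rewrite /= in vx dx iN at_.
rewrite failS; set rg := [seq u <- edges x | X (u, i) w].
have rgU u : u \in rg -> [/\ u \in edges x, X (u, i) w & U u].
  by rewrite mem_filter => /andP[a b]; split=> //; exact: EU b.
have xU u : u \in edges x -> U u by exact: EU.
have main x' : stp (x, i) (x', nxs i) ->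
   (exists s', reach ends ring T (iter l sg v, 0) (x', s') /\
      ((forall u, u \in edges x' -> U u) -> at_slot l x' s' i.+1)) ->
   ~~ (if (n <= dep x')%N then false else if ~~ desc v x' then true else
     if (x', nxs i) \in (x, i) :: hist then (x', nxs i) == (v, 0%N)
     else fail tree ch X N n v M ((x, i) :: hist) (x', nxs i) w) ->
   exists l x s, reach ends ring T (iter l sg v, 0) (x, s) /\ (n <= dep x)%N.
  move=> sp [s' [rc at']]; case: ifP => [nx _|nx]; first by exists l, x', s'.
  case: (boolP (desc v x')) => //= vx'.
  have dx' : (dep x' < n)%N by rewrite ltnNge nx.
  have x'U u : u \in edges x' -> U u by exact: EU.
  case: ifP => [hin ne|hin nf].
    have [p0 p0h sp0] := pred _ hin ne.
    have e := stp_inj (hreg _ p0h) (And3 vx dx iN : inreg (x, i)) sp0 sp.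
    by rewrite -e p0h in ph.
  apply: (IH ((x, i) :: hist) (x', nxs i)) => //.
  - by split=> //=; exact: nxs_lt.
  - by move=> p; rewrite inE => /orP[/eqP->|/hreg].
  - by rewrite /= ph.
  - by rewrite hin.
  - move=> p; rewrite inE => /orP[/eqP-> _|pin pne]; first by exists (x, i); rewrite ?mem_head.
    by have [p0 p0h sp0] := pred p pin pne; exists p0 => //; rewrite inE p0h orbT.
  - exact: at_wrap x'U iN (at' x'U).
  - by rewrite /= addSnnS.
move: main; rewrite -/rg; case rgs : rg => [|u [|u' rg']] main /=.
- apply: main.
    split=> //=; left; split=> // u ue; apply/negP => Xu.
    by have : u \in rg by [rewrite mem_filter Xu]; rewrite rgs.
  exists s; split; first by case: at_.
  move=> _; apply: at_stay at_ => u ue; apply/negP => Xu.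
  by have : u \in rg by [rewrite mem_filter Xu]; rewrite rgs.
- have [ue Xu Uu] := rgU u (eq_ind_r (fun z => is_true (u \in z)) (mem_head _ _) rgs).
  apply: main; first by split=> //=; right; exists u.
  exact: at_move Xu at_.
- have [_ Xu Uu] := rgU u (eq_ind_r (fun z => is_true (u \in z)) (mem_head _ _) rgs).
  have u'm : u' \in rg by rewrite rgs !inE eqxx orbT.
  have [_ Xu' Uu'] := rgU u' u'm.
  have uu := E4 Uu Uu' Xu Xu' iN.
  have : uniq rg by rewrite filter_uniq//; exact: (uniq_edges tree chP uch).
  by rewrite rgs /= uu mem_head.
Qed.

End Link.

(** * Almost sure regularity of the clocks *)

Section Small.
Variable R : realType.

Lemma pow_small (z e : R) : 0 <= z < 1 -> 0 < e -> exists K, z ^+ K <= e.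
Proof.
move=> /andP[z0 z1] e0; have := @cvg_expr R z; rewrite ger0_norm// => /(_ z1).
move=> /cvgrPdist_lt /(_ e e0) [K _ H]; exists K; have := H K (leqnn K).
by rewrite sub0r normrN ger0_norm ?exprn_ge0// => /ltW.
Qed.

Lemma div_small (C e : R) : 0 < e -> exists2 N, (0 < N)%N & forall k, (N <= k)%N -> C / k%:R <= e.
Proof.
move=> e0; exists (Num.bound (`|C| / e)).+1 => // k Nk.
have k0 : 0 < k%:R :> R by rewrite ltr0n; apply: leq_trans Nk.
rewrite ler_pdivrMr// (le_trans (ler_norm _))// mulrC -ler_pdivrMr//.
apply/ltW/(lt_le_trans (archi_boundP _)); first by rewrite divr_ge0// ltW.
by rewrite ler_nat ltnW.
Qed.

End Small.

Section Prob.
Context (d : measure_display) (Om : measurableType d) (R : realType).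
Variable P : probability Om R.
Variables (V : eqType) (r : V) (parent : V -> V).
Hypothesis tree : rooted_tree r parent.
Variable ch : V -> seq V.
Hypothesis chP : forall x u, (u \in ch x) = (u != r) && (parent u == x).
Variable D : nat.
Hypothesis chD : forall x, (size (ch x) <= D)%N.
Variable tau : tedge r -> nat -> Om -> R.
Hypothesis mtau : forall e k, measurable_fun setT (tau e k).
Hypothesis itau : mutually_independent P (fun ek : tedge r * nat => tau ek.1 ek.2).
Hypothesis etau : forall e k, exp1_distributed P (tau e k).
Variable e0 : tedge r.
Variable T : R.
Hypothesis T0 : 0 < T.

Local Notation dep := (dep tree).
Local Notation desc := (desc parent).

Definition edge (u : V) : tedge r := if pselect (u <> r) is left h then exist _ u h else e0.

Lemma edge_sval u : u != r -> sval (edge u) = u.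
Proof. by move=> /eqP ur; rewrite /edge; case: pselect. Qed.

Lemma sval_inj (e f : tedge r) : sval e = sval f -> e = f.
Proof.
by case: e f => [u hu] [u' hu'] /= e; subst u'; rewrite (Prop_irrelevance hu hu').
Qed.

Lemma edge_inj u u' : u != r -> u' != r -> edge u = edge u' -> u = u'.
Proof. by move=> ur u'r e; rewrite -(edge_sval ur) -(edge_sval u'r) e. Qed.

Lemma sval_nr (e : tedge r) : sval e != r.
Proof. by apply/eqP; exact: (svalP e). Qed.

Lemma edge_of (e : tedge r) : edge (sval e) = e.
Proof. by apply: sval_inj; apply: edge_sval; exact: sval_nr. Qed.

Let E : eqType := {classic (tedge r)}.
Let tau' : E -> nat -> Om -> R := tau.

Definition Sarr u k w : R := arrival tau (edge u) k w.
Definition posw w := forall e k, 0 < tau e k w.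

Lemma rvE w u t : rv (rings tau w) u t <-> u != r /\ exists k, Sarr u k w = t.
Proof.
split=> [[h [k e]]|[ur [k e]]].
  split; first exact/eqP.
  exists k; rewrite /Sarr (_ : edge u = exist _ u h)//.
  by apply: sval_inj; rewrite edge_sval//; exact/eqP.
have /eqP h := ur; exists h, k; rewrite -e /Sarr.
by congr (arrival tau _ _ _); apply: sval_inj; rewrite edge_sval.
Qed.

Lemma Sarr_lt w u k k' : posw w -> (k < k')%N -> Sarr u k w < Sarr u k' w.
Proof.
move=> pw; elim: k' => // k' IH; rewrite ltnS /Sarr /arrival leq_eqVlt => /orP[/eqP->|/IH h].
  by rewrite [ltRHS]big_ord_recr /= ltrDl.
by rewrite [ltRHS]big_ord_recr /= (lt_trans h)// ltrDl.
Qed.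

Lemma Sarr_gt0 w u k : posw w -> 0 < Sarr u k w.
Proof.
move=> pw; case: k => [|k]; first by rewrite /Sarr /arrival big_ord_recr big_ord0 /= add0r.
apply: lt_trans (Sarr_lt u pw (ltn0Sn k)).
by rewrite /Sarr /arrival big_ord_recr big_ord0 /= add0r.
Qed.

Lemma bd_seqc (I : eqType) (s : seq I) (A : I -> set Om) (c : R) :
  (forall x, x \in s -> bd P (A x) c) -> bd P [set w | exists2 x, x \in s & A x w] ((size s)%:R * c).
Proof.
move=> H; have := bd_seq (f := fun=> c) H.
by rewrite big_const_seq count_predT iter_addr_0 mulr_natl.
Qed.

(** Positive waiting times with sum at most [T] are each at most [T]; this crude bound suffices
    because it tends to 0 with [K]. *)
Lemma arr_bd u K : bd P [set w | posw w /\ Sarr u K w <= T] ((1 - expR (- T)) ^+ K.+1).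
Proof.
pose L := [seq ((edge u : E, j), [set x : R | x <= T]) | j <- iota 0 K.+1].
have uL : uniq (map fst L) by rewrite -map_comp map_inj_uniq ?iota_uniq// => j j' [].
have mI : measurable [set x : R | x <= T].
  rewrite (_ : [set x | _] = `]-oo, T]%classic); first exact: measurable_itv.
  by apply/seteqP; split=> x /=; rewrite in_itv.
have mL : mble L by rewrite /L; elim: (iota _ _) => //= j s IH.
have [mS PS] := indep_seq (tau := tau') mtau itau uL mL.
exists [set w | satE tau' w L]; split=> //.
  move=> w [pw Sw]; have le j : (j <= K)%N -> tau (edge u) j w <= T.
    move=> jK; apply: le_trans Sw; rewrite /Sarr /arrival.
    have jK' : (j < K.+1)%N by [].
    rewrite (bigD1 (Ordinal jK')) //= lerDl sumr_ge0// => k _; exact/ltW/pw.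
  have H (l : seq nat) : (forall j, j \in l -> (j <= K)%N) ->
      satE tau' w [seq ((edge u : E, j), [set x : R | x <= T]) | j <- l].
    elim: l => //= j l IH Hl; split; first by apply: le; apply: Hl; rewrite mem_head.
    by apply: IH => j' jl; apply: Hl; rewrite inE jl orbT.
  by apply: H => j; rewrite mem_iota.
rewrite PS /L big_map (eq_bigr (fun=> (1 - expR (- T))%:E)).
  rewrite big_const_seq count_predT size_iota.
  have -> : forall k, iter k (mule (1 - expR (- T))%:E) 1%E = ((1 - expR (- T)) ^+ k)%:E.
    by elim=> [|k IHk] /=; rewrite ?expr0// IHk -EFinM -exprS.
  exact: lexx.
move=> j _; rewrite (_ : _ @^-1` _ = ~` [set w | T < tau (edge u) j w]).
  rewrite probability_setC; first by rewrite (etau (edge u) j (ltW T0)) EFinB.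
  rewrite -[X in measurable X]setTI (_ : [set w | _] = tau (edge u) j @^-1` `]T, +oo[%classic).
    by apply: mtau.
  by apply/seteqP; split=> w /=; rewrite in_itv/= andbT.
by apply/seteqP; split=> w /=; rewrite leNgt => /negP.
Qed.

(** * Comparison of the clocks with their bits for a fixed number of slots *)

Section Fixed.
Variable N : nat.
Hypothesis N0 : (0 < N)%N.
Let h := T / N%:R.

Lemma h_gt0 : 0 < h. Proof. by rewrite divr_gt0// ltr0n. Qed.

Let q := expR (- h).

Definition XV (c : V * nat) (w : Om) : bool := hit tau' h_gt0 (edge c.1 : E, c.2) w.

Lemma cylV_bd (s : seq ((V * nat) * bool)) : uniq (unzip1 s) -> all (fun c => c.1 != r) (unzip1 s) ->
  bd P (cyl XV s) (pc q s).
Proof.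
move=> us nr; pose f (c : V * nat) : E * nat := (edge c.1 : E, c.2).
pose s' := [seq (f cb.1, cb.2) | cb <- s].
have us' : uniq (unzip1 s').
  rewrite /unzip1 -map_comp (_ : map _ s = map f (unzip1 s)); last by rewrite -map_comp.
  rewrite map_inj_in_uniq// => c c' /(allP nr) cr /(allP nr) c'r [e1 e2].
  by rewrite (surjective_pairing c) (surjective_pairing c') e2 (edge_inj cr c'r e1).
have := cyl_bd (tau := tau') mtau itau etau h_gt0 us'; apply: bd_sub.
  by move=> w cw cb /mapP[cb' cb's ->] /=; exact: (cw cb').
by rewrite /pc /s' big_map.
Qed.

Lemma p_le : 0 <= 1 - q <= T / N%:R.
Proof.
rewrite subr_ge0 -[X in q <= X]expR0 ler_expR oppr_le0 (ltW h_gt0) /=.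
by have := expR_ge1Dx (- h); rewrite /q -/h; lra.
Qed.

Lemma hit1_bd u i : u != r -> bd P [set w | XV (u, i) w] (T / N%:R).
Proof.
move=> ur; have := @cylV_bd [:: ((u, i), true)] isT; rewrite /= ur /= => /(_ isT).
apply: bd_sub.
  by move=> w Xw cb; rewrite inE => /eqP->.
by rewrite /pc big_seq1 /wt /=; case/andP: p_le.
Qed.

Lemma hit2_bd u i u' i' : u != r -> u' != r -> (u, i) != (u', i') ->
  bd P [set w | XV (u, i) w /\ XV (u', i') w] ((T / N%:R) ^+ 2).
Proof.
move=> ur u'r ne; have := @cylV_bd [:: ((u, i), true); ((u', i'), true)].
rewrite /= !inE ne ur u'r /= => /(_ isT isT).
apply: bd_sub.
  by move=> w [Xw Xw'] cb; rewrite !inE => /orP[] /eqP->.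
rewrite /pc !big_cons big_nil /wt /= mulr1 expr2; case/andP: p_le => *; exact: ler_pM.
Qed.

Definition sl0 u k w : nat := slot h_gt0 (tau (edge u) ^~ w) k.

Lemma XVP u i w : reflect (exists k, sl0 u k w = i) (XV (u, i) w).
Proof. exact: asboolP. Qed.

Lemma sl0_ub u k w : Sarr u k w <= (sl0 u k w).+1%:R * h.
Proof. exact: slot_ub. Qed.

Lemma sl0_lb u k w : posw w -> (sl0 u k w)%:R * h <= Sarr u k w + k%:R * h.
Proof. by move=> pw; apply: slot_lb => j; exact/ltW/pw. Qed.

Lemma Nh : N%:R * h = T.
Proof. by rewrite /h mulrCA divff ?mulr1// pnatr_eq0 -lt0n. Qed.

Lemma sl0_leN u k w K : posw w -> Sarr u k w <= T -> (k < K)%N -> (sl0 u k w <= N + K)%N.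
Proof.
move=> pw ST kK; have := sl0_lb u k pw; have h0 := h_gt0.
have : k%:R * h <= K%:R * h by rewrite ler_pM2r// ler_nat ltnW.
move=> h1 h2; rewrite -(ler_nat R) -(ler_pM2r h0) natrD mulrDl Nh; lra.
Qed.

(* discretisation failure on the finite vertex set U *)
Definition Bad (U : seq V) K : set Om := [set w | posw w /\
  [\/ exists2 u, u \in U & Sarr u K w <= T,
      exists2 c, c \in [seq (u, i) | u <- U, i <- iota 0 (N + K).+1] &
        exists2 c', c' \in [seq (u, i) | u <- U, i <- iota (c.2 - K.+1) (2 * K + 3)] &
          c != c' /\ (XV c w /\ XV c' w) |
      exists2 c, c \in [seq (u, i) | u <- U, i <- iota N K.+1] & XV c w]].

Lemma Bad_bd U K : all (fun u => u != r) U ->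
  bd P (Bad U K) ((size U)%:R * (1 - expR (- T)) ^+ K.+1 +
    ((size U)%:R * (N + K).+1%:R * ((size U)%:R * (2 * K + 3)%:R * (T / N%:R) ^+ 2) +
     (size U)%:R * K.+1%:R * (T / N%:R))).
Proof.
move=> /allP nr.
have b1 := bd_seqc (fun u (_ : u \in U) => arr_bd u K).
have b3 : bd P [set w | exists2 c, c \in [seq (u, i) | u <- U, i <- iota N K.+1] & XV c w]
    ((size U)%:R * K.+1%:R * (T / N%:R)).
  have := @bd_seqc _ [seq (u, i) | u <- U, i <- iota N K.+1] (fun c => [set w | XV c w]) (T / N%:R).
  rewrite size_allpairs size_iota natrM; apply.
  by move=> c /allpairsP[[u i] [/= uU _ ->]]; apply: hit1_bd; exact: nr.
have b2 : bd P [set w | exists2 c, c \in [seq (u, i) | u <- U, i <- iota 0 (N + K).+1] &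
        exists2 c', c' \in [seq (u, i) | u <- U, i <- iota (c.2 - K.+1) (2 * K + 3)] &
          c != c' /\ (XV c w /\ XV c' w)]
   ((size U)%:R * (N + K).+1%:R * ((size U)%:R * (2 * K + 3)%:R * (T / N%:R) ^+ 2)).
  have sz k l : (size U)%:R * l%:R = (size [seq (u, i) | u <- U, i <- iota k l])%:R :> R.
    by rewrite size_allpairs size_iota natrM.
  rewrite (sz 0%N (N + K).+1).
  apply: bd_seqc => c /allpairsP[[u i] [/= uU _ ->]].
  rewrite (sz (i - K.+1)%N (2 * K + 3)%N).
  apply: (@bd_seqc _ _ (fun c' => [set w | (u, i) != c' /\ (XV (u, i) w /\ XV c' w)])).
  move=> c' /allpairsP[[u' i'] [/= u'U _ ->]].
  case: (boolP ((u, i) == (u', i'))) => ne.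
    by apply: bd0; rewrite ?sqr_ge0// => w [].
  by apply: bd_sub (hit2_bd (nr _ uU) (nr _ u'U) ne) => // w [].
apply: bd_sub (bd_setU b1 (bd_setU b2 b3)) => // w [pw []].
- by move=> [u uU Su]; left; exists u.
- by move=> H; right; left.
- by move=> H; right; right.
Qed.

Lemma close_slots u u' k k' w K : posw w -> (k < K)%N -> (k' < K)%N ->
  Sarr u k w <= Sarr u' k' w -> (sl0 u k w <= sl0 u' k' w + K)%N.
Proof.
move=> pw kK k'K le; have h0 := h_gt0; have h1 := sl0_lb u k pw; have h2 := sl0_ub u' k' w.
have h3 : k.+1%:R * h <= K%:R * h by rewrite ler_pM2r// ler_nat.
have : ((sl0 u k w)%:R * h <= ((sl0 u' k' w)%:R + K%:R) * h).
  by move: h2 h3; rewrite -!natr1 mulrDl; lra.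
by rewrite ler_pM2r// -natrD ler_nat.
Qed.

(* Off the bad event, slots and ringing times are order isomorphic. *)
Lemma good_link U K w : all (fun u => u != r) U -> posw w -> ~ Bad U K w ->
  exists sl : V -> nat -> R,
  [/\ (forall u i, u \in U -> (i < N)%N -> XV (u, i) w ->
        [/\ rv (rings tau w) u (sl u i), 0 < sl u i & sl u i <= T]),
      (forall u t, u \in U -> rv (rings tau w) u t -> t <= T ->
        exists i, [/\ (i < N)%N, XV (u, i) w & sl u i = t]),
      (forall u u' i i', u \in U -> u' \in U -> XV (u, i) w -> XV (u', i') w -> (i < i')%N ->
        (i' < N)%N -> sl u i < sl u' i') &
      (forall u u' i, u \in U -> u' \in U -> XV (u, i) w -> XV (u', i) w -> (i < N)%N -> u = u')].
Proof.
move=> /allP nr pw nB.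
have G1 u : u \in U -> T < Sarr u K w.
  by move=> uU; rewrite ltNge; apply/negP => le; apply: nB; split=> //; constructor 1; exists u.
(* Slots may lag by up to [K], so a ring before [T] could be recorded in a slot from [N] to [N + K];
   the third part of [Bad] excludes it. *)
have G3 u i : u \in U -> (N <= i <= N + K)%N -> ~~ XV (u, i) w.
  move=> uU iN; apply/negP => Xu; apply: nB; split=> //; constructor 3.
  by exists (u, i) => //; apply: allpairs_f => //; rewrite mem_iota; lia.
have G2 u u' i i' : u \in U -> u' \in U -> (i <= N + K)%N -> (i <= i' + K.+1)%N -> (i' <= i + K.+1)%N ->
    XV (u, i) w -> XV (u', i') w -> (u, i) = (u', i').
  move=> uU u'U iN ii i'i X1 X2; apply/eqP/negPn/negP => ne; apply: nB; split=> //; constructor 2.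
  exists (u, i); first by apply: allpairs_f => //; rewrite mem_iota; lia.
  by exists (u', i') => //; apply: allpairs_f => //; rewrite mem_iota /=; lia.
have kK u k : u \in U -> Sarr u k w <= T -> (k < K)%N.
  move=> uU ST; rewrite ltnNge; apply/negP => Kk.
  have : Sarr u K w <= Sarr u k w.
    by move: Kk; rewrite leq_eqVlt => /orP[/eqP->//|/(Sarr_lt u pw)/ltW].
  by have := G1 u uU; lra.
have /choice[f Hf] (c : V * nat) : exists k, XV c w -> sl0 c.1 k w = c.2.
  case: c => u i; case: (boolP (XV (u, i) w)) => [/XVP[k e]|nX]; last by exists 0%N.
  by exists k.
exists (fun u i => Sarr u (f (u, i)) w); split.
- move=> u i uU iN Xu; have e := Hf _ Xu; rewrite /= in e; split.
  + by apply/rvE; split; [exact: nr|exists (f (u, i))].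
  + exact: Sarr_gt0.
  + apply: (le_trans (sl0_ub _ _ _)); rewrite e -Nh ler_pM2r ?h_gt0// ler_nat//.
- move=> u t uU /rvE[_ [k <-]] ST; have kk := kK u k uU ST.
  have Xk : XV (u, sl0 u k w) w by apply/XVP; exists k.
  have sN := sl0_leN pw ST kk.
  exists (sl0 u k w); split=> //.
    by rewrite ltnNge; apply/negP => h'; have := G3 u (sl0 u k w) uU; rewrite h' sN Xk => /(_ isT).
  by have := Hf _ Xk => /= /slot_inj ->.
- move=> u u' i i' uU u'U Xu Xu' ii i'N.
  have [e e'] := (Hf _ Xu, Hf _ Xu'); rewrite /= in e e'.
  have ST v j : v \in U -> (j < N)%N -> XV (v, j) w -> (f (v, j) < K)%N.
    move=> vU jN Xv; apply: (kK v) => //; apply: (le_trans (sl0_ub _ _ _)).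
    by rewrite (Hf _ Xv) /= -Nh ler_pM2r ?h_gt0// ler_nat.
  rewrite ltNge; apply/negP => le.
  have := close_slots pw (ST u' i' u'U i'N Xu') (ST u i uU (ltn_trans ii i'N) Xu) le.
  rewrite e e' => le2.
  have h1 : (i <= N + K)%N by move: ii i'N; clear; lia.
  have h2 : (i <= i' + K.+1)%N by move: ii; clear; lia.
  have h3 : (i' <= i + K.+1)%N by move: le2; clear; lia.
  by have [_ ei] := G2 u u' i i' uU u'U h1 h2 h3 Xu Xu'; rewrite ei ltnn in ii.
- move=> u u' i uU u'U Xu Xu' iN.
  have h1 : (i <= N + K)%N by move: iN; clear; lia.
  have h2 : (i <= i + K.+1)%N by clear; lia.
  by have [] := G2 u u' i i uU u'U h1 h2 h2 Xu Xu'.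
Qed.

End Fixed.

(** First [K] is chosen to make many rings unlikely; with [K] fixed, the remaining terms are of
    order [1 / N]. *)
Lemma Bad_small U e : all (fun u => u != r) U -> 0 < e ->
  exists K N1, (0 < N1)%N /\ forall N (N0 : (0 < N)%N), (N1 <= N)%N -> bd P (Bad N0 U K) e.
Proof.
move=> nr e1; set u := (size U)%:R : R.
have rho : 0 <= 1 - expR (- T) < 1.
  rewrite subr_ge0 -[X in _ <= X]expR0 ler_expR oppr_le0 (ltW T0) /=.
  by rewrite ltrBlDr ltrDl expR_gt0.
have u0 : 0 <= u by [].
have u1 : 0 < u + 1 by rewrite ltr_wpDl.
have e2 : 0 < e / 2 / (u + 1) by rewrite !divr_gt0.
have [K HK] := pow_small rho e2.
set C := u * 2 * (u * (2 * K + 3)%:R * T ^+ 2) + u * K.+1%:R * T.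
have [N1 N10 HN1] := @div_small R C (e / 2) (divr_gt0 e1 (ltr0n R 2)).
exists K, (N1 + K.+1)%N; split; first by rewrite addn_gt0 N10.
move=> N N0 NN; apply: bd_sub (Bad_bd N0 K nr) => //; rewrite -/u.
have NR : 0 < N%:R :> R by rewrite ltr0n.
have t1 : u * (1 - expR (- T)) ^+ K.+1 <= e / 2.
  have [r0 r1] := andP rho.
  apply: (@le_trans _ _ (u * (e / 2 / (u + 1)))).
    rewrite ler_wpM2l//; apply: le_trans HK; apply: ler_wiXn2l => //; exact: ltW.
  rewrite mulrCA -[leRHS]mulr1 ler_wpM2l ?divr_ge0 ?(ltW e1)// ler_pdivrMr// mul1r lerDl//.
have t2 : u * (N + K).+1%:R * (u * (2 * K + 3)%:R * (T / N%:R) ^+ 2) +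
     u * K.+1%:R * (T / N%:R) <= C / N%:R.
  rewrite /C mulrDl lerD//; last by rewrite mulrA.
  have le2 : (N + K).+1%:R <= 2 * N%:R :> R.
    by rewrite -natrM ler_nat; move: NN; clear; lia.
  have A0 : 0 <= u * (u * (2 * K + 3)%:R * (T / N%:R) ^+ 2).
    by apply: mulr_ge0 => //; apply: mulr_ge0; [exact: mulr_ge0|exact: sqr_ge0].
  have := ler_wpM2r A0 le2; rewrite (_ : 2 * N%:R * _ = u * 2 * (u * (2 * K + 3)%:R * T ^+ 2) / N%:R).
    by lra.
  by field; rewrite gt_eqF.
have t3 : C / N%:R <= e / 2 by apply: HN1; apply: leq_trans NN; exact: leq_addr.
by move: t1 t2 t3; lra.
Qed.

(** The generations [dl ch r n] are finite and exhaust the tree, so this is a countable union. *)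
Lemma negl_V (A : V -> set Om) : (forall u, u != r -> P.-negligible (A u)) ->
  P.-negligible [set w | exists2 u, u != r & A u w].
Proof.
move=> H; apply: (@negligibleS _ _ _ _ (\bigcup_n [set w | exists2 u, u \in [seq u <- dl ch r n | u != r] & A u w])).
  move=> w [u ur Au]; exists (dep u) => //; exists u => //.
  by rewrite mem_filter ur (dlP tree chP) desc_r//= dep_r add0n eqxx.
apply: negligible_bigcup => n.
have : {subset [seq u <- dl ch r n | u != r] <= predC1 r} by move=> u; rewrite mem_filter => /andP[].
elim: [seq u <- _ | _] => [|u s IH] Hs.
  apply: (@negligibleS _ _ _ _ set0); last exact: negligible_set0.
  by move=> w [].
apply: (@negligibleS _ _ _ _ (A u `|` [set w | exists2 u, u \in s & A u w])).
  by move=> w [u']; rewrite inE => /orP[/eqP->|u's] Au; [left|right; exists u'].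
apply: negligibleU; first by apply: H; have := Hs u (mem_head _ _).
by apply: IH => u' u's; apply: Hs; rewrite inE u's orbT.
Qed.

Lemma negl_pos : P.-negligible [set w | ~ posw w].
Proof.
apply: (@negligibleS _ _ _ _ [set w | exists2 u, u != r & (\bigcup_k [set w | tau (edge u) k w <= 0]) w]).
  move=> w /existsNP[e /existsNP[k /negP]]; rewrite -leNgt => h; exists (sval e); first exact: sval_nr.
  by exists k => //=; rewrite edge_of.
apply: negl_V => u ur; apply: negligible_bigcup => k.
have mA : measurable [set w | 0 < tau (edge u) k w].
  rewrite -[X in measurable X]setTI (_ : [set w | _] = tau (edge u) k @^-1` `]0, +oo[%classic).
    by apply: mtau.
  by apply/seteqP; split=> w /=; rewrite in_itv/= andbT.
have -> : [set w | tau (edge u) k w <= 0] = ~` [set w | 0 < tau (edge u) k w].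
  by apply/seteqP; split=> w /=; rewrite leNgt => /negP.
apply/negligibleP; first exact: measurableC.
have := probability_setC P mA; rewrite (etau (edge u) k (lexx 0)) oppr0 expR0 subee//.
Qed.

Lemma negl_frings : P.-negligible [set w | posw w /\ exists2 u, u != r & forall K, Sarr u K w <= T].
Proof.
apply: (@negligibleS _ _ _ _ [set w | exists2 u, u != r & (posw w /\ forall K, Sarr u K w <= T)]).
  by move=> w [pw [u ur H]]; exists u.
apply: negl_V => u ur; apply: bd_negligible => e e1.
have rho : 0 <= 1 - expR (- T) < 1.
  rewrite subr_ge0 -[X in _ <= X]expR0 ler_expR oppr_le0 (ltW T0) /=.
  by rewrite ltrBlDr ltrDl expR_gt0.
have [K HK] := pow_small rho e1.
apply: bd_sub (arr_bd u K); first by move=> w [pw H].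
have [r0 r1] := andP rho.
by apply: le_trans HK; apply: ler_wiXn2l => //; exact: ltW.
Qed.

(** Off a bad event of arbitrarily small probability the two clocks never share a slot, and the
    order of slots is the order of times. *)
Lemma negl_nosim : P.-negligible [set w | posw w /\ exists2 u, u != r & exists2 u', u' != r &
   u != u' /\ exists2 t, t <= T & rv (rings tau w) u t /\ rv (rings tau w) u' t].
Proof.
apply: (@negligibleS _ _ _ _ [set w | exists2 u, u != r & exists2 u', u' != r &
   (posw w /\ u != u' /\ exists2 t, t <= T & rv (rings tau w) u t /\ rv (rings tau w) u' t)]).
  by move=> w [pw [u ur [u' u'r [ne H]]]]; exists u => //; exists u'.
apply: negl_V => u ur; apply: negl_V => u' u'r; apply: bd_negligible => e e1.
have nr : all (fun u => u != r) [:: u; u'] by rewrite /= ur u'r.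
have [K [N1 [N10 H]]] := Bad_small nr e1.
apply: bd_sub (H N1 N10 (leqnn _)) => // w [pw [ne [t tT [rt rt']]]].
apply: contrapT => nB.
have [sl [E1 E2 E3 E4]] := good_link nr pw nB.
have [uU u'U] : u \in [:: u; u'] /\ u' \in [:: u; u'] by rewrite !inE !eqxx orbT.
have [i [iN Xi si]] := E2 u t uU rt tT; have [i' [i'N Xi' si']] := E2 u' t u'U rt' tT.
case: (ltngtP i i') => ii.
- by have := E3 u u' i i' uU u'U Xi Xi' ii i'N; rewrite si si' ltxx.
- by have := E3 u' u i' i u'U uU Xi' Xi ii iN; rewrite si si' ltxx.
- by subst i'; move: ne; rewrite (E4 u u' i uU u'U Xi Xi' iN) eqxx.
Qed.

(* In an interval of length at most 1 / (4 D) the rung edges, followed downwards,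
   form a subcritical branching process. *)
Variable M0 : nat.
Hypothesis M00 : (0 < M0)%N.
Hypothesis M0T : 4 * D%:R * T <= M0%:R.
Hypothesis D0 : (0 < D)%N.

(** A union bound over one ringing slot per vertex, taken one vertex at a time; the induction
    carries the bits already fixed, all away from the remaining vertices. *)
Lemma hits_bd N (N0 : (0 < N)%N) (us : seq V) (I : seq nat) : uniq us -> all (fun u => u != r) us ->
  bd P [set w | forall u, u \in us -> exists2 i, i \in I & XV N0 (u, i) w]
    (((size I)%:R * (T / N%:R)) ^+ size us).
Proof.
move=> uu nr; set q := expR (- (T / N%:R)).
have p01 := p_le N0; rewrite -/q in p01.
have q01 : 0 <= q <= 1 by rewrite expR_ge0; case/andP: p01; rewrite subr_ge0.
suff H : forall s : seq ((V * nat) * bool), uniq (unzip1 s) -> all (fun c => c.1 != r) (unzip1 s) ->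
    (forall c, c \in unzip1 s -> c.1 \notin us) ->
    bnd P (XV N0) q s [set w | forall u, u \in us -> exists2 i, i \in I & XV N0 (u, i) w]
     (((size I)%:R * (T / N%:R)) ^+ size us).
  have dis c : c \in unzip1 (@nil ((V * nat) * bool)) -> c.1 \notin us by [].
  have := H [::] isT isT dis; rewrite /bnd /pc big_nil mulr1.
  by apply: bd_sub => // w Hw; split.
elim: us uu nr => [|u us IH] /= => [_ _ s us nrs _|/andP[uus uu] /andP[ur nr] s us' nrs dis].
  rewrite expr0; apply: bnd_sub (_ : bnd P (XV N0) q s setT 1) => //.
  by rewrite /bnd mul1r setIT; exact: cylV_bd.
rewrite exprS /bnd.
have B i : i \in I -> bd P (cyl (XV N0) (((u, i), true) :: s) `&`
   [set w | forall u, u \in us -> exists2 i, i \in I & XV N0 (u, i) w])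
   (T / N%:R * ((size I)%:R * (T / N%:R)) ^+ size us * pc q s).
  move=> iI.
  have h1 : uniq (unzip1 (((u, i), true) :: s)).
    by rewrite /= us' andbT; apply/negP => /dis; rewrite mem_head.
  have h2 : all (fun c => c.1 != r) (unzip1 (((u, i), true) :: s)) by rewrite /= ur.
  have h3 c : c \in unzip1 (((u, i), true) :: s) -> c.1 \notin us.
    by rewrite /= inE => /orP[/eqP->//|/dis]; rewrite inE negb_or => /andP[].
  have := IH uu nr _ h1 h2 h3; rewrite /bnd pc_cons /wt; apply: bd_sub => //.
  rewrite mulrA ler_wpM2r ?pc_ge0// [leLHS]mulrC ler_wpM2r//; last by case/andP: p01.
  by rewrite exprn_ge0// mulr_ge0// divr_ge0// ltW.
apply: bd_sub (bd_seqc B).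
- move=> w [cw Hw]; have [i iI Xi] := Hw u (mem_head _ _); exists i => //; split.
    by apply/cyl_cons; split.
  by move=> u' u's; apply: Hw; rewrite inE u's orbT.
- by rewrite le_eqVlt; apply/orP; left; apply/eqP; ring.
Qed.

Lemma tree_path Lg t0 u : desc t0 u -> dep u = (dep t0 + Lg)%N ->
  exists ws, [/\ uniq ws, size ws = Lg, all (fun x => x != r) ws &
    forall x, x \in ws -> [/\ desc t0 x, desc x u & x <> t0]].
Proof.
elim: Lg u => [|Lg IH] u tu du; first by exists [::].
have ut : u != t0 by apply/eqP => e; move: du; rewrite e; clear; lia.
have ur : u != r by apply/eqP => e; move: du; rewrite e dep_r; clear; lia.
have dpu := dep_parent tree ur.
have tp := desc_up tu ut.
have dp : dep (parent u) = (dep t0 + Lg)%N by move: du; rewrite dpu; clear; lia.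
have [ws [uw sw aw Hw]] := IH _ tp dp.
exists (u :: ws); split.
- rewrite /= uw andbT; apply/negP => /Hw[_ /(desc_dep_le tree)]; rewrite dpu; clear; lia.
- by rewrite /= sw.
- by rewrite /= ur.
- move=> x; rewrite inE => /orP[/eqP->|/Hw[h1 h2 h3]]; first by split=> //; [exact: desc_refl|exact/eqP].
  by split=> //; exact: desc_parent.
Qed.

Lemma clus_bd k K t0 u Lg : (k < M0)%N -> desc t0 u -> dep u = (dep t0 + Lg)%N ->
  bd P [set w | posw w /\ clus parent (rings tau w) (k%:R * (T / M0%:R)) (k.+1%:R * (T / M0%:R)) t0 u]
    (Lg%:R * (1 - expR (- T)) ^+ K.+1 + (2 * D%:R)^-1 ^+ Lg).
Proof.
move=> kM tu du; have [ws [uw sw aw Hw]] := tree_path tu du.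
have M0R : 0 < M0%:R :> R by rewrite ltr0n.
(* Each interval consists of [K + 1] slots, and the lag of the slots adds [K + 1] more. The chance
   of a hit is thus at most [2 * T / M0], which is at most [1 / (2 * D)]. *)
pose N1 := K.+1; pose N := (M0 * N1)%N; have N0 : (0 < N)%N by rewrite muln_gt0 M00.
have NR : 0 < N%:R :> R by rewrite ltr0n.
set h := T / N%:R; have h0 : 0 < h by rewrite divr_gt0.
have TM : T / M0%:R = N1%:R * h.
  by rewrite /h /N natrM; field; rewrite !gt_eqF// ltr0n.
have b1 := bd_seqc (fun x (_ : x \in ws) => arr_bd x K).
have b2 := hits_bd N0 (iota (k * N1) (N1 + K.+1)) uw aw.
apply: bd_sub (bd_setU b1 b2).
  move=> w [pw [_ cl]]; apply: contrapT => /not_orP[nB1 nB2]; apply: nB2 => x xw.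
  have [t0x xu xt] := Hw x xw; have [s [as' sb /rvE[_ [j sj]]]] := cl x t0x xu xt.
  have sT : s <= T.
    apply: (le_trans sb); rewrite mulrCA ger_pMr// ler_pdivrMr// mul1r ler_nat//.
  have ST : T < Sarr x K w.
    by rewrite ltNge; apply/negP => le; apply: nB1; exists x.
  have jK : (j < K)%N.
    rewrite ltnNge; apply/negP => Kj.
    have : Sarr x K w <= Sarr x j w.
      by move: Kj; rewrite leq_eqVlt => /orP[/eqP->//|/(Sarr_lt x pw)/ltW].
    by rewrite sj; move: sT ST; lra.
  have ub := sl0_ub N0 x j w; have lb := sl0_lb N0 x j pw; rewrite -/h sj in ub lb.
  exists (sl0 N0 x j w); last by apply/XVP; exists j.
  rewrite mem_iota; apply/andP; split.
    rewrite -ltnS -(ltr_nat R) -(ltr_pM2r h0); apply: lt_le_trans ub.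
    by rewrite natrM -mulrA -TM.
  have jh : j.+1%:R * h <= K%:R * h by rewrite ler_pM2r// ler_nat.
  have : (sl0 N0 x j w)%:R * h < (k * N1 + (N1 + K.+1))%:R * h.
    apply: (le_lt_trans lb); move: sb jh; rewrite TM -!natr1 !natrD natrM -!natr1; move: h0; lra.
  by rewrite ltr_pM2r// ltr_nat.
rewrite sw lerD2l size_iota; apply: lerXn2r; rewrite ?nnegrE.
- by rewrite mulr_ge0// ltW.
- by rewrite invr_ge0 mulr_ge0.
have -> : (N1 + K.+1)%:R * h = 2 * (T / M0%:R) by rewrite TM /N1 natrD; ring.
have DR : 0 < D%:R :> R by rewrite ltr0n.
rewrite -[leRHS]mul1r ler_pdivlMr ?mulr_gt0// mulrAC mulrA ler_pdivrMr// mul1r.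
by move: M0T; lra.
Qed.

(** At most [D ^ Lg] vertices, each with weight [(2 * D) ^ - Lg], leave [2 ^ - Lg]. The generation
    [Lg] is chosen first, then [K] to absorb the error terms. *)
Lemma negl_perc k t0 : (k < M0)%N -> P.-negligible [set w | posw w /\ forall Lg, exists u,
   clus parent (rings tau w) (k%:R * (T / M0%:R)) (k.+1%:R * (T / M0%:R)) t0 u /\ dep u = (dep t0 + Lg)%N].
Proof.
move=> kM; apply: bd_negligible => e e1.
have e2 : 0 < e / 2 by rewrite divr_gt0.
have half : 0 <= (2^-1 : R) < 1 by apply/andP; split; lra.
have [Lg HL] := pow_small half e2.
have rho : 0 <= 1 - expR (- T) < 1.
  rewrite subr_ge0 -[X in _ <= X]expR0 ler_expR oppr_le0 (ltW T0) /=.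
  by rewrite ltrBlDr ltrDl expR_gt0.
set C : R := (D ^ Lg)%:R * Lg%:R.
have C0 : 0 <= C by rewrite mulr_ge0.
have [K HK] := pow_small rho (divr_gt0 e2 (ltr_wpDl C0 (@ltr01 R))).
have [r0 r1] := andP rho.
have {}HK : (1 - expR (- T)) ^+ K.+1 <= e / 2 / (C + 1).
  by apply: le_trans HK; apply: ler_wiXn2l => //; exact: ltW.
have DR : 0 < D%:R :> R by rewrite ltr0n.
have B u : u \in dl ch t0 Lg -> bd P [set w | posw w /\ clus parent (rings tau w)
    (k%:R * (T / M0%:R)) (k.+1%:R * (T / M0%:R)) t0 u]
    (Lg%:R * (1 - expR (- T)) ^+ K.+1 + (2 * D%:R)^-1 ^+ Lg).
  by rewrite (dlP tree chP) => /andP[tu /eqP du]; exact: clus_bd.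
apply: bd_sub (bd_seqc B).
  move=> w [pw H]; have [u [cu du]] := H Lg; exists u => //.
  by rewrite (dlP tree chP) du eqxx andbT; case: cu.
apply: (@le_trans _ _ ((D ^ Lg)%:R * (Lg%:R * (1 - expR (- T)) ^+ K.+1 + (2 * D%:R)^-1 ^+ Lg))).
  rewrite ler_wpM2r ?ler_nat ?dl_size//.
  by rewrite addr_ge0 ?mulr_ge0 ?exprn_ge0// invr_ge0 mulr_ge0.
rewrite mulrDr mulrA -/C invfM exprMn.
have -> : (D ^ Lg)%:R * (2^-1 ^+ Lg * D%:R^-1 ^+ Lg) = 2^-1 ^+ Lg :> R.
  by rewrite natrX mulrCA -exprMn divff ?expr1n ?mulr1// gt_eqF.
have : C * (1 - expR (- T)) ^+ K.+1 <= e / 2.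
  apply: (le_trans (ler_wpM2l C0 HK)); rewrite mulrCA -[leRHS]mulr1 ler_wpM2l ?(ltW e2)//.
  by rewrite ler_pdivrMr ?mul1r ?lerDl// ltr_wpDl.
by move: HL; lra.
Qed.

End Prob.

(** * Choice of the parameters and conclusion *)

Definition params (R : realType) (D : nat) (q : R) (N : nat) (al : R) :=
  exists L m' N2 (ze c2 mu : R),
   [/\ (L.+1 < N)%N, 0 < ze <= 1, 1 + al <= 2 * ze & 1 - (1 - al) * (1 - q ^+ L) <= ze] /\
   [/\ (0 < m')%N, 0 < c2 <= 1, c2 <= q ^+ (D * L), (N2 + L + 2 <= N)%N & (0 < N2)%N] /\
   [/\ 0 <= mu, 1 <= mu * (((1 - q) * q ^+ D) * N2%:R) &
     1 - ((1 - al * ze ^+ m') / m'%:R) * (m'%:R * (c2 / 6)) + mu * (2 * m' + 1)%:R <= al].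

(** With [ze ^+ m' <= 1 / 2] a block gains at least [c2 / 12]. Half of this is kept, which gives
    [al], and the other half pays [8 / T * (2 * m' + 1)]: hence the 192 in the bound for [T]. *)
Lemma params_exist (R : realType) (D : nat) : (0 < D)%N ->
  exists al T1 : R, [/\ 0 < al < 1, 0 < T1 & forall T, T1 <= T ->
    exists N1, forall N, (N1 <= N)%N -> params D (expR (- (T / N%:R))) N al].
Proof.
move=> D0; have DR : 1 <= D%:R :> R by rewrite ler1n.
set c2 : R := expR (- (2 * D%:R)).
have c20 : 0 < c2 := expR_gt0 _.
have c21 : c2 <= 1 by rewrite -[leRHS]expR0 ler_expR; lra.
set al := 1 - c2 / 24; set ze := (1 + al) / 2.
have al01 : 0 < al < 1 by apply/andP; split; rewrite /al; lra.
have ze01 : 0 < ze < 1 by apply/andP; split; rewrite /ze /al; lra.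
have ze01' : 0 <= ze < 1 by case/andP: ze01 => /ltW -> ->.
have half : 0 < (2^-1 : R) by rewrite invr_gt0.
have [m hm] := pow_small ze01' half.
have {}hm : ze ^+ m.+1 <= 2^-1.
  by apply: le_trans hm; apply: ler_wiXn2l => //; lra.
set C : R := (2 * m.+1 + 1)%:R; have C0 : 0 <= C by [].
exists al, (192 * C / c2 + 4); split=> //.
  by rewrite ltr_wpDl// divr_ge0 ?mulr_ge0// ltW.
move=> T T1; have T4 : 4 <= T by apply: le_trans T1; rewrite lerDr divr_ge0 ?mulr_ge0// ltW.
have T0 : 0 < T by move: T4; lra.
(* The first summand gives [h * D <= 1 / 2]. The 12 is needed for [N2 >= N / 2], as [L <= N / 4 + 1]
   by [T >= 4]. *)
exists (Num.bound (2 * D%:R * T) + 12)%N => N NN.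
have N12 : 12 <= N%:R :> R by rewrite ler_nat (leq_trans _ NN)// leq_addl.
have ND : 2 * D%:R * T <= N%:R.
  apply/ltW; apply: lt_le_trans (_ : (Num.bound (2 * D%:R * T))%:R <= _).
    by apply: archi_boundP; rewrite !mulr_ge0// ltW.
  by rewrite ler_nat (leq_trans _ NN)// leq_addr.
have NT : 2 * T <= N%:R.
  apply: le_trans ND; rewrite -mulrA ler_pM2l// -[leLHS]mul1r ler_pM2r//.
have N0 : 0 < N%:R :> R by lra.
set h := T / N%:R; have h0 : 0 < h by rewrite divr_gt0.
have hN : h * N%:R = T by rewrite /h divfK// gt_eqF.
have hD : h * D%:R <= 1 / 2.
  by rewrite /h mulrAC ler_pdivrMr//; move: ND; lra.
have h2 : h <= 1 / 2 by rewrite /h ler_pdivrMr//; move: NT; lra.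
set q := expR (- h).
have qX k : q ^+ k = expR (- (k%:R * h)) by rewrite /q -expRM_natl mulrN.
set x := N%:R / T; have x0 : 0 <= x by rewrite divr_ge0// ltW.
have hx : h * x = 1 by rewrite /h /x; field; rewrite !gt_eqF.
have x4 : x <= N%:R / 4 by rewrite /x ler_pM2l// lef_pV2 ?posrE.
have /andP[Lx xL] := truncn_itv x0.
(* The window has length [L * h] between 1 and 2: long enough for [q ^+ L <= 1 / 2], short enough
   for [c2 <= q ^+ (D * L)]. *)
set L := (Num.truncn x).+1.
have xL' : x <= L%:R by exact: ltW.
have Lx' : L%:R <= x + 1 by rewrite /L -natr1 lerD2r.
have hL1 : 1 <= L%:R * h.
  have : x * h <= L%:R * h by rewrite ler_pM2r.
  by move: hx; lra.
have hL2 : L%:R * h <= 2.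
  have : L%:R * h <= (x + 1) * h by rewrite ler_pM2r.
  by move: hx h2; lra.
have L2 : (L + 2 <= N)%N by rewrite -(ler_nat R) natrD; move: Lx' x4 N12; lra.
have N2R : N%:R / 2 <= (N - (L + 2))%:R :> R.
  by rewrite natrB// natrD; move: Lx' x4 N12; lra.
have N20 : (0 < N - (L + 2))%N by rewrite -(ltr_nat R); move: N2R N12; lra.
(* The block takes all the time that the window leaves. A given clock rings alone in it about
   [h / 2 * (1 / 2) * (N / 2) = T / 8] times at least, hence [mu = 8 / T]. *)
exists L, m.+1, (N - (L + 2))%N, ze, c2, (8 / T).
have qL : q ^+ L <= 1 / 2.
  rewrite qX; apply: (@le_trans _ _ (expR (- 1))); first by rewrite ler_expR lerN2.
  rewrite expRN div1r lef_pV2 ?posrE ?expR_gt0//.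
  by have := expR_ge1Dx (1 : R); lra.
split; first split.
- by move: L2; clear; lia.
- by case/andP: ze01 => -> /ltW ->.
- by rewrite /ze; lra.
- have : (1 - al) * (1 / 2) <= (1 - al) * (1 - q ^+ L).
    by apply: ler_wpM2l; move: al01 qL; lra.
  by rewrite /ze; lra.
split; first split=> //.
- by rewrite c20.
- rewrite qX /c2 ler_expR lerN2 natrM -mulrA mulrC ler_wpM2r//.
- by move: L2; clear; lia.
split.
- by rewrite divr_ge0// ltW.
- have qD : 1 / 2 <= q ^+ D.
    by rewrite qX; have := expR_ge1Dx (- (D%:R * h)); move: hD; lra.
  have q2 : 1 / 2 <= q by have := expR_ge1Dx (- h); rewrite -/q; move: h2; lra.
  have p2 : h / 2 <= 1 - q.
    have : q * (1 + h) <= 1.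
      have : q * (1 + h) <= q * expR h by apply: ler_wpM2l (expR_ge1Dx h); exact: expR_ge0.
      by rewrite /q -expRD addNr expR0.
    by have := ler_wpM2r (ltW h0) q2; lra.
  have A : h / 2 * (1 / 2) * (N%:R / 2) <= (1 - q) * q ^+ D * (N - (L + 2))%:R.
    have h20 : 0 <= h / 2 by rewrite divr_ge0// ltW.
    have half0 : 0 <= 1 / 2 :> R by rewrite divr_ge0.
    by apply: ler_pM (ler_pM h20 half0 p2 qD) N2R => //; rewrite mulr_ge0.
  have A' : T / 8 <= (1 - q) * q ^+ D * (N - (L + 2))%:R.
    by apply: le_trans A; rewrite -hN; lra.
  have := ler_wpM2l (divr_ge0 (ler0n R 8) (ltW T0)) A'.
  by rewrite (_ : 8 / T * (T / 8) = 1)//; field; rewrite gt_eqF.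
- have -> : (1 - al * ze ^+ m.+1) / m.+1%:R * (m.+1%:R * (c2 / 6)) = (1 - al * ze ^+ m.+1) * (c2 / 6).
    have m0 : m.+1%:R != 0 :> R by rewrite pnatr_eq0.
    by move: (1 - _) (m.+1%:R : R) m0 => a b b0; field.
  have aze : al * ze ^+ m.+1 <= 1 / 2.
    apply: le_trans (_ : 1 * ze ^+ m.+1 <= _); last by rewrite mul1r; lra.
    by rewrite ler_wpM2r ?exprn_ge0//; move: al01 ze01; lra.
  have : 1 / 2 * (c2 / 6) <= (1 - al * ze ^+ m.+1) * (c2 / 6) by rewrite ler_wpM2r; lra.
  have : 8 / T * C <= c2 / 24.
    rewrite mulrAC ler_pdivrMr//; have : 192 * C / c2 <= T by move: T1; lra.
    by rewrite ler_pdivrMr//; lra.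
  by rewrite -/C /al; lra.
Qed.

(** * Starting vertices with disjoint subtrees *)

Section Roots.
Variables (V : eqType) (r : V) (parent : V -> V).
Hypothesis tree : rooted_tree r parent.
Variable ch : V -> seq V.
Hypothesis chP : forall x u, (u \in ch x) = (u != r) && (parent u == x).
Hypothesis uch : forall x, uniq (ch x).
Hypothesis ch2 : forall x, (2 <= size (ch x))%N.

Local Notation dep := (dep tree).
Local Notation desc := (desc parent).

(** One more vertex per generation is enough: the first child of each vertex, and the second child
    of one of them. Depth starts at 1 to avoid the root, which has no edge above it. *)
Lemma antichain k : exists vs, [/\ size vs = k.+1, uniq vs & forall v, v \in vs -> dep v = k.+1].
Proof.
have c1 x : nth r (ch x) 0 \in ch x by apply: mem_nth; apply: leq_trans (ch2 x).
have c2 x : nth r (ch x) 1 \in ch x by apply: mem_nth; exact: ch2.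
have p1 : cancel (fun x => nth r (ch x) 0) parent by move=> x; exact: (ch_parent chP (c1 x)).
elim: k => [|k [vs [sz uv dv]]].
  exists [:: nth r (ch r) 0]; split=> // v; rewrite inE => /eqP->.
  by rewrite (ch_dep tree chP (c1 r)) dep_r.
case: vs sz uv dv => // v vs sz uv dv.
exists (nth r (ch v) 1 :: [seq nth r (ch x) 0 | x <- v :: vs]); split.
- by rewrite /= size_map; move: sz => /= ->.
- rewrite cons_uniq (map_inj_uniq (can_inj p1)) uv andbT; apply/negP => /mapP[x _ e].
  have vx : v = x by rewrite -(p1 x) -e (ch_parent chP (c2 v)).
  move: e; rewrite -vx => /eqP; rewrite nth_uniq// ?ch2//.
  by apply: leq_trans (ch2 v).
- move=> u; rewrite inE => /orP[/eqP->|/mapP[x xs ->]].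
    by rewrite (ch_dep tree chP (c2 v)) dv ?mem_head.
  by rewrite (ch_dep tree chP (c1 x)) dv.
Qed.

Lemma same_dep_ndesc v v' : dep v = dep v' -> v != v' -> ~~ desc v v'.
Proof.
move=> e ne; apply/negP => vv'.
by have := desc_dep tree vv' ; rewrite eq_sym e ltnn => /(_ ne).
Qed.

End Roots.

(** * Many walks at once, and passage to the limit *)

Section Main.
Context (d : measure_display) (Om : measurableType d) (R : realType).
Variable P : probability Om R.
Variables (V : eqType) (r : V) (parent : V -> V).
Hypothesis tree : rooted_tree r parent.
Variable ch : V -> seq V.
Hypothesis chP : forall x u, (u \in ch x) = (u != r) && (parent u == x).
Hypothesis uch : forall x, uniq (ch x).
Variable D : nat.
Hypothesis chD : forall x, (2 <= size (ch x) <= D)%N.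
Variable tau : tedge r -> nat -> Om -> R.
Hypothesis mtau : forall e k, measurable_fun setT (tau e k).
Hypothesis itau : mutually_independent P (fun ek : tedge r * nat => tau ek.1 ek.2).
Hypothesis etau : forall e k, exp1_distributed P (tau e k).
Variable e0 : tedge r.
Variable T : R.
Hypothesis T0 : 0 < T.

Local Notation dep := (dep tree).
Local Notation desc := (desc parent).
Local Notation XV N0 := (XV tau e0 T0 N0).

(** Induction on the starting vertices: the joint failure of the tail is the event [FF] for the
    exploration from [v], which reads only bits in the subtree of [v], disjoint from the others. *)
Lemma multi_fail (al : R) N (N0 : (0 < N)%N) n M vs : 0 < al < 1 ->
  params D (expR (- (T / N%:R))) N al ->
  uniq vs -> all (fun v => v != r) vs ->
  (forall v v', v \in vs -> v' \in vs -> v != v' -> ~~ desc v v') ->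
  forall s, wf (fun c => (c.1 != r) && all (fun v => ~~ desc v c.1) vs) s ->
  bnd P (XV N0) (expR (- (T / N%:R))) s
    [set w | forall v, v \in vs -> fail tree ch (XV N0) N n v M [::] (v, 0%N) w] (al ^+ size vs).
Proof.
move=> al01 [L [m' [N2 [ze [c2 [mu [[LN ze01 alze vvL] [[m'0 c201 c2q N2N N20] [mu0 muN st]]]]]]]]].
have q01 : 0 < expR (- (T / N%:R)) < 1.
  rewrite expR_gt0 /= -[ltRHS]expR0 ltr_expR oppr_lt0 divr_gt0// ltr0n//.
have q01' : 0 <= expR (- (T / N%:R)) <= 1 by case/andP: q01 => /ltW -> /ltW ->.
have al0 : 0 <= al by case/andP: al01 => /ltW.
elim: vs => [_ _ _ s /andP[us aw]|v vs IH /andP[vvs uvs] /= /andP[vr nr] inc s ws].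
  rewrite expr0 /bnd mul1r; apply: bd_sub (cylV_bd mtau itau etau e0 T0 N0 us _) => //.
  by apply/allP => c /(allP aw) /andP[].
have incs v1 v2 : v1 \in vs -> v2 \in vs -> v1 != v2 -> ~~ desc v1 v2.
  by move=> h1 h2; apply: inc; rewrite inE ?h1 ?h2 orbT.
set okc : pred (V * nat) := fun c => (c.1 != r) && all (fun v => ~~ desc v c.1) vs.
have okv u i : desc v u -> okc (u, i).
  move=> vu; rewrite /okc /= (desc_nr tree vr vu); apply/allP => v' v's; apply/negP => v'u.
  have ne : v != v' by apply: contraNneq vvs => ->.
  case/orP: (desc_cmp vu v'u); apply/negP.
    by apply: inc => //; rewrite inE ?eqxx ?v's ?orbT.
  by apply: inc; rewrite 1?eq_sym// inE ?eqxx ?v's ?orbT.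
have FFb := IH uvs nr incs.
have ws' : wf okc s.
  case/andP: ws => us aw; rewrite /wf us; apply: sub_all aw => c /= /andP[cr /andP[_ h]].
  by rewrite /okc cr.
have nov u i : desc v u -> get s (u, i) = None.
  move=> vu; apply/eqP; rewrite get_None; apply/negP => /(allP (proj2 (andP ws))) /=.
  by rewrite vu /= andbF.
have := explore_root tree chP uch n q01 vr okv (exprn_ge0 (size vs) al0) FFb LN al01 ze01 alze vvL m'0
  chD c201 c2q N2N N20 mu0 muN st M ws' nov.
rewrite exprSr; apply: bnd_sub => w _ H; split; first by apply: H; rewrite mem_head.
by move=> v' v's; apply: H; rewrite inE v's orbT.
Qed.

Local Notation ends := (@tends V r parent).

Variable M0 : nat.
Hypothesis M00 : (0 < M0)%N.
Hypothesis M0T : 4 * D%:R * T <= M0%:R.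
Hypothesis D0 : (0 < D)%N.

Definition Reg w := [/\ posw tau w,
  (forall e f t, rings tau w e t -> rings tau w f t -> t <= T -> e = f),
  (forall e, exists l : seq R, forall t, rings tau w e t -> t <= T -> t \in l) &
  (forall k t, (k < M0)%N -> exists L, forall u,
    clus parent (rings tau w) (k%:R * (T / M0%:R)) (k.+1%:R * (T / M0%:R)) t u -> dep u <> (dep t + L)%N)].

Let chD1 x : (size (ch x) <= D)%N. Proof. by case/andP: (chD x). Qed.

Lemma negl_Reg : P.-negligible [set w | ~ Reg w].
Proof.
pose perc k t0 w := posw tau w /\ forall Lg, exists u,
   clus parent (rings tau w) (k%:R * (T / M0%:R)) (k.+1%:R * (T / M0%:R)) t0 u /\ dep u = (dep t0 + Lg)%N.
have np : P.-negligible (\bigcup_k [set w | (k < M0)%N /\ exists t0, perc k t0 w]).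
  apply: negligible_bigcup => k; case: (ltnP k M0) => kM; last first.
    by apply: (@negligibleS _ _ _ _ set0); [move=> w []|exact: negligible_set0].
  have H t0 : P.-negligible [set w | perc k t0 w].
    exact: (negl_perc tree chP chD1 mtau itau etau e0 T0 M00 M0T D0 t0 kM).
  have H' := negl_V tree chP (fun u (_ : u != r) => H u).
  apply: (negligibleS _ (negligibleU (H r) H')) => w [_ [t0 p0]].
  by case: (eqVneq t0 r) => [<-|tr]; [left|right; exists t0].
have n1 := negl_pos tree chP mtau etau e0.
have n2 := negl_nosim tree chP mtau itau etau e0 T0.
have n3 := negl_frings tree chP mtau itau etau e0 T0.
apply: (negligibleS _ (negligibleU (negligibleU n1 n2) (negligibleU n3 np))) => w nR.
apply: contrapT => /not_orP[/not_orP[/contrapT pw h2] /not_orP[h3 h4]]; apply: nR; split=> //.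
- move=> [u ur] [u' ur'] t re rf tT; apply: contrapT => ne; apply: h2; split=> //.
  exists u; first exact/eqP.
  exists u'; first exact/eqP.
  split; first by apply/eqP => e; apply: ne; exact: sval_inj.
  by exists t => //; split; [exists ur|exists ur'].
- move=> e.
  have [K SK] : exists K, T < Sarr tau e0 (sval e) K w.
    apply: contrapT => /forallNP nK; apply: h3; split=> //; exists (sval e); first exact: sval_nr.
    by move=> K; rewrite leNgt; apply/negP; exact: nK.
  exists [seq arrival tau e k w | k <- iota 0 K] => t [k <-] tT; apply: map_f.
  rewrite mem_iota /= add0n ltnNge; apply/negP => Kk.
  have : Sarr tau e0 (sval e) K w <= Sarr tau e0 (sval e) k w.
    by move: Kk; rewrite leq_eqVlt => /orP[/eqP->//|/(Sarr_lt e0 (sval e) pw)/ltW].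
  by rewrite {2}/Sarr edge_of leNgt (le_lt_trans tT SK).
- move=> k t kM; apply: contrapT => /forallNP nL; apply: h4; exists k => //; split=> //; exists t; split=> // Lg.
  have /existsNP[u] := nL Lg; move=> /not_implyP[cu /contrapT du]; by exists u.
Qed.

Definition far n (vs : seq V) w := exists2 sg : V -> V,
  (forall y, stirring_path ends (rings tau w) T y (sg y)) &
  exists2 v, v \in vs & exists l x s, reach ends (rings tau w) T (iter l sg v, 0) (x, s) /\ (n <= dep x)%N.

(** One [al ^+ size vs] pays for the discretisation and one for the failure of all walks. [N] is
    taken large depending on [n], so it matters that [al] depends on neither. *)
Lemma far_bd (al : R) vs k n : 0 < al < 1 ->
  (exists N1, forall N, (N1 <= N)%N -> params D (expR (- (T / N%:R))) N al) ->
  uniq vs -> (forall v, v \in vs -> dep v = k.+1) -> (k.+1 < n)%N ->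
  bd P [set w | Reg w /\ ~ far n vs w] (al ^+ size vs + al ^+ size vs).
Proof.
move=> al01 [N1 HN1] uv dv kn.
pose U := flatten [seq dl ch r j | j <- iota 1 n].
have memU u : (u \in U) = (0 < dep u <= n)%N.
  apply/flatten_mapP/idP => [[j]|du].
    rewrite mem_iota (dlP tree chP) dep_r add0n => jn /andP[_ /eqP ->].
    by move: jn; clear; lia.
  exists (dep u); first by rewrite mem_iota; move: du; clear; lia.
  by rewrite (dlP tree chP) desc_r//= dep_r add0n.
have nrU : all (fun u => u != r) U.
  by apply/allP => u; rewrite memU; apply: contraTneq => ->; rewrite dep_r.
have alk : 0 < al ^+ size vs by rewrite exprn_gt0//; case/andP: al01.
have [K [N3 [N30 HB]]] := Bad_small mtau itau etau e0 T0 nrU alk.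
pose N := maxn N1 N3.
have N0 : (0 < N)%N by apply: leq_trans N30 _; exact: leq_maxr.
have bB := HB N N0 (leq_maxr _ _).
have par := HN1 N (leq_maxl _ _).
pose M := (\max_(v <- vs) (size (flatten [seq dl ch v j | j <- iota 0 n]) * N)).+1.
have nrv v : v \in vs -> v != r.
  by move=> /dv; apply: contra_eq_neq => ->; rewrite dep_r.
have nrvs : all (fun v => v != r) vs by apply/allP.
have inc v v' : v \in vs -> v' \in vs -> v != v' -> ~~ desc v v'.
  by move=> /dv e /dv e'; apply: (@same_dep_ndesc _ _ _ tree); rewrite e e'.
have bF := multi_fail N0 n M al01 par uv nrvs inc (s := [::]) isT.
rewrite /bnd /pc big_nil mulr1 in bF.
apply: bd_sub (bd_setU bB bF) => // w [[pw nosim fr pe] nfar].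
apply: contrapT => /not_orP[nB nF]; apply: nfar.
have [sg [_ sgP _]] := flow_exists chP T0 M00 e0 nosim fr pe.
exists sg => //.
have [v vvs nf] : exists2 v, v \in vs & ~~ fail tree ch (XV N0) N n v M [::] (v, 0%N) w.
  apply: contrapT => H; apply: nF; split=> // v vvs; apply: contrapT => /negP nf.
  by apply: H; exists v.
exists v => //.
have [sl [E1 E2 E3 E4]] := good_link nrU pw nB.
have sgP' y : exists s, reach ends (rings tau w) T (y, 0) (sg y, s) /\ final ends (rings tau w) T (sg y, s).
  by have /(stirring_reach _ _ _ e0) := sgP y.
have EU x u : desc v x -> (dep x < n)%N -> u \in edges ch x -> u \in U.
  move=> vx xn; rewrite memU inE => /orP[/eqP->|ux].
    by have := desc_dep_le tree vx; rewrite dv//; move: xn; clear; lia.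
  by rewrite (ch_dep tree chP ux).
have H1 : inreg tree N n v (v, 0%N) by split; rewrite /= ?desc_refl ?dv.
have H2 : exists l s, at_slot parent ch (rings tau w) T N v sg (XV N0) w sl (fun u => u \in U) l v s 0.
  exists 0%N, 0; split; [exact: reach_refl|by left|].
  move=> u t ue ru t0 tT.
  have uU : u \in U by apply: EU ue; rewrite ?desc_refl ?dv.
  by have [i [iN Xi si]] := E2 u t uU ru tT; exists i.
have H3 p : p \in [:: (v, 0%N)] -> p != (v, 0%N) ->
    exists2 p0, p0 \in [::] & stp parent ch N (XV N0) w p0 p.
  by rewrite inE => /eqP->; rewrite eqxx.
have H4 : (size (flatten [seq dl ch v j | j <- iota 0 n]) * N < size (@nil (V * nat)) + M)%N.
  rewrite add0n ltnS.
  exact: (@leq_bigmax_seq _ _ xpredT (fun v => (size (flatten [seq dl ch v j | j <- iota 0 n]) * N)%N) v).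
have H5 p : p \in [::] -> inreg tree N n v p by [].
exact: (fail_reach chP uch N0 (nrv v vvs) nosim sgP' E1 E2 E3 E4 EU H1 H5 isT isT H3 H2 H4 nf).
Qed.

Lemma In_bound (A : Type) (f : A -> nat) (l : seq A) : exists B, forall x, List.In x l -> (f x < B)%N.
Proof.
elim: l => [|a l [B HB]]; first by exists 0%N.
exists (maxn (f a).+1 B) => x /= [<-|/HB]; rewrite leq_max; first by rewrite leqnn.
by move=> ->; rewrite orbT.
Qed.

(** A finite cycle is traced by finitely many trajectories over [[0, T]], each of which makes
    finitely many jumps. *)
Lemma finite_cycle_bound w sg v : (forall e f t, rings tau w e t -> rings tau w f t -> t <= T -> e = f) ->
  (forall y, stirring_path ends (rings tau w) T y (sg y)) ->
  (exists l : list V, forall x, cycle_of sg v x -> List.In x l) ->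
  exists B, forall l x s, reach ends (rings tau w) T (iter l sg v, 0) (x, s) -> (dep x < B)%N.
Proof.
move=> nosim sgP [l Hl].
have /choice[b Hb] y : exists B, forall c, reach ends (rings tau w) T (y, 0) c -> (dep c.1 < B)%N.
  have /(stirring_reach _ _ _ e0) [s [ry fy]] := sgP y.
  have [ly Hy] := reach_finite (tends_noloop tree) nosim ry fy.
  by have [B HB] := In_bound dep ly; exists B => c /Hy /HB.
have [B HB] := In_bound b l; exists B => k x s rx.
have xl : List.In (iter k sg v) l by apply: Hl; exists k; left.
exact: (ltn_trans (Hb _ _ rx) (HB _ xl)).
Qed.

Lemma stirring_infinite (al : R) : 0 < al < 1 ->
  (exists N1, forall N, (N1 <= N)%N -> params D (expR (- (T / N%:R))) N al) ->
  P.-negligible [set w | ~ stirring_has_infinite_cycle ends (rings tau w) T].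
Proof.
move=> al01 par.
suff H : P.-negligible [set w | Reg w /\ ~ stirring_has_infinite_cycle ends (rings tau w) T].
  apply: (negligibleS _ (negligibleU negl_Reg H)) => w nw.
  by have [rw|nr] := pselect (Reg w); [right|left].
apply: bd_negligible => e e1.
have al01' : 0 <= al < 1 by case/andP: al01 => /ltW -> ->.
have [k Hk] := pow_small al01' (divr_gt0 e1 (ltr0n R 2)).
have ch2 x : (2 <= size (ch x))%N by case/andP: (chD x).
have [vs [sv uv dv]] := antichain tree chP uch ch2 k.
have Hv : al ^+ size vs + al ^+ size vs <= e.
  have : al ^+ size vs <= al ^+ k by rewrite sv; apply: ler_wiXn2l => //; move: al01; lra.
  by move: Hk; lra.
(* The shift by [k.+2] keeps the target deeper than the starting vertices for every [m]. *)
have B m := far_bd (n := m + k.+2) al01 par uv dv (leq_addl _ _).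
apply: (bd_sub _ Hv (bd_incr _ B)); last first.
  move=> n m nm w [rw nf]; split=> //; apply: contra_not nf => -[sg sgP [v vvs [l [x [s [rx dx]]]]]].
  exists sg => //; exists v => //; exists l, x, s; split=> //; apply: leq_trans dx.
  by rewrite leq_add2r.
move=> w [rw nI]; have [pw nosim fr pe] := rw.
have [sg [bsg sgP usg]] := flow_exists chP T0 M00 e0 nosim fr pe.
have fin v : exists l : list V, forall x, cycle_of sg v x -> List.In x l.
  by apply: contrapT => nl; apply: nI; exists sg; split=> //; exists v.
have /choice[b Hb] v := finite_cycle_bound nosim sgP (fin v).
(* If all cycles are finite, the trajectories from [vs] stay above this depth, so the event occurs
   from there on; by uniqueness [sg'] is the flow itself. *)
exists (\max_(v <- vs) b v)%N => //; split=> // -[sg' sgP' [v vvs [l [x [s [rx dx]]]]]].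
rewrite (usg _ sgP') in rx.
have := Hb v l x s rx; rewrite ltnNge => /negP; apply.
apply: leq_trans dx; apply: leq_trans (leq_addr _ _).
exact: (@leq_bigmax_seq _ _ xpredT b v).
Qed.

End Main.

Lemma mem_In (V : eqType) (x : V) (l : seq V) : List.In x l -> x \in l.
Proof. by elim: l => //= a l IH [->|/IH h]; rewrite inE ?eqxx ?h ?orbT. Qed.

Lemma children_list (V : eqType) (r : V) (parent : V -> V) :
  uniformly_bounded_degree r parent -> at_least_two_offspring r parent ->
  exists2 D, (0 < D)%N & exists ch : V -> seq V,
    [/\ (forall x u, (u \in ch x) = (u != r) && (parent u == x)), (forall x, uniq (ch x)) &
       forall x, (2 <= size (ch x) <= D)%N].
Proof.
move=> [D HD] two.
have /choice[f Hf] := HD.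
pose ch v := undup [seq u <- f v | (u != r) && (parent u == v)].
have chP x u : (u \in ch x) = (u != r) && (parent u == x).
  rewrite mem_undup mem_filter andbC; apply: andb_idl => /andP[/eqP ur /eqP pu].
  by apply: mem_In; apply: (Hf x).2; left.
have uch x : uniq (ch x) by exact: undup_uniq.
have sz x : (2 <= size (ch x) <= D)%N.
  apply/andP; split.
    have [w1 [w2 [ne [[h1 h1'] [h2 h2']]]]] := two x.
    apply: (@uniq_leq_size _ [:: w1; w2]).
      by rewrite /= inE andbT; exact/eqP.
    move=> u; rewrite !inE chP => /orP[] /eqP->; apply/andP; split; exact/eqP.
  apply: leq_trans (Hf x).1; apply: leq_trans (size_undup _) _.
  by rewrite size_filter count_size.
exists D; last by exists ch.
by have := sz r; clear; lia.
Qed.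

Theorem theorem1 (R : realType) (V : Type) (r : V) (parent : V -> V) :
  rooted_tree r parent ->
  infinite_vertex_set V ->
  uniformly_bounded_degree r parent ->
  at_least_two_offspring r parent ->
  exists T0 : R, 0 < T0 /\
    forall T : R, T0 <= T ->
    forall (d : measure_display) (Omega : measurableType d)
           (P : probability Omega R) (tau : tedge r -> nat -> Omega -> R),
      (forall e k, measurable_fun setT (tau e k)) ->
      mutually_independent P (fun ek : tedge r * nat => tau ek.1 ek.2) ->
      (forall e k, exp1_distributed P (tau e k)) ->
      exists A : set Omega,
        [/\ measurable A, P A = 1%E &
            A `<=` [set w | stirring_has_infinite_cycle
                              (tends parent) (rings tau w) T]].
Proof.
move=> tree _ deg two.
have [D D0 [ch [chP uch chD]]] := @children_list {classic V} r parent deg two.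
have [al [T1 [al01 T10 HT]]] := @params_exist R D D0.
exists T1; split=> // T TT d Om P tau mtau itau etau.
have T0 : 0 < T := lt_le_trans T10 TT.
(* An offspring of the root supplies the default edge. *)
have [x [_ [_ [[xr _] _]]]] := two r.
pose M0 := (Num.bound (4 * D%:R * T)).+1.
have M0T : 4 * D%:R * T <= M0%:R.
  apply/ltW; apply: lt_le_trans (_ : (Num.bound (4 * D%:R * T))%:R <= _).
    by apply: archi_boundP; rewrite !mulr_ge0// ltW.
  by rewrite ler_nat.
have [B [mB PB HB]] := @stirring_infinite d Om R P {classic V} r parent tree ch chP uch D chD tau
  mtau itau etau (exist _ x xr) T T0 M0 isT M0T D0 al al01 (HT T TT).
exists (~` B); split; first exact: measurableC.
  by rewrite probability_setC// PB sube0.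
by move=> w nBw; apply: contrapT => nw; apply: nBw; exact: HB.
Qed.
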